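(* Let $R$ be a skew-invertible Hecke symmetry and $\mathbf{Y}(R)$ the corresponding braided Yangian with generating matrix $L(u)$. The elementary symmetric polynomials $e_k(u)$ and the power sums $p_k(u)=\mathrm{Tr}_R(L^{[k]}(u))$ are connected by the Newton identities: for all $k\ge1$, $$k_qe_k(u)-q^{k-1}p_1(q^{-2(k-1)}u)e_{k-1}(u)+q^{k-2}p_2(q^{-2(k-2)}u)e_{k-2}(u)+\dots+(-1)^kp_k(u)=0,$$ i.e. $k_qe_k(u)+\sum_{j=1}^{k}(-1)^{j}q^{k-j}p_j(q^{-2(k-j)}u)e_{k-j}(u)=0$.
   Context: Conventions. $V$ is an $N$-dimensional vector space over $\mathbb{K}=\mathbb{R}$ or $\mathbb{C}$ with a fixed basis $\{x_i\}$. An operator $R$ on $V^{\otimes 2}$ has matrix given by $R(x_i\otimes x_j)=R_{ij}^{ks}x_k\otimes x_s$ (summation over repeated indices); matrix products are $(AB)_i^j=A_i^kB_k^j$. $R_k=R_{k\,k+1}$ is $R$ acting in tensor factors $k,k+1$; lower indices on operators indicate the tensor factors where they act; $L_1=L\otimes I$. Hecke symmetry: $R$ satisfies $R_{12}R_{23}R_{12}=R_{23}R_{12}R_{23}$ and $(qI-R)(q^{-1}I+R)=0$, with $q\in\mathbb{K}$ nonzero and generic ($q^n\neq 1$ for all nonzero integers $n$). Put $k_q=\frac{q^k-q^{-k}}{q-q^{-1}}$. Skew-invertible: there is $\Psi$ on $V^{\otimes 2}$ with $R_{ij}^{kl}\Psi_{lp}^{jq'}=\delta_i^{q'}\delta_p^k$.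 Put $C_i^j=\Psi_{ik}^{jk}$; $\mathrm{Tr}_R(X)=\mathrm{Tr}(XC)=C_i^jX_j^i$ for a matrix $X$ with entries in any algebra, and $\mathrm{Tr}_{R(a\dots b)}$ is the $R$-trace over tensor factors $a,\dots,b$. Skew-symmetrizers: $\mathcal{P}^{(1)}=I$, $\mathcal{P}^{(k+1)}_{1\dots k+1}=\frac{k_q}{(k+1)_q}\mathcal{P}^{(k)}_{1\dots k}\big(\frac{q^k}{k_q}I-R_k\big)\mathcal{P}^{(k)}_{1\dots k}$. Braided Yangian: let $R(u,v)=R-\frac{u(q-q^{-1})}{u-v}I$. $\mathbf{Y}(R)$ is the unital associative algebra generated by the entries $l_i^j[k]$ ($k\ge1$) of matrices $L[k]$, where $L(u)=\sum_{k\ge0}L[k]u^{-k}$, $L[0]=I$, subject to the relations obtained by expanding $R(u,v)L_1(u)RL_1(v)=L_1(v)RL_1(u)R(u,v)$. Notation: $L_{\overline1}(u)=L_1(u)$, $L_{\overline{k+1}}(u)=R_kL_{\overline k}(u)R_k^{-1}$. Elementary symmetric polynomials: $e_0(u)=1$, $e_k(u)=\mathrm{Tr}_{R(1\dots k)}\big(\mathcal{P}^{(k)}_{1\dots k}L_{\overline1}(u)L_{\overline2}(q^{-2}u)\cdots L_{\overline k}(q^{-2(k-1)}u)\big)$ for $k\ge1$. Matrix powers: $L^{[k]}(u)=\mathrm{Tr}_{R(2\dots k)}\big(L_{\overline1}(q^{-2(k-1)}u)L_{\overline2}(q^{-2(k-2)}u)\cdots L_{\overline k}(u)R_{k-1}\cdots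 R_2R_1\big)$, $k\ge1$; this equals $L(q^{-2(k-1)}u)L(q^{-2(k-2)}u)\cdots L(u)$. *)

(* Defs.v *)
From HB Require Import structures.
From mathcomp Require Import all_boot all_order all_algebra.
From mathcomp Require Import boolp reals complex monalg.

Set Implicit Arguments.
Unset Strict Implicit.
Unset Printing Implicit Defensive.

Import GRing.Theory.
Local Open Scope ring_scope.
Local Open Scope quotient_scope.

(* [Series s] is the formal power series \sum_k s k * u^{-k} in u^{-1}. *)

Record series (A : Type) : Type := Series { scoef : nat -> A }.

HB.instance Definition _ (A : Type) := gen_eqMixin (series A).
HB.instance Definition _ (A : Type) := gen_choiceMixin (series A).

Lemma seriesP (A : Type) (s t : series A) :
  (forall n, scoef s n = scoef t n) -> s = t.
Proof. by case: s t => s [t] /= st; congr Series; apply/funext. Qed.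

Section SeriesZmod.
Variable A : zmodType.
Implicit Types s t : series A.

Definition series_zero : series A := Series (fun _ => 0).
Definition series_opp s : series A := Series (fun n => - scoef s n).
Definition series_add s t : series A := Series (fun n => scoef s n + scoef t n).

Fact series_addA : associative series_add.
Proof. by move=> s t v; apply/seriesP => n /=; rewrite addrA. Qed.
Fact series_addC : commutative series_add.
Proof. by move=> s t; apply/seriesP => n /=; rewrite addrC. Qed.
Fact series_add0 : left_id series_zero series_add.
Proof. by move=> s; apply/seriesP => n /=; rewrite add0r. Qed.
Fact series_addN : left_inverse series_zero series_opp series_add.
Proof. by move=> s; apply/seriesP => n /=; rewrite addNr. Qed.

HB.instance Definition _ := GRing.isZmodule.Build (series A)
  series_addA series_addC series_add0 series_addN.
End SeriesZmod.

Section SeriesRing.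
Variable A : nzRingType.
Implicit Types s t : series A.

Definition series_one : series A := Series (fun n => (n == 0%N)%:R).
Definition series_mul s t : series A :=
  Series (fun n => \sum_(i < n.+1) scoef s i * scoef t (n - i)).

Let trunc n s : {poly A} := \poly_(i < n.+1) scoef s i.

Let coef_mul_trunc n m s t : (n <= m)%N ->
  scoef (series_mul s t) n = (trunc m s * trunc m t)`_n.
Proof.
move=> nm; rewrite coefM; apply: eq_bigr => i _; rewrite !coef_poly.
by rewrite !ltnS (leq_trans (leq_subr _ _) nm) (leq_trans (leq_ord i) nm).
Qed.

Fact series_mulA : associative series_mul.
Proof.
move=> s t v; apply/seriesP => n.
transitivity ((trunc n s * (trunc n t * trunc n v))`_n).
  rewrite coefM; apply: eq_bigr => i _.
  by rewrite coef_poly ltn_ord -coef_mul_trunc ?leq_subr.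
rewrite mulrA coefM; apply: eq_bigr => i _.
by rewrite -coef_mul_trunc ?leq_ord // coef_poly ltnS leq_subr.
Qed.

Fact series_mul1l : left_id series_one series_mul.
Proof.
move=> s; apply/seriesP => n /=; rewrite big_ord_recl /= mul1r subn0.
by rewrite big1 ?addr0 // => i _; rewrite mul0r.
Qed.

Fact series_mul1r : right_id series_one series_mul.
Proof.
move=> s; apply/seriesP => n /=; rewrite big_ord_recr /= subnn mulr1.
rewrite big1 ?add0r // => i _.
by rewrite subn_eq0 leqNgt ltn_ord mulr0.
Qed.

Fact series_mulDl : left_distributive series_mul +%R.
Proof.
move=> s t v; apply/seriesP => n /=; rewrite -big_split /=.
by apply: eq_bigr => i _; rewrite mulrDl.
Qed.

Fact series_mulDr : right_distributive series_mul +%R.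
Proof.
move=> s t v; apply/seriesP => n /=; rewrite -big_split /=.
by apply: eq_bigr => i _; rewrite mulrDr.
Qed.

Fact series_1neq0 : series_one != 0.
Proof.
apply/eqP => /(congr1 (fun s => scoef s 0%N)) /= /eqP.
by rewrite oner_eq0.
Qed.

HB.instance Definition _ := GRing.Zmodule_isNzRing.Build (series A)
  series_mulA series_mul1l series_mul1r series_mulDl series_mulDr series_1neq0.
End SeriesRing.

Section SeriesAlg.
Variables (K : fieldType) (A : algType K).
Implicit Types s t : series A.

Definition series_scale (c : K) s : series A :=
  Series (fun n => c *: scoef s n).

Fact series_scaleA a b s :
  series_scale a (series_scale b s) = series_scale (a * b) s.
Proof. by apply/seriesP => n /=; rewrite scalerA. Qed.
Fact series_scale1 : left_id 1 series_scale.
Proof. by move=> s; apply/seriesP => n /=; rewrite scale1r. Qed.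
Fact series_scaleDr : right_distributive series_scale +%R.
Proof. by move=> a s t; apply/seriesP => n /=; rewrite scalerDr. Qed.
Fact series_scaleDl s : {morph series_scale^~ s : a b / a + b}.
Proof. by move=> a b; apply/seriesP => n /=; rewrite scalerDl. Qed.

HB.instance Definition _ := GRing.Zmodule_isLmodule.Build K (series A)
  series_scaleA series_scale1 series_scaleDr series_scaleDl.

Fact series_scaleAl (a : K) (s t : series A) : a *: (s * t) = (a *: s) * t.
Proof.
apply/seriesP => n /=; rewrite scaler_sumr.
by apply: eq_bigr => i _; rewrite scalerAl.
Qed.

HB.instance Definition _ :=
  GRing.Lmodule_isLalgebra.Build K (series A) series_scaleAl.

Fact series_scaleAr (a : K) (s t : series A) : a *: (s * t) = s * (a *: t).
Proof.
apply/seriesP => n /=; rewrite scaler_sumr.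
by apply: eq_bigr => i _; rewrite scalerAr.
Qed.

HB.instance Definition _ :=
  GRing.Lalgebra_isAlgebra.Build K (series A) series_scaleAr.

(* s(c u), as a series in u^{-1} *)
Definition dilate (c : K) s : series A := Series (fun n => c ^- n *: scoef s n).
End SeriesAlg.

Section AlgebraQuotient.
Variables (K : fieldType) (A : algType K) (S : A -> Prop).

Inductive two_sided_ideal : A -> Prop :=
| ideal_gen x of S x : two_sided_ideal x
| ideal_zero : two_sided_ideal 0
| ideal_add x y of two_sided_ideal x & two_sided_ideal y :
    two_sided_ideal (x + y)
| ideal_mull a x of two_sided_ideal x : two_sided_ideal (a * x)
| ideal_mulr a x of two_sided_ideal x : two_sided_ideal (x * a).

Definition ideal_pred : {pred A} := fun x => `[< two_sided_ideal x >].

Fact ideal_predP x : reflect (two_sided_ideal x) (x \in ideal_pred).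
Proof. exact: asboolP. Qed.

Fact ideal_zmod_closed : zmod_closed ideal_pred.
Proof.
split=> [|x y /ideal_predP Ix /ideal_predP Iy]; apply/ideal_predP.
  exact: ideal_zero.
by apply: ideal_add => //; rewrite -mulN1r; apply: ideal_mull.
Qed.

HB.instance Definition _ := GRing.isZmodClosed.Build A ideal_pred
  ideal_zmod_closed.

(* Only used to make the quotient a non-trivial ring, as algType requires. *)
Hypothesis proper : ~ two_sided_ideal 1.

Definition alg_quot := let _ := proper in Quotient.quot ideal_pred.

HB.instance Definition _ := GRing.Zmodule.on alg_quot.

Definition quot_pi (x : A) : alg_quot := \pi_(Quotient.quot ideal_pred) x.

Lemma quot_piP x y : quot_pi x = quot_pi y <-> two_sided_ideal (x - y).
Proof.
split=> [/eqP|I]; first by rewrite -Quotient.idealrBE => /ideal_predP.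
by apply/eqP; rewrite -Quotient.idealrBE; apply/ideal_predP.
Qed.

Let quot_repr (x : alg_quot) : A := repr (x : Quotient.quot ideal_pred).

Let quot_reprK x : quot_pi (quot_repr x) = x.
Proof. exact: reprK. Qed.

Let quot_piD x y : quot_pi (x + y) = quot_pi x + quot_pi y.
Proof. exact: (raddfD (\pi_(Quotient.quot ideal_pred))). Qed.

Definition quot_one : alg_quot := quot_pi 1.
Definition quot_mul (x y : alg_quot) : alg_quot :=
  quot_pi (quot_repr x * quot_repr y).
Definition quot_scale (c : K) (x : alg_quot) : alg_quot :=
  quot_pi (c *: quot_repr x).

Let ideal_repr x : two_sided_ideal (quot_repr (quot_pi x) - x).
Proof. by apply/quot_piP; rewrite quot_reprK. Qed.

Let pi_mul x y : quot_pi (x * y) = quot_mul (quot_pi x) (quot_pi y).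
Proof.
apply/esym/quot_piP.
set x' := quot_repr _; set y' := quot_repr _.
have -> : x' * y' - x * y = (x' - x) * y' + x * (y' - y).
  by rewrite mulrBl mulrBr addrA subrK.
by apply: ideal_add; [apply: ideal_mulr|apply: ideal_mull]; apply: ideal_repr.
Qed.

Let pi_scale c x : quot_pi (c *: x) = quot_scale c (quot_pi x).
Proof.
apply/esym/quot_piP; rewrite -scalerBr -mulr_algl.
by apply: ideal_mull; apply: ideal_repr.
Qed.

Fact quot_mulA : associative quot_mul.
Proof.
move=> x y z; rewrite -[x]quot_reprK -[y]quot_reprK -[z]quot_reprK.
by rewrite -!pi_mul mulrA.
Qed.
Fact quot_mul1l : left_id quot_one quot_mul.
Proof. by move=> x; rewrite -[x]quot_reprK -pi_mul mul1r. Qed.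
Fact quot_mul1r : right_id quot_one quot_mul.
Proof. by move=> x; rewrite -[x]quot_reprK -pi_mul mulr1. Qed.
Fact quot_mulDl : left_distributive quot_mul +%R.
Proof.
move=> x y z; rewrite -[x]quot_reprK -[y]quot_reprK -[z]quot_reprK.
by rewrite -!(pi_mul, quot_piD) mulrDl.
Qed.
Fact quot_mulDr : right_distributive quot_mul +%R.
Proof.
move=> x y z; rewrite -[x]quot_reprK -[y]quot_reprK -[z]quot_reprK.
by rewrite -!(pi_mul, quot_piD) mulrDr.
Qed.
Fact quot_1neq0 : quot_one != 0.
Proof.
apply/eqP => q10; apply: proper; rewrite -[1]subr0; apply/quot_piP.
by rewrite [LHS]q10; apply/esym/(raddf0 (\pi_(Quotient.quot ideal_pred))).
Qed.

HB.instance Definition _ := GRing.Zmodule_isNzRing.Build alg_quot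
  quot_mulA quot_mul1l quot_mul1r quot_mulDl quot_mulDr quot_1neq0.

Fact quot_scaleA a b x : quot_scale a (quot_scale b x) = quot_scale (a * b) x.
Proof. by rewrite -[x]quot_reprK -!pi_scale scalerA. Qed.
Fact quot_scale1 : left_id 1 quot_scale.
Proof. by move=> x; rewrite -[x]quot_reprK -pi_scale scale1r. Qed.
Fact quot_scaleDr : right_distributive quot_scale +%R.
Proof.
move=> a x y; rewrite -[x]quot_reprK -[y]quot_reprK.
by rewrite -!(pi_scale, quot_piD) scalerDr.
Qed.
Fact quot_scaleDl x : {morph quot_scale^~ x : a b / a + b}.
Proof.
by move=> a b; rewrite -[x]quot_reprK -!(pi_scale, quot_piD) scalerDl.
Qed.

HB.instance Definition _ := GRing.Zmodule_isLmodule.Build K alg_quot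
  quot_scaleA quot_scale1 quot_scaleDr quot_scaleDl.

Fact quot_scaleAl (a : K) (x y : alg_quot) : a *: (x * y) = (a *: x) * y.
Proof.
rewrite -[x]quot_reprK -[y]quot_reprK; do 2!rewrite /GRing.mul /GRing.scale /=.
by rewrite -!(pi_mul, pi_scale) scalerAl.
Qed.

HB.instance Definition _ :=
  GRing.Lmodule_isLalgebra.Build K alg_quot quot_scaleAl.

Fact quot_scaleAr (a : K) (x y : alg_quot) : a *: (x * y) = x * (a *: y).
Proof.
rewrite -[x]quot_reprK -[y]quot_reprK; do 2!rewrite /GRing.mul /GRing.scale /=.
by rewrite -!(pi_mul, pi_scale) scalerAr.
Qed.

HB.instance Definition _ :=
  GRing.Lalgebra_isAlgebra.Build K alg_quot quot_scaleAr.

Fact quot_pi_zmod_morphism : zmod_morphism quot_pi.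
Proof. exact: (raddfB (\pi_(Quotient.quot ideal_pred))). Qed.
Fact quot_pi_monoid_morphism : monoid_morphism quot_pi.
Proof. by split=> // x y; apply: pi_mul. Qed.
Fact quot_pi_scalable : scalable quot_pi.
Proof. by move=> c x; apply: pi_scale. Qed.

HB.instance Definition _ :=
  GRing.isZmodMorphism.Build A alg_quot quot_pi quot_pi_zmod_morphism.
HB.instance Definition _ :=
  GRing.isMonoidMorphism.Build A alg_quot quot_pi quot_pi_monoid_morphism.
HB.instance Definition _ :=
  GRing.isScalable.Build K A alg_quot *:%R quot_pi quot_pi_scalable.

End AlgebraQuotient.

Section FreeAlgebra.
Variables (K : fieldType) (G : choiceType).

Definition free_alg := {malg K[{fmonom G}]}.

HB.instance Definition _ := GRing.Lalgebra.on free_alg.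

Fact malg_scaleAr (a : K) (x y : {malg K[{fmonom G}]}) :
  a *: (x * y) = x * (a *: y).
Proof.
have xa : x * a%:MP = a%:MP * x.
  rewrite !malgM_def fgmulgU fgmulUg.
  by apply: eq_bigr => w _; rewrite mul1m mulm1 mulrC.
by rewrite -(mul_malgC a y) mulrA xa -mulrA mul_malgC.
Qed.

Fact free_scaleAr (a : K) (x y : free_alg) : a *: (x * y) = x * (a *: y).
Proof. exact: malg_scaleAr. Qed.

HB.instance Definition _ :=
  GRing.Lalgebra_isAlgebra.Build K free_alg free_scaleAr.

Definition free_gen (g : G) : free_alg := << fmu g >>.

Definition free_aug : free_alg -> K := @mcoeff {fmonom G} K mone.

Fact free_aug_zmod_morphism : zmod_morphism free_aug.
Proof. exact: raddfB. Qed.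
Fact free_aug_monoid_morphism : monoid_morphism free_aug.
Proof.
split; first exact: (rmorph1 (@mcoeff {fmonom G} K mone)).
exact: (rmorphM (@mcoeff {fmonom G} K mone)).
Qed.

HB.instance Definition _ :=
  GRing.isZmodMorphism.Build free_alg K free_aug free_aug_zmod_morphism.
HB.instance Definition _ :=
  GRing.isMonoidMorphism.Build free_alg K free_aug free_aug_monoid_morphism.

Fact free_aug_gen g : free_aug (free_gen g) = 0.
Proof.
rewrite /free_aug mcoeffU; case: eqP => // /(congr1 (@fdeg G)).
by rewrite fdeg1 fdegU.
Qed.

Fact free_aug_in_alg c : free_aug c%:A = c.
Proof. by rewrite /free_aug mcoeffZ mcoeff1 eqxx mulr1. Qed.
End FreeAlgebra.

(* Operators on V^{\otimes n.+1} as matrices with rows indexed by the lower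
   multi-index (i_1, ..., i_{n.+1}) and columns by the upper one; composition
   of matrices is (AB)_i^j = A_i^k B_k^j. Operators on V^{\otimes 2} itself are
   also given as 'M_(N * N), with X (mxvec_index i j) (mxvec_index k s) the
   entry X_{ij}^{ks}. *)

Notation tensor_op A N n := 'M[A]_#|{ffun 'I_n.+1 -> 'I_N}|.

Section TensorOperators.
Variables (A : nzRingType) (N n : nat).

Definition mindex (i : 'I_#|{ffun 'I_n.+1 -> 'I_N}|) : {ffun 'I_n.+1 -> 'I_N} :=
  enum_val i.

(* Tensor factors are numbered 1, ..., n.+1. *)
Definition factor (k : nat) : 'I_n.+1 := inord k.-1.

Definition act1 (k : nat) (X : 'M[A]_N) : tensor_op A N n :=
  let a := factor k in
  \matrix_(i, j)
    (X (mindex i a) (mindex j a)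
       *+ [forall c, (c != a) ==> (mindex i c == mindex j c)]).

Definition act2 (k : nat) (X : 'M[A]_(N * N)) : tensor_op A N n :=
  let a := factor k in let b := factor k.+1 in
  \matrix_(i, j)
    (X (mxvec_index (mindex i a) (mindex i b))
       (mxvec_index (mindex j a) (mindex j b))
       *+ [forall c, (c != a) && (c != b) ==> (mindex i c == mindex j c)]).
End TensorOperators.

(* A matrix of scalars regarded as a matrix over a K-algebra. *)
Notation extend A X := (map_mx (in_alg A) X).

Section HeckeSymmetry.
Variables (K : fieldType) (N : nat) (q : K) (R : 'M[K]_(N * N)).

Definition qnum (k : nat) : K := (q ^+ k - q ^- k) / (q - q^-1).

Definition braid (n k : nat) : tensor_op K N n := act2 n k R.

Definition hecke_symmetry : Prop :=
  braid 2 1 * braid 2 2 * braid 2 1 = braid 2 2 * braid 2 1 * braid 2 2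
  /\ (q%:M - R) * ((q^-1)%:M + R) = 0.

Definition skew_inverse (Psi : 'M[K]_(N * N)) : Prop :=
  forall i p k s : 'I_N,
    \sum_j \sum_l R (mxvec_index i j) (mxvec_index k l)
                  * Psi (mxvec_index l p) (mxvec_index j s)
    = (i == s)%:R * (p == k)%:R.

(* P^{(k)} in the first k of n.+1 factors; the value at k = 0 is never used. *)
Fixpoint skew_symmetrizer (n k : nat) : tensor_op K N n :=
  match k with
  | 0 | 1 => 1
  | k'.+1 =>
      (qnum k' / qnum k) *:
        (skew_symmetrizer n k' * ((q ^+ k' / qnum k')%:M - braid n k')
           * skew_symmetrizer n k')
  end.
End HeckeSymmetry.

Section RTrace.
Variables (K : fieldType) (N : nat) (C : 'M[K]_N) (A : algType K).

(* Tr_R (X) *)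
Definition rtrace (X : 'M[A]_N) : A := \tr (X *m extend A C).

(* Tr_{R(1...n.+1)} X *)
Definition rtrace_all (n : nat) (X : tensor_op A N n) : A :=
  \sum_i \sum_j (\prod_c C (mindex j c) (mindex i c)) *: X i j.

(* Tr_{R(2...n.+1)} X *)
Definition rtrace_tail (n : nat) (X : tensor_op A N n) : 'M[A]_N :=
  \matrix_(a, b)
    \sum_(i | mindex i ord0 == a) \sum_(j | mindex j ord0 == b)
      (\prod_(c | c != ord0) C (mindex j c) (mindex i c)) *: X i j.
End RTrace.

(* The matrix C, with C_i^j = \sum_k Psi_{ik}^{jk}. *)
Definition skew_trace_mx (K : fieldType) (N : nat) (Psi : 'M[K]_(N * N))
    : 'M[K]_N :=
  \matrix_(i, j) \sum_k Psi (mxvec_index i k) (mxvec_index j k).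

Section YangianRelations.
Variables (K : fieldType) (N : nat) (q : K) (R : 'M[K]_(N * N)).
Variables (A : algType K) (Lc : nat -> 'M[A]_N).

Local Notation R1 := (extend A (braid R 1 1)).
Local Notation L1 k := (act1 1 1 (Lc k)).

(* A family X a b stands for \sum_{a, b} X a b * u^{-a} * v^{-b}. *)
Definition mul_uinv (X : nat -> nat -> tensor_op A N 1) (a b : nat) :=
  if a is a'.+1 then X a' b else 0.
Definition mul_vinv (X : nat -> nat -> tensor_op A N 1) (a b : nat) :=
  if b is b'.+1 then X a b' else 0.

(* Both sides of the relation are multiplied by
   v^{-1} - u^{-1} = (u - v) u^{-1} v^{-1}, which turns R(u,v) into
   v^{-1} (R - (q - q^{-1}) I) - u^{-1} R. *)
Definition yangian_lhs (a b : nat) : tensor_op A N 1 :=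
  let X a b := L1 a * R1 * L1 b in
  (R1 - extend A (q - q^-1)%:M) * mul_vinv X a b - R1 * mul_uinv X a b.

Definition yangian_rhs (a b : nat) : tensor_op A N 1 :=
  let X a b := L1 b * R1 * L1 a in
  mul_vinv X a b * (R1 - extend A (q - q^-1)%:M) - mul_uinv X a b * R1.

(* L(u) = I satisfies the relations, so the algebra they present is nonzero. *)
Fact yangian_trivial (phi : {rmorphism A -> K}) :
    (forall c, phi (c%:A) = c) ->
    (forall k i j, phi (Lc k i j) = ((k == 0%N) && (i == j))%:R) ->
  forall a b i j, phi (yangian_lhs a b i j - yangian_rhs a b i j) = 0.
Proof.
move=> phi_alg phi_L a b i j.
pose m (X : tensor_op A N 1) : tensor_op K N 1 := map_mx phi X.
have mB X Y : m (X - Y) = m X - m Y by exact: map_mxB.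
have mM X Y : m (X * Y) = m X * m Y by exact: map_mxM.
have m0 : m 0 = 0 by exact: map_mx0.
have mE X : m (extend A X) = X by apply/matrixP => ? ?; rewrite !mxE phi_alg.
have mL k : m (L1 k) = (k == 0%N)%:R.
  apply/matrixP => s t; rewrite !mxE rmorphMn phi_L.
  case: k => [|k] /=; rewrite !mxE ?mul0rn // -mulrnA mulnb.
  congr (_ *+ nat_of_bool _).
  rewrite -(inj_eq enum_val_inj) -/(mindex s) -/(mindex t).
  apply/andP/eqP => [[/eqP e /forallP h]|->]; last first.
    by rewrite eqxx; split=> //; apply/forallP => c; rewrite eqxx implybT.
  apply/ffunP => c; case: (eqVneq c (factor 1 1)) => [->//|ne].
  by apply/eqP; apply: (implyP (h c)).
suff e : m (yangian_lhs a b) = m (yangian_rhs a b).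
  rewrite rmorphB; apply/eqP; rewrite subr_eq0; apply/eqP.
  by have /matrixP/(_ i j) := e; rewrite !mxE.
rewrite /yangian_lhs /yangian_rhs.
have cR c : (c%:M : tensor_op K N 1) * braid R 1 1 = braid R 1 1 * c%:M.
  by rewrite -[RHS]/(_ *m _) scalar_mxC.
have mX c d : m (L1 c * R1 * L1 d) = ((c == 0%N) && (d == 0%N))%:R * braid R 1 1.
  rewrite !mM mE !mL; case: c d => [|c] [|d] /=;
  by rewrite ?(mulr1, mul1r, mulr0, mul0r).
have mu c d : m (mul_uinv (fun a b => L1 a * R1 * L1 b) c d)
            = ((c == 1%N) && (d == 0%N))%:R * braid R 1 1.
  by case: c => [|c] /=; rewrite ?m0 ?mX ?mul0r.
have mv c d : m (mul_vinv (fun a b => L1 a * R1 * L1 b) c d)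
            = ((c == 0%N) && (d == 1%N))%:R * braid R 1 1.
  by case: d => [|d] /=; rewrite ?m0 ?mX ?andbF ?mul0r.
have mu' c d : m (mul_uinv (fun a b => L1 b * R1 * L1 a) c d)
            = ((c == 1%N) && (d == 0%N))%:R * braid R 1 1.
  by case: c => [|c] /=; rewrite ?m0 ?mX ?mul0r // andbC.
have mv' c d : m (mul_vinv (fun a b => L1 b * R1 * L1 a) c d)
            = ((c == 0%N) && (d == 1%N))%:R * braid R 1 1.
  by case: d => [|d] /=; rewrite ?m0 ?mX ?andbF ?mul0r // andbC.
rewrite !mB !mM mu mv mu' mv' !mB !mE.
case: (_ && _); case: (_ && _);
  by rewrite ?(mul0r, mulr0, subr0, sub0r, mul1r) // mulrBl mulrBr cR.
Qed.
End YangianRelations.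

Section BraidedYangian.
Variables (K : fieldType) (N : nat) (q : K) (R : 'M[K]_(N * N)).

(* The generator (k, i, j) is l_i^j[k.+1]. *)
Definition yangian_free : algType K := free_alg K (nat * 'I_N * 'I_N)%type.

Definition yangian_free_coef (k : nat) : 'M[yangian_free]_N :=
  if k is k'.+1 then \matrix_(i, j) free_gen K (k', i, j) else 1.

Definition yangian_relator (x : yangian_free) : Prop :=
  exists a b i j,
    x = yangian_lhs q R yangian_free_coef a b i j
        - yangian_rhs q R yangian_free_coef a b i j.

Lemma yangian_proper : ~ two_sided_ideal yangian_relator 1.
Proof.
pose aug : {rmorphism yangian_free -> K} :=
  @free_aug K (nat * 'I_N * 'I_N)%type.
suff aug0 x : two_sided_ideal yangian_relator x -> aug x = 0.
  by move=> /aug0/eqP; rewrite rmorph1 oner_eq0.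
elim=> {x} [x [a [b [i [j ->]]]]||x y _ x0 _ y0|y x _ x0|y x _ x0];
  last 4 first.
- by rewrite rmorph0.
- by rewrite rmorphD x0 y0 addr0.
- by rewrite rmorphM x0 mulr0.
- by rewrite rmorphM x0 mul0r.
apply: yangian_trivial => [c|l s t].
  exact: free_aug_in_alg.
case: l => [|l] /=; rewrite !mxE ?rmorph_nat //.
exact: free_aug_gen.
Qed.

Definition braided_yangian : algType K := alg_quot yangian_proper.

Definition yangian_coef (k : nat) : 'M[braided_yangian]_N :=
  map_mx (quot_pi yangian_proper) (yangian_free_coef k).

Definition generating_matrix : 'M[series braided_yangian]_N :=
  \matrix_(i, j) Series (fun k => yangian_coef k i j).
End BraidedYangian.

Section SymmetricFunctions.
Variables (K : fieldType) (N : nat) (q : K) (R : 'M[K]_(N * N)) (C : 'M[K]_N).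
Variables (A : algType K) (L : 'M[series A]_N).

Local Notation braidA n k := (extend (series A) (braid R n k)).
Local Notation braidVA n k := (extend (series A) (invmx (braid R n k))).

(* X_{\overline k} in n.+1 factors; the value at k = 0 is never used. *)
Fixpoint overline (n k : nat) (X : 'M[series A]_N) : tensor_op (series A) N n :=
  match k with
  | 0 | 1 => act1 n 1 X
  | k'.+1 => braidA n k' * overline n k' X * braidVA n k'
  end.

Local Notation L_ c := (map_mx (dilate c) L).

Definition elem_sym (k : nat) : series A :=
  if k is n.+1 then
    rtrace_all C (extend (series A) (skew_symmetrizer q R n k)
      * \prod_(1 <= a < k.+1) overline n a (L_ (q ^- (2 * a.-1))))
  else 1.

(* L^{[k]}(u), meaningful for k >= 1 only: the operators act in k factors. *)
Definition matrix_power (k : nat) : 'M[series A]_N :=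
  let n := k.-1 in
  rtrace_tail C
    ((\prod_(1 <= a < k.+1) overline n a (L_ (q ^- (2 * (k - a)))))
      * \prod_(1 <= a < k) braidA n (k - a)).

Definition power_sum (k : nat) : series A := rtrace C (matrix_power k).
End SymmetricFunctions.

(* Main.v *)
(* Everything is written as an R-trace over k = m + j factors against the single
   product M = L_{\bar 1}(q^{-2(k-1)}u) ... L_{\bar k}(u).  The two-site relation
   at v = q^{-2}u reads (R_i - q) L_{\bar i}(u) L_{\overline{i+1}}(q^{-2}u)
   = L_{\bar i}(q^{-2}u) L_{\overline{i+1}}(u) (R_i - q), whence M P = P M P for
   every skew-symmetrizer P in consecutive factors.  Permuting spectral parameters
   between two copies of P^{(k)} by adjacent swaps gives e_k(u) = Tr_R(M P^{(k)}).
   Since Tr_R over the last factor of R_p X R_p^{-1} is Tr_R over the last factor of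
   X, a product of two traces is one trace with the second argument shifted to the
   right, and p_j(q^{-2m}u) e_m(u) = Tr_R(M P^{(m)}_{j+1..k} R_{j-1} ... R_1) =: T_j.
   With V_j := Tr_R(M P^{(m+1)}_{j..k} R_{j-1} ... R_1), the left recursion for
   skew-symmetrizers and the cyclicity of Tr_R with respect to the R_i yield
   (m+1)_q V_j = q^m T_j - m_q V_{j+1}.  The alternating sum telescopes to
   k_q V_1 = k_q e_k(u). *)
Require Import Defs.
From HB Require Import structures.
From mathcomp Require Import all_boot all_order all_algebra ring zify.
From mathcomp Require Import reals complex.

Set Implicit Arguments.
Unset Strict Implicit.
Unset Printing Implicit Defensive.

Import GRing.Theory.
Local Open Scope ring_scope.

(** The entries of L(u) do not commute, so cyclicity of Tr_R is not automatic; it is used only for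
    polynomials in the R_i, which have scalar entries and are compatible with C because R commutes
    with C ⊗ C. This and the invariance of Tr_R under conjugation both come from R_12 C_1 Psi_21 =
    C_2 = Psi_21 C_1 R_12, that is, from the Yang-Baxter equation contracted with Psi on its outer
    strands. Why M P = P M P: on the image of P the operator R_i - q is the nonzero scalar -(q +
    q^{-1}), so up to this scalar M P is M (R_i - q) P = (R_i - q) M' P, where M' has two parameters
    swapped. By the Hecke relation R_i acts by -q^{-1} on the image of R_i - q, hence P absorbs M P
    from the left. For parameters q^{-2a}u, q^{-2a'}u that are not consecutive, R_i - q is replaced
    by a multiple of R(u,v), which acts on P by q^{-1}(q^{2a} - q^{2a'+2}). As q is generic this
    vanishes only for a = a' + 1, and then the swap is read in the opposite direction. The left
    recursion holds because the reversed sequence of generators produces the same idempotent. *)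

Local Notation op A N p := 'M[A]_#|{ffun 'I_p -> 'I_N}|.

(** * Operators on tensor powers *)

Section Snoc.
Variables (N p : nat).
Implicit Types (f g : {ffun 'I_p -> 'I_N}) (a b : 'I_N).

(** Inductions on the number of tensor factors split off the last one: an operator in earlier
    factors is then a [pad], and the entry computations concentrate on operators that touch the last
    factors. *)
Definition snoc f a : {ffun 'I_p.+1 -> 'I_N} :=
  [ffun c => if unlift ord_max c is Some d then f d else a].

Lemma snoc_max f a : snoc f a ord_max = a.
Proof. by rewrite ffunE unlift_none. Qed.

Lemma snoc_lift f a c : snoc f a (lift ord_max c) = f c.
Proof. by rewrite ffunE liftK. Qed.

Lemma snocK (h : {ffun 'I_p.+1 -> 'I_N}) :
  snoc [ffun c => h (lift ord_max c)] (h ord_max) = h.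
Proof.
by apply/ffunP => c; rewrite ffunE; case: unliftP => [d|] ->; rewrite ?ffunE.
Qed.

Lemma eq_snoc f g a b : (snoc f a == snoc g b) = (f == g) && (a == b).
Proof.
apply/eqP/andP => [e|[/eqP-> /eqP->] //]; split; apply/eqP.
  by apply/ffunP => c; rewrite -(snoc_lift f a) e snoc_lift.
by rewrite -(snoc_max f a) e snoc_max.
Qed.

Lemma sum_snoc (A : nmodType) (F : {ffun 'I_p.+1 -> 'I_N} -> A) :
  \sum_h F h = \sum_f \sum_a F (snoc f a).
Proof.
rewrite pair_big (reindex (fun x => snoc x.1 x.2)) //=.
exists (fun h => ([ffun c => h (lift ord_max c)], h ord_max)) => [[f a]|h] _ /=.
  by congr (_, _); rewrite ?snoc_max //; apply/ffunP => c; rewrite ffunE snoc_lift.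
exact: snocK.
Qed.
End Snoc.

Section Entries.
Variables (A : pzSemiRingType) (N p : nat).
Implicit Types (X Y : op A N p) (f g : {ffun 'I_p -> 'I_N}).

Definition entry X f g : A := X (enum_rank f) (enum_rank g).

Definition mkop (F : {ffun 'I_p -> 'I_N} -> {ffun 'I_p -> 'I_N} -> A) : op A N p :=
  \matrix_(i, j) F (enum_val i) (enum_val j).

Lemma entry_mkop F f g : entry (mkop F) f g = F f g.
Proof. by rewrite /entry mxE !enum_rankK. Qed.

Lemma entryP X Y : (forall f g, entry X f g = entry Y f g) -> X = Y.
Proof.
move=> e; apply/matrixP => i j.
by have := e (enum_val i) (enum_val j); rewrite /entry !enum_valK.
Qed.

Lemma sum_op (V : nmodType) (F : 'I_#|{ffun 'I_p -> 'I_N}| -> V) :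
  \sum_i F i = \sum_f F (enum_rank f).
Proof. by rewrite (reindex enum_rank) //; apply/onW_bij/enum_rank_bij. Qed.

Lemma entryM X Y f g : entry (X * Y) f g = \sum_h entry X f h * entry Y h g.
Proof. by rewrite /entry mxE sum_op. Qed.

Lemma entry1 f g : entry 1 f g = (f == g)%:R.
Proof. by rewrite /entry mxE (inj_eq enum_rank_inj). Qed.
End Entries.

Lemma entryB (A : pzRingType) N p (X Y : op A N p) f g :
  entry (X - Y) f g = entry X f g - entry Y f g.
Proof. by rewrite /entry !mxE. Qed.

Section Pad.
Variables (A : pzRingType) (N : nat).

(** X ⊗ I, with the identity in a new last factor. *)
Definition pad p (X : op A N p) : op A N p.+1 :=
  mkop (fun f g => entry X [ffun c => f (lift ord_max c)] [ffun c => g (lift ord_max c)]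
                   *+ (f ord_max == g ord_max)).

Lemma entry_pad p (X : op A N p) f a g b :
  entry (pad X) (snoc f a) (snoc g b) = entry X f g *+ (a == b).
Proof.
rewrite entry_mkop !snoc_max; congr (entry X _ _ *+ _);
  by apply/ffunP => c; rewrite ffunE snoc_lift.
Qed.

Lemma entry_snocP p (X Y : op A N p.+1) :
  (forall f a g b, entry X (snoc f a) (snoc g b) = entry Y (snoc f a) (snoc g b)) -> X = Y.
Proof. by move=> e; apply: entryP => f g; rewrite -(snocK f) -(snocK g). Qed.

Lemma padB p (X Y : op A N p) : pad (X - Y) = pad X - pad Y.
Proof.
apply: entry_snocP => f a g b.
by rewrite entryB !entry_pad entryB mulrnBl.
Qed.

Lemma padM p (X Y : op A N p) : pad (X * Y) = pad X * pad Y.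
Proof.
apply: entry_snocP => f a g b; rewrite entry_pad !entryM sum_snoc.
rewrite -sumrMnl; apply: eq_bigr => h _.
rewrite (bigD1 a) //= big1 ?addr0 => [|c ca]; last first.
  by rewrite entry_pad eq_sym (negPf ca) mul0r.
by rewrite !entry_pad eqxx mulrnAr.
Qed.

Lemma pad1 p : pad (1 : op A N p) = 1.
Proof.
apply: entry_snocP => f a g b; rewrite entry_pad !entry1 eq_snoc.
by rewrite -mulrnA mulnb.
Qed.
End Pad.

Section ActEntries.
Variables (A : nzRingType) (N : nat).

Lemma entry_act1 n k (X : 'M[A]_N) f g :
  entry (act1 n k X) f g =
  X (f (factor n k)) (g (factor n k))
    *+ [forall c, (c != factor n k) ==> (f c == g c)].
Proof. by rewrite /entry mxE /mindex !enum_rankK. Qed.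

Lemma entry_act2 n k (X : 'M[A]_(N * N)) f g :
  entry (act2 n k X) f g =
  X (mxvec_index (f (factor n k)) (f (factor n k.+1)))
    (mxvec_index (g (factor n k)) (g (factor n k.+1)))
    *+ [forall c, (c != factor n k) && (c != factor n k.+1) ==> (f c == g c)].
Proof. by rewrite /entry mxE /mindex !enum_rankK. Qed.

Lemma forall_ord_max p (P : pred 'I_p.+1) :
  [forall c, P c] = [forall c, P (lift ord_max c)] && P ord_max.
Proof.
apply/forallP/andP => [h|[/forallP h h'] c]; first by split=> //; apply/forallP.
by case: (unliftP ord_max c) => [d|] ->.
Qed.

Lemma factorS n k : (k.-1 <= n)%N -> factor n.+1 k = lift ord_max (factor n k).
Proof.
move=> kn; apply: ord_inj; rewrite lift_max !inordK ?ltnS //.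
exact: leqW.
Qed.

Lemma pad_act1 n k (X : 'M[A]_N) : (k <= n.+1)%N ->
  pad (act1 n k X) = act1 n.+1 k X.
Proof.
move=> kn; apply: entry_snocP => f a g b.
have kn' : (k.-1 <= n)%N by case: k kn.
rewrite entry_pad !entry_act1 factorS // !snoc_lift -mulrnA mulnb; congr (_ *+ nat_of_bool _).
rewrite [RHS]forall_ord_max !snoc_max neq_lift /=; congr (_ && _).
by apply: eq_forallb => c; rewrite (inj_eq lift_inj) !snoc_lift.
Qed.

Lemma pad_act2 n k (X : 'M[A]_(N * N)) : (0 < k <= n)%N ->
  pad (act2 n k X) = act2 n.+1 k X.
Proof.
move=> /andP[k0 kn]; apply: entry_snocP => f a g b.
have kn' : (k.-1 <= n)%N by apply: leq_trans kn; apply: leq_pred.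
rewrite entry_pad !entry_act2 !factorS // !snoc_lift -mulrnA mulnb; congr (_ *+ nat_of_bool _).
rewrite [RHS]forall_ord_max !snoc_max !neq_lift /=; congr (_ && _).
by apply: eq_forallb => c; rewrite !(inj_eq lift_inj) !snoc_lift.
Qed.

Lemma entry_act2_last p (X : 'M[A]_(N * N)) f a b g c d :
  entry (act2 p.+1 p.+1 X) (snoc (snoc f a) b) (snoc (snoc g c) d) =
  X (mxvec_index a b) (mxvec_index c d) *+ (f == g).
Proof.
rewrite entry_act2.
have -> : factor p.+1 p.+1 = lift ord_max (ord_max : 'I_p.+1).
  by apply: ord_inj; rewrite lift_max !inordK.
have -> : factor p.+1 p.+2 = ord_max by apply: val_inj; rewrite /= inordK.
rewrite !snoc_lift !snoc_max !forall_ord_max eqxx eqxx andbF /= !andbT.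
congr (_ *+ nat_of_bool _); apply/forallP/eqP => [h|-> e]; last by rewrite !snoc_lift eqxx
  implybT.
apply/ffunP => e; apply/eqP; have := implyP (h e); rewrite !snoc_lift; apply.
by rewrite (inj_eq lift_inj) ![lift _ _ == _]eq_sym !neq_lift.
Qed.
End ActEntries.

Section Act2Last.
Variables (A : nzRingType) (N : nat).
Implicit Types X Y : 'M[A]_(N * N).

Lemma entry_snoc2P p (X Y : op A N p.+2) :
  (forall f a b g c d, entry X (snoc (snoc f a) b) (snoc (snoc g c) d)
                     = entry Y (snoc (snoc f a) b) (snoc (snoc g c) d)) -> X = Y.
Proof.
move=> e; apply: entry_snocP => f a g b.
by rewrite -(snocK f) -(snocK g).
Qed.

Lemma sum_mxvec (V : nmodType) m n (F : 'I_(m * n) -> V) :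
  \sum_i F i = \sum_a \sum_b F (mxvec_index a b).
Proof.
rewrite pair_big (reindex (fun x => mxvec_index x.1 x.2)) //=.
have [g gK Kg] := curry_mxvec_bij m n; exists g => x _.
  by rewrite -[RHS]gK /=; case: x.
by rewrite -[RHS]Kg /=; case: (g x).
Qed.

Lemma eq_mxvec_index m n (a c : 'I_m) (b d : 'I_n) :
  (mxvec_index a b == mxvec_index c d) = (a == c) && (b == d).
Proof. by rewrite (inj_eq (@cast_ord_inj _ _ _)) (inj_eq enum_rank_inj) xpair_eqE. Qed.

Lemma act2B n k X Y : act2 n k (X - Y) = act2 n k X - act2 n k Y.
Proof.
by apply: entryP => f g; rewrite entryB !entry_act2 !mxE mulrnBl.
Qed.

Lemma act2D n k X Y : act2 n k (X + Y) = act2 n k X + act2 n k Y.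
Proof.
by apply: entryP => f g; rewrite /entry !mxE mulrnDl.
Qed.

Lemma act2_lastM p X Y :
  act2 p.+1 p.+1 (X * Y) = act2 p.+1 p.+1 X * act2 p.+1 p.+1 Y.
Proof.
apply: entry_snoc2P => f a b g c d.
rewrite entry_act2_last entryM sum_snoc sum_snoc (bigD1 f) //= [X in _ + X]big1.
  rewrite addr0 mxE sum_mxvec -sumrMnl; apply: eq_bigr => i _.
  rewrite -sumrMnl; apply: eq_bigr => j _.
  by rewrite !entry_act2_last eqxx mulrnAr.
move=> h hf; apply: big1 => i _; apply: big1 => j _.
by rewrite entry_act2_last eq_sym (negPf hf) mul0r.
Qed.

Lemma act2_scalar n k (c : A) : (0 < k <= n)%N -> act2 n k (c%:M : 'M[A]_(N * N)) = c%:M.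
Proof.
move=> kn; apply: entryP => f g; rewrite entry_act2 /entry !mxE.
rewrite (inj_eq enum_rank_inj) -mulrnA mulnb; congr (_ *+ nat_of_bool _).
rewrite eq_mxvec_index.
apply/andP/eqP => [[/andP[/eqP e1 /eqP e2] /forallP h]|->]; last first.
  by rewrite !eqxx; split=> //; apply/forallP => d; rewrite eqxx implybT.
apply/ffunP => d; case: (eqVneq d (factor n k)) => [->//|n1].
case: (eqVneq d (factor n k.+1)) => [->//|n2].
by apply/eqP; apply: (implyP (h d)); rewrite n1.
Qed.

Lemma act2M n k X Y : (0 < k <= n)%N -> act2 n k (X * Y) = act2 n k X * act2 n k Y.
Proof.
elim: n => [|n IHn] /andP[k0 kn]; first by case: k k0 kn.
have [k_n|n_k] := leqP k n; first by rewrite -!pad_act2 ?k0 // IHn ?k0 // padM.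
by have -> : k = n.+1 by [apply/eqP; rewrite eqn_leq kn]; apply: act2_lastM.
Qed.

(** The operators act in disjoint factors, but over a noncommutative ring their entries must commute
    as well, hence the centrality of the entries of [X]. *)
Lemma comm_pad_pad_act2 p (Y : op A N p) X :
    (forall i j x, X i j * x = x * X i j) ->
  act2 p.+1 p.+1 X * pad (pad Y) = pad (pad Y) * act2 p.+1 p.+1 X.
Proof.
move=> Xc; apply: entry_snoc2P => f a b g c d.
rewrite !entryM !sum_snoc (bigD1 f) //= [X in _ + X]big1 ?addr0; last first.
  move=> h hf; apply: big1 => i _; apply: big1 => j _.
  by rewrite entry_act2_last eq_sym (negPf hf) mul0r.
rewrite [RHS](bigD1 g) //= [X in _ = _ + X]big1 ?addr0; last first.
  move=> h hf; apply: big1 => i _; apply: big1 => j _.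
  by rewrite entry_act2_last (negPf hf) mulr0.
rewrite (bigD1 c) //= [X in _ + X]big1 ?addr0; last first.
  move=> i ic; apply: big1 => j _.
  by rewrite !entry_pad (negPf ic) !mul0rn mulr0.
rewrite (bigD1 d) //= [X in _ + X]big1 ?addr0; last first.
  by move=> i id; rewrite !entry_pad (negPf id) mulr0n mulr0.
rewrite [RHS](bigD1 a) //= [X in _ = _ + X]big1 ?addr0; last first.
  move=> i ic; apply: big1 => j _.
  by rewrite !entry_pad eq_sym (negPf ic) !mul0rn mul0r.
rewrite [RHS](bigD1 b) //= [X in _ = _ + X]big1 ?addr0; last first.
  by move=> i id; rewrite !entry_pad [b == _]eq_sym (negPf id) mulr0n mul0r.
by rewrite !entry_act2_last !entry_pad !eqxx !mulr1n Xc.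
Qed.
End Act2Last.

(** * Identities for the skew inverse *)

Section SkewInverse.
Variables (K : fieldType) (I : finType).
Variables r psi : I -> I -> I -> I -> K.

Definition kdelta (i j : I) : K := (i == j)%:R.

Lemma sum_kdelta (F : I -> K) j : \sum_i kdelta i j * F i = F j.
Proof.
rewrite (bigD1 j) //= /kdelta eqxx mul1r big1 ?addr0 // => i ij.
by rewrite (negPf ij) mul0r.
Qed.

Lemma kdeltaC i j : kdelta i j = kdelta j i.
Proof. by rewrite /kdelta eq_sym. Qed.

Hypothesis skewr : forall i p k s,
  \sum_(x : I * I) r i x.1 k x.2 * psi x.2 p x.1 s = kdelta i s * kdelta p k.

(* A one-sided inverse of a square matrix is two-sided. *)
Lemma skewl l j j' l' :
  \sum_(x : I * I) psi l x.2 j x.1 * r x.1 j' x.2 l' = kdelta j' j * kdelta l l'.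
Proof.
pose A := \matrix_(x < #|{: I * I}|, y < #|{: I * I}|)
  r (enum_val x).1 (enum_val y).1 (enum_val x).2 (enum_val y).2.
pose B := \matrix_(x < #|{: I * I}|, y < #|{: I * I}|)
  psi (enum_val x).2 (enum_val y).2 (enum_val x).1 (enum_val y).1.
have sumE (F : 'I_#|{: I * I}| -> K) : \sum_x F x = \sum_x F (enum_rank x).
  by rewrite (reindex enum_rank) //; apply/onW_bij/enum_rank_bij.
have /mulmx1C/matrixP/(_ (enum_rank (j, l)) (enum_rank (j', l'))) : A *m B = 1%:M.
  apply/matrixP => x y; rewrite !mxE sumE.
  transitivity (kdelta (enum_val x).1 (enum_val y).1 * kdelta (enum_val y).2 (enum_val x).2).
    by rewrite -skewr; apply: eq_bigr => z _; rewrite !mxE enum_rankK.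
  rewrite /kdelta -natrM mulnb -(inj_eq enum_val_inj).
  by case: (enum_val x) (enum_val y) => [a b] [c d]; rewrite xpair_eqE [d == b]eq_sym.
rewrite !mxE sumE (inj_eq enum_rank_inj) xpair_eqE => e.
rewrite /kdelta -natrM mulnb [j' == j]eq_sym -e.
by apply: eq_bigr => x _; rewrite !mxE !enum_rankK.
Qed.

(** [skewl] in the form that removes one [r] from inside a longer contraction; [contractr] does the
    same on the other side by [skewr]. *)
Lemma contractl l j (G : I -> I -> K) :
  \sum_(x : I * I) psi l x.2 j x.1 * (\sum_(y : I * I) r x.1 y.1 x.2 y.2 * G y.1 y.2)
  = G j l.
Proof.
under eq_bigr do rewrite big_distrr /=.
rewrite exchange_big /= -(pair_bigA _ (fun a c =>
  \sum_(x : I * I) psi l x.2 j x.1 * (r x.1 a x.2 c * G a c))) /=.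
rewrite -[RHS](sum_kdelta (fun a => G a l) j); apply: eq_bigr => a _.
rewrite -(sum_kdelta (fun c => G a c) l) big_distrr /=; apply: eq_bigr => c _.
by rewrite mulrA (kdeltaC c) -skewl big_distrl /=; apply: eq_bigr => x _; rewrite mulrA.
Qed.

Lemma contractr p s (G : I -> I -> K) :
  \sum_(x : I * I) (\sum_(y : I * I) r y.1 x.1 y.2 x.2 * G y.1 y.2) * psi x.2 p x.1 s
  = G s p.
Proof.
under eq_bigr do rewrite big_distrl /=.
rewrite exchange_big /= -(pair_bigA _ (fun b c =>
  \sum_(x : I * I) r b x.1 c x.2 * G b c * psi x.2 p x.1 s)) /=.
rewrite -[RHS](sum_kdelta (fun b => G b p) s); apply: eq_bigr => b _.
rewrite -(sum_kdelta (fun c => G b c) p) big_distrr /=; apply: eq_bigr => c _.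
rewrite mulrA (kdeltaC c) -skewr big_distrl /=; apply: eq_bigr => x _.
by rewrite -!mulrA [G b c * _]mulrC.
Qed.

Hypothesis yb : forall i j k d e f,
  \sum_(y : I * I) r y.1 k y.2 f * (\sum_a r i j a y.1 * r a y.2 d e) =
  \sum_(y : I * I) r i y.1 d y.2 * (\sum_b r j k y.1 b * r y.2 b e f).

(* Psi_{ld}^{Ji} R_{ij}^{as} R_{ap}^{de} = R_{jk}^{Jb} R_{lb}^{ef} Psi_{fp}^{ks}:
   the Yang-Baxter equation contracted with Psi on both outer strands. *)
Lemma yb_skew l J j s p e :
  \sum_(x : I * I) psi l x.2 J x.1 * (\sum_a r x.1 j a s * r a p x.2 e) =
  \sum_(x : I * I) (\sum_b r j x.1 J b * r l b e x.2) * psi x.2 p x.1 s.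
Proof.
(* [contractr] is read backwards to insert the third crossing. After the Yang-Baxter equation,
   [contractl] cancels a crossing on the opposite strand. *)
transitivity (\sum_(x : I * I) psi l x.2 J x.1 * (\sum_(y : I * I)
   (\sum_(z : I * I) r z.1 y.1 z.2 y.2 * (\sum_a r x.1 j a z.1 * r a z.2 x.2 e))
      * psi y.2 p y.1 s)).
  apply: eq_bigr => x _.
  by rewrite (contractr p s (fun b c => \sum_a r x.1 j a b * r a c x.2 e)).
under eq_bigr => x _ do under eq_bigr => y _ do rewrite yb.
under eq_bigr do rewrite big_distrr /=.
rewrite exchange_big /=; apply: eq_bigr => y _.
rewrite -(contractl l J (fun a c => \sum_b r j y.1 a b * r c b e y.2)) big_distrl /=.
by apply: eq_bigr => x _; rewrite mulrA.
Qed.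

Definition skew_trace (i j : I) : K := \sum_k psi i k j k.

(* R_12 C_1 Psi_21 = C_2 *)
Lemma skew_trace_l l be ka s :
  \sum_(x : I * I) r l be x.1 x.2 * (\sum_p psi x.2 p ka s * skew_trace x.1 p)
  = kdelta l s * skew_trace be ka.
Proof.
(* This is [yb_skew] contracted once more with Psi, one R being cancelled by [contractl]. *)
have step p e :
    \sum_f r l be e f * psi f p ka s =
    \sum_(x : I * I) psi be x.2 ka x.1 *
      (\sum_(y : I * I) psi l y.2 x.2 y.1 * (\sum_a r y.1 x.1 a s * r a p y.2 e)).
  under [RHS]eq_bigr => x _ do rewrite yb_skew.
  rewrite -(contractl be ka (fun k b => \sum_f r l b e f * psi f p k s)).
  apply: eq_bigr => x _; congr (_ * _).
  rewrite -(pair_bigA _ (fun k b => r x.1 k x.2 b * (\sum_f r l b e f * psi f p k s))) /=.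
  rewrite -(pair_bigA _ (fun k f => (\sum_b r x.1 k x.2 b * r l b e f) * psi f p k s)) /=.
  apply: eq_bigr => k _.
  under eq_bigr do rewrite big_distrr /=.
  under [RHS]eq_bigr do rewrite big_distrl /=.
  rewrite exchange_big /=; apply: eq_bigr => f _; apply: eq_bigr => b _.
  by rewrite !mulrA.
transitivity (\sum_z \sum_(w : I * I)
   (\sum_f r l be w.2 f * psi f w.1 ka s) * psi w.2 z w.1 z).
  rewrite exchange_big /= -(pair_bigA _ (fun p e =>
    \sum_z (\sum_f r l be e f * psi f p ka s) * psi e z p z)) /=.
  rewrite -(pair_bigA _ (fun e f => r l be e f * (\sum_p psi f p ka s * skew_trace e p))) /=.
  rewrite [RHS]exchange_big /=; apply: eq_bigr => e _.
  under eq_bigr do rewrite big_distrr /=.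
  rewrite exchange_big /=; apply: eq_bigr => p _.
  rewrite -big_distrr /= -/(skew_trace e p) big_distrl /=; apply: eq_bigr => f _.
  by rewrite mulrA.
(* With the trace over [z] written out, [contractr] removes one more R; the remaining R and Psi then
   cancel by [skewl]. *)
transitivity (\sum_z \sum_(x : I * I) psi be x.2 ka x.1 *
    (\sum_i psi l z x.2 i * r i x.1 z s)).
  apply: eq_bigr => z _.
  rewrite -(contractr z z (fun a d => \sum_(x : I * I) psi be x.2 ka x.1 *
    (\sum_i psi l d x.2 i * r i x.1 a s))).
  apply: eq_bigr => w _; congr (_ * _); rewrite step.
  under [RHS]eq_bigr do rewrite big_distrr /=.
  rewrite [RHS]exchange_big /=; apply: eq_bigr => x _.
  under [RHS]eq_bigr do rewrite mulrCA.
  rewrite -big_distrr /=; congr (_ * _).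
  rewrite -(pair_bigA _ (fun i d => psi l d x.2 i * (\sum_a r i x.1 a s * r a w.1 d w.2))) /=.
  rewrite -(pair_bigA _ (fun a d => r a w.1 d w.2 * (\sum_i psi l d x.2 i * r i x.1 a s))) /=.
  rewrite exchange_big [RHS]exchange_big /=; apply: eq_bigr => d _.
  under eq_bigr do rewrite big_distrr /=.
  under [RHS]eq_bigr do rewrite big_distrr /=.
  rewrite exchange_big /=; apply: eq_bigr => a _; apply: eq_bigr => i _.
  by rewrite mulrA mulrC.
rewrite exchange_big /=.
transitivity (\sum_(x : I * I) psi be x.2 ka x.1 * (kdelta x.1 x.2 * kdelta l s)).
  apply: eq_bigr => x _; rewrite -big_distrr -skewl /=; congr (_ * _).
  by rewrite exchange_big pair_big.
rewrite -(pair_bigA _ (fun j J => psi be J ka j * (kdelta j J * kdelta l s))) exchange_big /=.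
rewrite /skew_trace big_distrr /=; apply: eq_bigr => j _.
rewrite -(sum_kdelta (fun i => psi be j ka i) j) big_distrr /=; apply: eq_bigr => i _.
by rewrite mulrC mulrAC mulrC mulrA.
Qed.

(* Psi_21 C_1 R_12 = C_2 *)
Lemma skew_trace_r mu nu p J :
  \sum_(x : I * I) (\sum_s psi mu p x.2 s * skew_trace s x.1) * r x.1 x.2 J nu
  = kdelta p J * skew_trace mu nu.
Proof.
(* Traced against C, the other side of [yb_skew] collapses by [contractr] and [skewl]. Contracting
   the result with Psi and cancelling by [contractl] gives the claim. *)
have step l e :
    \sum_(x : I * I) (\sum_(y : I * I) (\sum_b r x.1 y.1 J b * r l b e y.2)
        * psi y.2 p y.1 x.2) * skew_trace x.2 x.1 = kdelta p J * kdelta l e.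
  under eq_bigr => x _ do rewrite -yb_skew /skew_trace big_distrr /=.
  rewrite exchange_big /= -skewl -(pair_bigA _ (fun i d => psi l d J i * r i p d e)) /=.
  apply: eq_bigr => z _.
  rewrite -(contractr z z (fun i a => \sum_d psi l d J i * r a p d e)).
  apply: eq_bigr => w _; congr (_ * _).
  rewrite -(pair_bigA _ (fun i d => psi l d J i * (\sum_a r i w.1 a w.2 * r a p d e))) /=.
  rewrite -(pair_bigA _ (fun i a => r i w.1 a w.2 * (\sum_d psi l d J i * r a p d e))) /=.
  apply: eq_bigr => i _.
  under eq_bigr do rewrite big_distrr /=.
  under [RHS]eq_bigr do rewrite big_distrr /=.
  rewrite exchange_big /=; apply: eq_bigr => a _; apply: eq_bigr => d _.
  by rewrite mulrCA.
transitivity (\sum_(y : I * I) psi mu y.2 nu y.1 * (kdelta p J * kdelta y.1 y.2)); last first.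
  rewrite -(pair_bigA _ (fun l e => psi mu e nu l * (kdelta p J * kdelta l e))) exchange_big /=.
  rewrite /skew_trace big_distrr /=; apply: eq_bigr => e _.
  rewrite -(sum_kdelta (fun l => psi mu e nu l) e) big_distrr /=; apply: eq_bigr => l _.
  by rewrite mulrC mulrA.
under [RHS]eq_bigr do rewrite -step.
rewrite -(contractl mu nu (fun b f => \sum_(x : I * I) (\sum_s psi f p x.2 s * skew_trace s x.1)
   * r x.1 x.2 J b)).
apply: eq_bigr => w _; congr (_ * _).
under eq_bigr do rewrite big_distrr /=.
rewrite exchange_big /=.
under [RHS]eq_bigr do rewrite big_distrl /=.
rewrite -(pair_bigA _ (fun j k => \sum_(y : I * I) r w.1 y.1 w.2 y.2 *
   ((\sum_s psi y.2 p k s * skew_trace s j) * r j k J y.1))) /=.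
rewrite -(pair_bigA _ (fun j s => \sum_(y : I * I) (\sum_b r j y.1 J b * r w.1 b w.2 y.2) *
   psi y.2 p y.1 s * skew_trace s j)) /=.
apply: eq_bigr => j _; rewrite [RHS]exchange_big /=.
rewrite -(pair_bigA _ (fun k f => \sum_s (\sum_b r j k J b * r w.1 b w.2 f) *
   psi f p k s * skew_trace s j)) /=.
apply: eq_bigr => k _.
rewrite -(pair_bigA _ (fun b f => r w.1 b w.2 f *
   ((\sum_s psi f p k s * skew_trace s j) * r j k J b))) exchange_big /=.
apply: eq_bigr => f _.
under [RHS]eq_bigr do rewrite -mulrA.
rewrite -big_distrr big_distrl /=; apply: eq_bigr => b _; ring.
Qed.
End SkewInverse.

(** * Braid relations *)

Section EntryMul.
Variables (A : nzRingType) (N : nat).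

Lemma sum_act2_last p (X : 'M[A]_(N * N)) f a b (F : _ -> A) :
  \sum_h entry (act2 p.+1 p.+1 X) (snoc (snoc f a) b) h * F h =
  \sum_c \sum_d X (mxvec_index a b) (mxvec_index c d) * F (snoc (snoc f c) d).
Proof.
rewrite !sum_snoc (bigD1 f) //= [X in _ + X]big1 ?addr0 => [|h hf].
  by apply: eq_bigr => c _; apply: eq_bigr => d _; rewrite entry_act2_last eqxx.
apply: big1 => c _; apply: big1 => d _.
by rewrite entry_act2_last eq_sym (negPf hf) mul0r.
Qed.

Lemma sum_act2_lastr p (X : 'M[A]_(N * N)) g c d (F : _ -> A) :
  \sum_h F h * entry (act2 p.+1 p.+1 X) h (snoc (snoc g c) d) =
  \sum_a \sum_b F (snoc (snoc g a) b) * X (mxvec_index a b) (mxvec_index c d).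
Proof.
rewrite !sum_snoc (bigD1 g) //= [X in _ + X]big1 ?addr0 => [|h hf].
  by apply: eq_bigr => a _; apply: eq_bigr => b _; rewrite entry_act2_last eqxx.
apply: big1 => a _; apply: big1 => b _.
by rewrite entry_act2_last (negPf hf) mulr0.
Qed.

Lemma sum_pad p (X : op A N p) f a (F : _ -> A) :
  \sum_h entry (pad X) (snoc f a) h * F h = \sum_h entry X f h * F (snoc h a).
Proof.
rewrite sum_snoc; apply: eq_bigr => h _; rewrite (bigD1 a) //= big1 ?addr0.
  by rewrite entry_pad eqxx.
by move=> c ca; rewrite entry_pad eq_sym (negPf ca) mul0r.
Qed.

Lemma sum_padr p (X : op A N p) g b (F : _ -> A) :
  \sum_h F h * entry (pad X) h (snoc g b) = \sum_h F (snoc h b) * entry X h g.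
Proof.
rewrite sum_snoc; apply: eq_bigr => h _; rewrite (bigD1 b) //= big1 ?addr0.
  by rewrite entry_pad eqxx.
by move=> c ca; rewrite entry_pad (negPf ca) mulr0.
Qed.
End EntryMul.

Section YangBaxter.
Variables (K : fieldType) (N : nat) (R : 'M[K]_(N * N)).

Let r i j k s := R (mxvec_index i j) (mxvec_index k s).

(** In the last three factors the braid relation is its component form times the identity elsewhere.
    The formula serves twice: at [p = 0] it extracts [yang_baxter] from the hypothesis, and for
    general [p] it gives the relation for the last pair of generators. *)
Lemma entry_braid_left p f i j k g d e l :
  entry (braid R p.+2 p.+1 * braid R p.+2 p.+2 * braid R p.+2 p.+1)
    (snoc (snoc (snoc f i) j) k) (snoc (snoc (snoc g d) e) l) =
  (\sum_(y : 'I_N * 'I_N) r y.1 k y.2 l * (\sum_a r i j a y.1 * r a y.2 d e))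
    *+ (f == g).
Proof.
rewrite /braid -mulrA -(@pad_act2 _ _ p.+1 p.+1) ?leqnn // entryM sum_pad sum_act2_last.
under eq_bigr => a _ do under eq_bigr => b _ do rewrite entryM sum_act2_last.
rewrite -(pair_bigA _ (fun b c => r b k c l * (\sum_a r i j a b * r a c d e))) /=.
rewrite exchange_big -sumrMnl; apply: eq_bigr => b _.
under eq_bigr do rewrite big_distrr /=.
rewrite exchange_big -sumrMnl; apply: eq_bigr => c _.
rewrite big_distrr -sumrMnl; apply: eq_bigr => a _.
rewrite (bigD1 l) //= big1 ?addr0 => [|m ml]; last first.
  by rewrite entry_pad (negPf ml) mulr0n mulr0.
by rewrite entry_pad eqxx entry_act2_last -/(r _ _ _ _) !mulrnAr mulrCA.
Qed.

Lemma entry_braid_right p f i j k g d e l :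
  entry (braid R p.+2 p.+2 * braid R p.+2 p.+1 * braid R p.+2 p.+2)
    (snoc (snoc (snoc f i) j) k) (snoc (snoc (snoc g d) e) l) =
  (\sum_(y : 'I_N * 'I_N) r i y.1 d y.2 * (\sum_b r j k y.1 b * r y.2 b e l))
    *+ (f == g).
Proof.
rewrite /braid -mulrA -(@pad_act2 _ _ p.+1 p.+1) ?leqnn // entryM sum_act2_last.
under eq_bigr => a _ do under eq_bigr => b _ do rewrite entryM sum_pad sum_act2_last.
rewrite -(pair_bigA _ (fun a c => r i a d c * (\sum_b r j k a b * r c b e l))) /=.
rewrite -sumrMnl; apply: eq_bigr => a _.
under eq_bigr do rewrite big_distrr /=.
rewrite exchange_big (bigD1 d) //= [X in _ + X]big1 ?addr0 => [|c cd]; last first.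
  apply: big1 => b _; rewrite big1 ?mulr0 // => m _.
  by rewrite entry_act2_last eq_snoc (negPf cd) andbF mulr0n mulr0.
under eq_bigr do rewrite big_distrr /=.
rewrite exchange_big -sumrMnl; apply: eq_bigr => c _.
rewrite big_distrr -sumrMnl; apply: eq_bigr => b _.
by rewrite entry_act2_last eq_snoc eqxx andbT !mulrnAr mulrCA.
Qed.

Hypothesis braid2 :
  braid R 2 1 * braid R 2 2 * braid R 2 1 = braid R 2 2 * braid R 2 1 * braid R 2 2.

Lemma yang_baxter i j k d e l :
  \sum_(y : 'I_N * 'I_N) r y.1 k y.2 l * (\sum_a r i j a y.1 * r a y.2 d e) =
  \sum_(y : 'I_N * 'I_N) r i y.1 d y.2 * (\sum_b r j k y.1 b * r y.2 b e l).
Proof.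
(* The empty multi-index: for [p = 0] the last three factors are all there is. *)
pose f : {ffun 'I_0 -> 'I_N} := [ffun x : 'I_0 => i].
have := congr1 (fun X => entry X (snoc (snoc (snoc f i) j) k)
                                 (snoc (snoc (snoc f d) e) l)) braid2.
by rewrite entry_braid_left entry_braid_right eqxx.
Qed.

Lemma braid_rel n i : (0 < i < n)%N ->
  braid R n i * braid R n i.+1 * braid R n i =
  braid R n i.+1 * braid R n i * braid R n i.+1.
Proof.
elim: n => [|n IHn] /andP[i0 i_n] //.
have [lt_in|le_ni] := ltnP i n.
  rewrite /braid -!pad_act2 ?i0 ?(ltnW lt_in) ?andbT //= -!padM.
  by congr (pad _); apply: IHn; rewrite i0.
have ei : i = n by apply/eqP; rewrite eqn_leq le_ni -ltnS i_n.
move: i0; rewrite {IHn i i_n le_ni}ei; case: n => // n _.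
apply: entry_snocP => f k g l; rewrite -(snocK f) -(snocK g).
set f' := [ffun c => f _]; set g' := [ffun c => g _].
rewrite -(snocK f') -(snocK g') entry_braid_left entry_braid_right.
by congr (_ *+ _); apply: yang_baxter.
Qed.

Lemma braid_comm n i j : (0 < i)%N -> (i.+1 < j <= n)%N ->
  braid R n i * braid R n j = braid R n j * braid R n i.
Proof.
move=> i0; elim: n => [|n IHn] /andP[ij jn]; first by case: j ij jn.
have [le_jn|lt_nj] := leqP j n.
  have le_in : (i <= n)%N by apply: leq_trans le_jn; apply: ltnW; apply: ltnW.
  have j0 : (0 < j)%N by apply: leq_trans ij.
  rewrite /braid -!pad_act2 ?i0 ?j0 // -!padM.
  by congr (pad _); apply: IHn; rewrite ij.
have ej : j = n.+1 by apply/eqP; rewrite eqn_leq jn.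
move: ij; rewrite {IHn j jn lt_nj}ej ltnS; case: n => // n i_n.
have e : act2 n.+2 i R = pad (pad (act2 n i R)).
  by rewrite (@pad_act2 _ _ n) ?i0 // pad_act2 // i0 leqW.
by rewrite /braid e comm_pad_pad_act2 // => *; apply: mulrC.
Qed.
End YangBaxter.

Section ExtendAct.
Variables (K : fieldType) (A : algType K) (N : nat).

(* Typing the result as ['M[A]_m] keeps the ring structures found on it uniform. *)
Definition ext m (X : 'M[K]_m) : 'M[A]_m := extend A X.

Lemma ext_act2 n k (X : 'M[K]_(N * N)) :
  ext (act2 n k X) = act2 n k (ext X).
Proof. by apply/matrixP => i j; rewrite !mxE rmorphMn. Qed.

Lemma ext_pad p (X : op K N p) : ext (pad X) = pad (ext X).
Proof. by apply/matrixP => i j; rewrite !mxE rmorphMn /entry mxE. Qed.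

Lemma ext_central m (X : 'M[K]_m) i j (x : A) :
  ext X i j * x = x * ext X i j.
Proof. by rewrite mxE mulr_algl mulr_algr. Qed.

Lemma act1_braid_comm R n j (X : 'M[A]_N) : (1 < j <= n)%N ->
  ext (braid R n j) * act1 n 1 X = act1 n 1 X * ext (braid R n j).
Proof.
rewrite /braid ext_act2.
elim: n => [|n IHn] /andP[j1 jn]; first by case: j j1 jn.
have j0 := ltnW j1.
have [le_jn|lt_nj] := leqP j n.
  rewrite -pad_act1 // -!pad_act2 ?j0 // -!padM.
  by congr (pad _); apply: IHn; rewrite j1.
have ej : j = n.+1 by apply/eqP; rewrite eqn_leq jn.
move: j1; rewrite {IHn j jn lt_nj j0}ej; case: n => // n _.
by rewrite -!pad_act1 // comm_pad_pad_act2 // => *; exact: ext_central.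
Qed.

Lemma extM m (X Y : 'M[K]_m) : ext (X * Y) = ext X * ext Y.
Proof. exact: map_mxM. Qed.

Lemma ext1 m : ext (1 : 'M[K]_m) = 1.
Proof. exact: map_mx1. Qed.

Lemma extB m (X Y : 'M[K]_m) : ext (X - Y) = ext X - ext Y.
Proof. exact: map_mxB. Qed.

Lemma ext_scalar m c : ext (c%:M : 'M[K]_m) = (c%:A)%:M.
Proof. exact: map_scalar_mx. Qed.

Lemma ext_scalar_comm n (X : 'M[K]_n) (x : A) : ext X * x%:M = x%:M * ext X.
Proof.
apply/matrixP => i j; rewrite !mxE (bigD1 j) //= big1 ?addr0 => [|k kj]; last first.
  by rewrite [_%:M _ _]mxE (negPf kj) mulr0.
rewrite (bigD1 i) //= [X in _ = _ + X]big1 ?addr0 => [|k kj]; last first.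
  by rewrite [_%:M _ _]mxE eq_sym (negPf kj) mul0r.
by rewrite ![_%:M _ _]mxE !eqxx ext_central.
Qed.
End ExtendAct.

(** * R-traces *)

Section Trace.
Variables (K : fieldType) (N : nat) (C : 'M[K]_N) (A : algType K).

Definition rtrace_last p (X : op A N p.+1) : op A N p :=
  mkop (fun f g => \sum_a \sum_b C b a *: entry X (snoc f a) (snoc g b)).

(** Unlike [rtrace_all] this covers [p = 0], where it returns the single entry; tracing out factors
    one by one ends there. *)
Definition rtrace_full p (X : op A N p) : A :=
  \sum_(f : {ffun 'I_p -> 'I_N}) \sum_(g : {ffun 'I_p -> 'I_N})
    (\prod_c C (g c) (f c)) *: entry X f g.

Lemma rtrace_allE n (X : tensor_op A N n) : rtrace_all C X = rtrace_full X.
Proof.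
rewrite /rtrace_all /rtrace_full sum_op; apply: eq_bigr => f _; rewrite sum_op.
by apply: eq_bigr => g _; rewrite /mindex !enum_rankK.
Qed.

Lemma rtrace_full_last p (X : op A N p.+1) : rtrace_full (rtrace_last X) = rtrace_full X.
Proof.
rewrite /rtrace_full sum_snoc; apply: eq_bigr => f _.
under eq_bigr do rewrite entry_mkop scaler_sumr.
rewrite exchange_big; apply: eq_bigr => a _; rewrite sum_snoc.
apply: eq_bigr => g _; rewrite scaler_sumr; apply: eq_bigr => b _.
rewrite scalerA; congr (_ *: _); rewrite [RHS]big_ord_recr /= !snoc_max.
congr (_ * _); apply: eq_bigr => c _.
by rewrite (_ : widen_ord _ c = lift ord_max c) ?snoc_lift //; apply: ord_inj; rewrite lift_max.
Qed.

(** The factor left open in L^{[k]} is closed by the outer Tr_R, which makes p_k a trace over all k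
    factors. *)
Lemma rtrace_tailE n (X : tensor_op A N n) : rtrace C (rtrace_tail C X) = rtrace_full X.
Proof.
rewrite -rtrace_allE /rtrace /rtrace_all /mxtrace.
rewrite [RHS](partition_big (fun i => mindex i ord0) predT) //=.
apply: eq_bigr => a _; rewrite mxE.
under [LHS]eq_bigr do rewrite mxE big_distrl /=.
rewrite exchange_big; apply: eq_bigr => i /eqP ia.
rewrite [RHS](partition_big (fun j => mindex j ord0) predT) //=.
apply: eq_bigr => b _; rewrite big_distrl; apply: eq_bigr => j /eqP jb.
rewrite /= mxE -scalerAr mulr1 scalerA [in RHS](bigD1 ord0) //= ia jb.
by congr (_ *: _); congr (_ * _); apply: eq_bigl => c; rewrite andTb.
Qed.

Lemma rtrace_last_mull p (X : op A N p) (Y : op A N p.+1) : rtrace_last (pad X * Y) = X *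
  rtrace_last Y.
Proof.
apply: entryP => f g; rewrite entry_mkop entryM.
under eq_bigr => a _ do under eq_bigr => b _ do rewrite entryM sum_pad scaler_sumr.
under [RHS]eq_bigr do rewrite entry_mkop big_distrr /=.
rewrite [RHS]exchange_big; apply: eq_bigr => a _.
under [RHS]eq_bigr do rewrite big_distrr /=.
rewrite [RHS]exchange_big; apply: eq_bigr => b _.
by apply: eq_bigr => h _; rewrite scalerAr.
Qed.

Lemma rtrace_last_mulr p (X : op A N p) (Y : op A N p.+1) : rtrace_last (Y * pad X) =
  rtrace_last Y * X.
Proof.
apply: entryP => f g; rewrite entry_mkop entryM.
under eq_bigr => a _ do under eq_bigr => b _ do rewrite entryM sum_padr scaler_sumr.
under [RHS]eq_bigr do rewrite entry_mkop big_distrl /=.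
rewrite [RHS]exchange_big; apply: eq_bigr => a _.
under [RHS]eq_bigr do rewrite big_distrl /=.
rewrite [RHS]exchange_big; apply: eq_bigr => b _.
by apply: eq_bigr => h _; rewrite scalerAl.
Qed.

Lemma rtrace_fullB p (X Y : op A N p) : rtrace_full (X - Y) = rtrace_full X - rtrace_full Y.
Proof.
rewrite /rtrace_full -sumrB; apply: eq_bigr => f _; rewrite -sumrB.
by apply: eq_bigr => g _; rewrite entryB scalerBr.
Qed.

Lemma rtrace_fullZ p (c : K) (X : op A N p) : rtrace_full (c%:A *: X) = c *: rtrace_full X.
Proof.
rewrite /rtrace_full scaler_sumr; apply: eq_bigr => f _; rewrite scaler_sumr.
apply: eq_bigr => g _; rewrite /entry mxE mulr_algl !scalerA.
by rewrite mulrC.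
Qed.

(** The side on which [x] stands matters, as [A] is not commutative; it fixes the order of the
    factors in [rtrace_full_shift_mul]. *)
Lemma rtrace_full_scalar p (X : op A N p) (x : A) : rtrace_full (X * x%:M) = rtrace_full X * x.
Proof.
rewrite /rtrace_full big_distrl; apply: eq_bigr => f _; rewrite big_distrl.
apply: eq_bigr => g _ /=; rewrite -scalerAl; congr (_ *: _); rewrite entryM.
rewrite (bigD1 g) //= big1 ?addr0 => [|h hg].
  by rewrite /entry [x%:M _ _]mxE eqxx.
by rewrite {2}/entry mxE (inj_eq enum_rank_inj) (negPf hg) mulr0.
Qed.
End Trace.

(** * The matrix C: commutation of R with C ⊗ C, and conjugation by R under the trace *)

Section Mx2.
Variables (K : pzSemiRingType) (N : nat).

Definition mx2 (F : 'I_N -> 'I_N -> 'I_N -> 'I_N -> K) : 'M[K]_(N * N) :=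
  let idx (x : 'I_(N * N)) := enum_val (cast_ord (esym (mxvec_cast N N)) x) in
  \matrix_(x, y) F (idx x).1 (idx x).2 (idx y).1 (idx y).2.

Lemma mx2E F a b c d : mx2 F (mxvec_index a b) (mxvec_index c d) = F a b c d.
Proof. by rewrite mxE /mxvec_index !cast_ordK !enum_rankK. Qed.

Lemma mx2P (X Y : 'M[K]_(N * N)) :
  (forall a b c d, X (mxvec_index a b) (mxvec_index c d)
                 = Y (mxvec_index a b) (mxvec_index c d)) -> X = Y.
Proof.
by move=> e; apply/matrixP => x y; case/mxvec_indexP: x => a b; case/mxvec_indexP: y.
Qed.

Lemma mx2M (X Y : 'M[K]_(N * N)) a b c d :
  (X * Y) (mxvec_index a b) (mxvec_index c d) =
  \sum_(x : 'I_N * 'I_N) X (mxvec_index a b) (mxvec_index x.1 x.2)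
                       * Y (mxvec_index x.1 x.2) (mxvec_index c d).
Proof.
by rewrite mxE; rewrite sum_mxvec pair_big.
Qed.
End Mx2.

Section Skew.
Variables (K : fieldType) (N : nat) (q : K) (R Psi : 'M[K]_(N * N)).
Hypothesis q_neq0 : q != 0.
Hypothesis hecke : hecke_symmetry q R.
Hypothesis skew : skew_inverse R Psi.

Local Notation C := (skew_trace_mx Psi).
Let r i j k s := R (mxvec_index i j) (mxvec_index k s).
Let psi i j k s := Psi (mxvec_index i j) (mxvec_index k s).

Let skewr i p k s :
  \sum_(x : 'I_N * 'I_N) r i x.1 k x.2 * psi x.2 p x.1 s = kdelta K i s * kdelta K p k.
Proof. by rewrite -skew [RHS]pair_big. Qed.

Let trCE i j : skew_trace psi i j = C i j.
Proof. by rewrite mxE. Qed.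

Let C1 := mx2 (fun a b c d => C a c * kdelta K b d).
Let C2 := mx2 (fun a b c d => kdelta K a c * C b d).
(** [W1] and [W2] are C_1 Psi_21 and Psi_21 C_1 as matrices on V ⊗ V, so that [skew_trace_l] and
    [skew_trace_r] become matrix identities. *)
Let W1 := mx2 (fun b t k s => \sum_p C b p * psi t p s k).
Let W2 := mx2 (fun p t j k => \sum_s psi t p k s * C s j).

Let RW1 : R * W1 = C2.
Proof.
apply: mx2P => l be s ka; rewrite mx2M [RHS]mx2E -trCE.
rewrite -(skew_trace_l skewr (yang_baxter (proj1 hecke))).
apply: eq_bigr => x _; rewrite mx2E; congr (_ * _); apply: eq_bigr => p _.
by rewrite trCE mulrC.
Qed.

Let W2R : W2 * R = C2.
Proof.
apply: mx2P => p mu J nu; rewrite mx2M [RHS]mx2E -trCE.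
rewrite -(skew_trace_r skewr (yang_baxter (proj1 hecke))).
apply: eq_bigr => x _; rewrite mx2E; congr (_ * _); apply: eq_bigr => s _.
by rewrite trCE.
Qed.

Let mulC1 (X : 'M[K]_(N * N)) a b c d :
  (X * C1) (mxvec_index a b) (mxvec_index c d) =
  \sum_e X (mxvec_index a b) (mxvec_index e d) * C e c.
Proof.
rewrite mx2M -(pair_bigA _ (fun e k => X _ (mxvec_index e k) * C1 (mxvec_index e k) _)) /=.
apply: eq_bigr => e _; rewrite -(sum_kdelta (fun k => X _ (mxvec_index e k) * C e c)).
by apply: eq_bigr => k _; rewrite mx2E mulrA mulrC.
Qed.

Let C1mul (X : 'M[K]_(N * N)) a b c d :
  (C1 * X) (mxvec_index a b) (mxvec_index c d) =
  \sum_e C a e * X (mxvec_index e b) (mxvec_index c d).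
Proof.
rewrite mx2M -(pair_bigA _ (fun e k => C1 _ (mxvec_index e k) * X (mxvec_index e k) _)) /=.
apply: eq_bigr => e _; rewrite -(sum_kdelta (fun k => C a e * X (mxvec_index e k) _)).
by apply: eq_bigr => k _; rewrite mx2E kdeltaC mulrAC mulrC.
Qed.

Let CC := mx2 (fun a b c d => C a c * C b d).

(** R C_1 C_2 = R C_1 (Psi_21 C_1 R) = (R C_1 Psi_21) C_1 R = C_2 C_1 R. *)
Lemma comm_skew_trace : R * CC = CC * R.
Proof.
have CC12 : C1 * C2 = CC.
  apply: mx2P => a b c d; rewrite C1mul [RHS]mx2E.
  rewrite -(sum_kdelta (fun e => C a e * C b d) c); apply: eq_bigr => e _.
  by rewrite mx2E mulrCA.
have CC21 : C2 * C1 = CC.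
  apply: mx2P => a b c d; rewrite mulC1 [RHS]mx2E.
  rewrite -(sum_kdelta (fun e => C e c * C b d) a); apply: eq_bigr => e _.
  by rewrite mx2E kdeltaC mulrAC mulrA.
have W12 : C1 * W2 = W1 * C1.
  apply: mx2P => b t j k; rewrite C1mul mulC1.
  under eq_bigr do rewrite mx2E big_distrr.
  rewrite exchange_big; apply: eq_bigr => e _; rewrite mx2E big_distrl.
  by apply: eq_bigr => p _; rewrite /= mulrA.
rewrite -{1}CC12 -W2R [C1 * _]mulrA W12 -mulrA mulrA RW1.
by rewrite [C2 * _]mulrA CC21.
Qed.

Local Notation lam := (q - q^-1).

(** The Hecke relation reads R^2 = 1 + (q - q^{-1}) R. *)
Lemma braid_matrix_inv : (R - lam%:M) * R = 1 /\ R * (R - lam%:M) = 1.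
Proof.
have [_ h] := hecke.
have lamR (c : K) (X : 'M[K]_(N * N)) : c%:M * X = X * c%:M.
  by rewrite -[LHS]/(_ *m _) -scalar_mxC.
have qq : q%:M * (q^-1)%:M = 1 :> 'M[K]_(N * N).
  by rewrite -[LHS]/(_ *m _) -scalar_mxM divff.
have e : (R - lam%:M) * R = 1.
  apply/eqP; rewrite -subr_eq0 -oppr_eq0; apply/eqP; rewrite -[RHS]h.
  have -> : lam%:M = q%:M - (q^-1)%:M :> 'M[K]_(N * N) by rewrite raddfB.
  rewrite !mulrBl !mulrDr qq -!lamR; move: (_ * R) (_ * R) (R * R) => a b c.
  by rewrite !opprB opprD !addrA.
by split=> //; rewrite mulrBr -lamR -mulrBl.
Qed.

(** Multiplying R C_1 Psi_21 = C_2 by R^{-1} turns R^{-1} C_2 into C_1 Psi_21, and this Psi cancels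
    against the remaining R. The identity gives the coefficients of Tr_{R(2)}(R X_1 R^{-1}) =
    Tr_R(X) I. *)
Lemma skew_trace_conj i a b k :
  \sum_(x : 'I_N * 'I_N) r i x.1 a x.2 *
     (\sum_u (R - lam%:M) (mxvec_index b x.2) (mxvec_index k u) * C u x.1)
  = kdelta K i k * C b a.
Proof.
have e : (R - lam%:M) * C2 = W1 by rewrite -RW1 mulrA (proj1 braid_matrix_inv) mul1r.
have e' t s : \sum_u (R - lam%:M) (mxvec_index b t) (mxvec_index k u) * C u s =
              \sum_p C b p * psi t p s k.
  rewrite -(mx2E (fun b t k s => \sum_p C b p * psi t p s k)) -/W1 -e mx2M.
  rewrite -(pair_bigA _ (fun y z =>
    (R - lam%:M) (mxvec_index b t) (mxvec_index y z) * C2 (mxvec_index y z) _)) /=.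
  rewrite exchange_big; apply: eq_bigr => u _ /=.
  rewrite -(sum_kdelta (fun y => (R - lam%:M) (mxvec_index b t) (mxvec_index y u) * C u s) k).
  by apply: eq_bigr => y _; rewrite mx2E mulrCA.
under eq_bigr do rewrite e' big_distrr.
rewrite exchange_big -(sum_kdelta (fun p => kdelta K i k * C b p) a); apply: eq_bigr => p _ /=.
rewrite mulrA [_ * kdelta K i k]mulrC -skewr big_distrl; apply: eq_bigr => x _ /=.
by rewrite mulrA mulrAC.
Qed.
End Skew.

(** * Partial R-traces, the braided shift and products of traces *)

Lemma exchange_big4 (V : nmodType) (I : finType) (F : I -> I -> I -> I -> V) :
  \sum_a \sum_b \sum_c \sum_d F a b c d = \sum_c \sum_d \sum_a \sum_b F a b c d.
Proof.
transitivity (\sum_a \sum_c \sum_d \sum_b F a b c d).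
  apply: eq_bigr => a _; rewrite exchange_big; apply: eq_bigr => c _.
  by rewrite exchange_big.
by rewrite exchange_big; apply: eq_bigr => c _; rewrite exchange_big.
Qed.

Section BraidTrace.
Variables (K : fieldType) (N : nat) (q : K) (R Psi : 'M[K]_(N * N)).
Hypothesis q_neq0 : q != 0.
Hypothesis hecke : hecke_symmetry q R.
Hypothesis skew : skew_inverse R Psi.
Variable A : algType K.

Local Notation C := (skew_trace_mx Psi).
Local Notation R' := (R - (q - q^-1)%:M).

Lemma mulbraidV n k : (0 < k <= n)%N -> braid R n k * act2 n k R' = 1.
Proof. by move=> kn; rewrite -act2M // (proj2 (braid_matrix_inv q_neq0 hecke)) act2_scalar. Qed.

Lemma mulVbraid n k : (0 < k <= n)%N -> act2 n k R' * braid R n k = 1.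
Proof. by move=> kn; rewrite -act2M // (proj1 (braid_matrix_inv q_neq0 hecke)) act2_scalar. Qed.

Lemma invmx_braid n k : (0 < k <= n)%N -> invmx (braid R n k) = act2 n k R'.
Proof.
move=> kn; have e := mulbraidV kn; have [u _] := mulmx1_unit e.
by rewrite -[RHS](mulKmx u) [_ *m act2 _ _ _]e mulmx1.
Qed.

(** The entries of R and R^{-1} are scalars, so they can be collected in front of each entry of [X]
    and summed by [skew_trace_conj]. *)
Lemma rtrace_last_conj p (X : op A N p.+1) :
  rtrace_last C (ext A (braid R p.+1 p.+1) * pad X * ext A (act2 p.+1 p.+1 R'))
  = pad (rtrace_last C X).
Proof.
apply: entry_snocP => f i g k; rewrite entry_pad !entry_mkop.
transitivity (\sum_a \sum_b \sum_s \sum_t \sum_u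
   (C u s * (R (mxvec_index i s) (mxvec_index a t) *
      R' (mxvec_index b t) (mxvec_index k u))) *: entry X (snoc f a) (snoc g b)).
  transitivity (\sum_s \sum_u \sum_a \sum_b \sum_t
   (C u s * (R (mxvec_index i s) (mxvec_index a t) *
      R' (mxvec_index b t) (mxvec_index k u))) *: entry X (snoc f a) (snoc g b)).
    apply: eq_bigr => s _; apply: eq_bigr => u _.
    rewrite -mulrA entryM /braid !ext_act2 sum_act2_last scaler_sumr.
    apply: eq_bigr => a _; rewrite [RHS]exchange_big scaler_sumr.
    apply: eq_bigr => t _; rewrite entryM sum_act2_lastr big_distrr scaler_sumr.
    apply: eq_bigr => b _; rewrite (bigD1 t) //= big1 ?addr0 => [|t' tt'].
      rewrite entry_pad eqxx mulr1n ![ext _ _ _ _]mxE mulr_algr mulr_algl.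
      by rewrite !scalerA mulrA.
    by rewrite entry_pad eq_sym (negPf tt') mulr0n mul0r.
  rewrite exchange_big4; apply: eq_bigr => a _; apply: eq_bigr => b _.
  by apply: eq_bigr => s _; rewrite exchange_big.
rewrite -sumrMnl; apply: eq_bigr => a _; rewrite -sumrMnl; apply: eq_bigr => b _.
have := skew_trace_conj q_neq0 hecke skew i a b k; rewrite /kdelta => e.
rewrite -scaler_nat scalerA -e -(pair_bigA _ (fun s t =>
  R (mxvec_index i s) (mxvec_index a t) *
    (\sum_u R' (mxvec_index b t) (mxvec_index k u) * C u s))) scaler_suml.
apply: eq_bigr => s _; rewrite scaler_suml; apply: eq_bigr => t _.
rewrite big_distrr scaler_suml; apply: eq_bigr => u _; congr (_ *: _) => /=.
by rewrite mulrC mulrA.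
Qed.

(** The R-trace over two factors is a trace against C ⊗ C, with which R commutes; the entries of R
    are scalars and pass those of [X]. *)
Lemma rtrace_last2_comm p (X : op A N p.+2) :
  rtrace_last C (rtrace_last C (ext A (braid R p.+1 p.+1) * X)) =
  rtrace_last C (rtrace_last C (X * ext A (braid R p.+1 p.+1))).
Proof.
apply: entryP => f g; rewrite !entry_mkop.
pose m (a b : 'I_N) := mxvec_index a b.
transitivity (\sum_b \sum_b' \sum_c \sum_d
  (\sum_(x : 'I_N * 'I_N) C b x.1 * C b' x.2 * R (m x.1 x.2) (m c d))
    *: entry X (snoc (snoc f c) d) (snoc (snoc g b) b')).
  rewrite exchange_big; apply: eq_bigr => b _.
  transitivity (\sum_a \sum_b' \sum_a' \sum_c \sum_d
     (C b a * C b' a' * R (m a a') (m c d))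
      *: entry X (snoc (snoc f c) d) (snoc (snoc g b) b')).
    apply: eq_bigr => a _; rewrite entry_mkop exchange_big scaler_sumr.
    apply: eq_bigr => b' _; rewrite scaler_sumr; apply: eq_bigr => a' _.
    rewrite entryM /braid ext_act2 sum_act2_last scalerA scaler_sumr.
    apply: eq_bigr => c _; rewrite scaler_sumr; apply: eq_bigr => d _.
    by rewrite [ext _ _ _ _]mxE mulr_algl scalerA.
  rewrite exchange_big; apply: eq_bigr => b' _; rewrite pair_big exchange_big.
  apply: eq_bigr => c _; rewrite exchange_big; apply: eq_bigr => d _.
  by rewrite scaler_suml.
transitivity (\sum_b \sum_b' \sum_c \sum_d
  (\sum_(x : 'I_N * 'I_N) R (m b b') (m x.1 x.2) * (C x.1 c * C x.2 d))
    *: entry X (snoc (snoc f c) d) (snoc (snoc g b) b')).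
  apply: eq_bigr => b _; apply: eq_bigr => b' _.
  apply: eq_bigr => c _; apply: eq_bigr => d _; congr (_ *: _).
  have /matrixP/(_ (m b b') (m c d)) := comm_skew_trace hecke skew.
  rewrite !mx2M => e; transitivity (\sum_(x : 'I_N * 'I_N)
    mx2 (fun a b c d => C a c * C b d) (m b b') (m x.1 x.2) * R (m x.1 x.2) (m c d)).
    by apply: eq_bigr => x _; rewrite mx2E.
  by rewrite -e; apply: eq_bigr => x _; rewrite mx2E.
transitivity (\sum_c \sum_d \sum_b \sum_b'
  (\sum_(x : 'I_N * 'I_N) R (m b b') (m x.1 x.2) * (C x.1 c * C x.2 d))
    *: entry X (snoc (snoc f c) d) (snoc (snoc g b) b')).
  exact: exchange_big4.
transitivity (\sum_c \sum_x \sum_d \sum_y \sum_b \sum_b'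
  (R (m b b') (m x y) * (C x c * C y d))
    *: entry X (snoc (snoc f c) d) (snoc (snoc g b) b')).
  apply: eq_bigr => c _; rewrite [RHS]exchange_big; apply: eq_bigr => d _.
  rewrite [RHS]exchange_big4; apply: eq_bigr => b _; apply: eq_bigr => b' _.
  by rewrite scaler_suml pair_big.
apply: eq_bigr => c _; apply: eq_bigr => x _; rewrite entry_mkop scaler_sumr.
apply: eq_bigr => d _; rewrite scaler_sumr; apply: eq_bigr => y _.
rewrite entryM /braid ext_act2 sum_act2_lastr scalerA scaler_sumr.
apply: eq_bigr => b _; rewrite scaler_sumr; apply: eq_bigr => b' _.
rewrite [ext _ _ _ _]mxE mulr_algr scalerA.
by rewrite mulrC.
Qed.

(* R_1 ... R_p, and its inverse *)
Fixpoint passW p : op K N p.+1 :=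
  if p is p'.+1 then pad (passW p') * braid R p'.+1 p'.+1 else 1.

Fixpoint passV p : op K N p.+1 :=
  if p is p'.+1 then act2 p'.+1 p'.+1 R' * pad (passV p') else 1.

Lemma passWS p : passW p.+1 = pad (passW p) * braid R p.+1 p.+1.
Proof. by []. Qed.

Lemma passVS p : passV p.+1 = act2 p.+1 p.+1 R' * pad (passV p).
Proof. by []. Qed.

Lemma passWK p : passW p * passV p = 1.
Proof.
elim: p => [|p IHp] /=; first exact: mulr1.
by rewrite mulrA -[X in X * _]mulrA mulbraidV ?leqnn // mulr1 -padM IHp pad1.
Qed.

Lemma passVK p : passV p * passW p = 1.
Proof.
elim: p => [|p IHp] /=; first exact: mulr1.
by rewrite mulrA -[X in X * _]mulrA -padM IHp pad1 mulr1 mulVbraid ?leqnn.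
Qed.

(** The braided substitute for I ⊗ Z: it is multiplicative and carries R_i to R_{i+1} and L_{\bar i}
    to L_{\overline{i+1}}, see [shift_braid] and [shift_overline]. *)
Definition shift p (Z : op A N p) : op A N p.+1 :=
  ext A (passW p) * pad Z * ext A (passV p).

Lemma shiftM p (X Y : op A N p) : shift (X * Y) = shift X * shift Y.
Proof.
rewrite /shift padM !mulrA.
by rewrite -[_ * ext A (passV p) * ext A (passW p)]mulrA -extM passVK ext1 mulr1.
Qed.

Lemma shift1 p : shift (1 : op A N p) = 1.
Proof. by rewrite /shift pad1 mulr1 -extM passWK ext1. Qed.

Lemma shiftB p (X Y : op A N p) : shift (X - Y) = shift X - shift Y.
Proof. by rewrite /shift padB mulrBr mulrBl. Qed.

Lemma pad_scalar p (x : A) : pad (x%:M : op A N p) = x%:M.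
Proof.
apply: entry_snocP => f a g b; rewrite entry_pad /entry !mxE -mulrnA mulnb.
by rewrite !(inj_eq enum_rank_inj) eq_snoc.
Qed.

Lemma shift_scalar p (x : A) : shift (x%:M : op A N p) = x%:M.
Proof.
by rewrite /shift pad_scalar ext_scalar_comm -mulrA -extM passWK ext1 mulr1.
Qed.

Lemma passW_braid n i : (0 < i <= n)%N ->
  passW n.+1 * braid R n.+1 i = braid R n.+1 i.+1 * passW n.+1.
Proof.
have Rb := proj1 hecke.
elim: n => [|n IHn] /andP[i0 i_n]; first by case: i i0 i_n.
have [le_in|lt_ni] := leqP i n.
  rewrite (passWS n.+1) -mulrA -braid_comm ?leqnn ?andbT //.
  rewrite [RHS]mulrA [LHS]mulrA; congr (_ * _).
  rewrite /braid -(@pad_act2 _ _ n.+1 i) ?i0 ?(leqW le_in) //.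
  rewrite -(@pad_act2 _ _ n.+1 i.+1) // -!padM.
  by congr (pad _); apply: IHn; rewrite i0.
have ei : i = n.+1 by apply/eqP; rewrite eqn_leq i_n.
rewrite ei 2!passWS padM.
have -> : pad (braid R n.+1 n.+1) = braid R n.+2 n.+1 by rewrite /braid pad_act2 ?leqnn.
rewrite -!mulrA [braid R n.+2 n.+1 * (_ * _)]mulrA (braid_rel Rb) ?leqnn //.
rewrite !mulrA; congr (_ * _ * _); rewrite /braid comm_pad_pad_act2 //.
by move=> *; apply: mulrC.
Qed.

Lemma shift_braid n i : (0 < i <= n)%N ->
  shift (ext A (braid R n i)) = ext A (braid R n.+1 i.+1).
Proof.
move=> i_n; rewrite /shift -ext_pad {1}/braid pad_act2 // -!extM passW_braid //.
by rewrite -mulrA passWK mulr1.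
Qed.

Lemma braidVE n i : (0 < i <= n)%N ->
  ext A (invmx (braid R n i)) =
  ext A (braid R n i) - ext A (q - q^-1)%:M.
Proof. by move=> i_n; rewrite -extB invmx_braid // act2B act2_scalar. Qed.

Lemma shift_braidV n i : (0 < i <= n)%N ->
  shift (ext A (invmx (braid R n i))) = ext A (invmx (braid R n.+1 i.+1)).
Proof.
move=> i_n; have i_n' : (0 < i.+1 <= n.+1)%N by case/andP: i_n.
by rewrite !braidVE // shiftB shift_braid // !ext_scalar shift_scalar.
Qed.

Lemma pad_braid n i : (0 < i <= n)%N ->
  pad (ext A (braid R n i)) = ext A (braid R n.+1 i).
Proof. by move=> i_n; rewrite -ext_pad /braid pad_act2. Qed.

Lemma pad_braidV n i : (0 < i <= n)%N ->
  pad (ext A (invmx (braid R n i))) = ext A (invmx (braid R n.+1 i)).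
Proof.
move=> /andP[i0 i_n]; rewrite !braidVE ?i0 ?(leqW i_n) //.
by rewrite padB pad_braid ?i0 // !ext_scalar pad_scalar.
Qed.

(** L_1 commutes with R_2, R_3, ..., which therefore cancel against their inverses; only the
    conjugation by R_1 survives. *)
Lemma shift_act1 n (X : 'M[A]_N) :
  shift (act1 n 1 X) =
  ext A (braid R n.+1 1) * act1 n.+1 1 X * ext A (invmx (braid R n.+1 1)).
Proof.
rewrite invmx_braid // /shift pad_act1 //.
elim: n => [|n IHn].
  by rewrite /= pad1 !(mul1r, mulr1).
rewrite (passWS n.+1) (passVS n.+1) !extM -!mulrA.
rewrite [ext A (braid _ _ _) * _]mulrA act1_braid_comm ?leqnn // -!mulrA.
rewrite [ext A (braid _ _ _) * _]mulrA -extM mulbraidV ?leqnn // ext1 mul1r.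
rewrite -pad_act1 // !ext_pad mulrA -!padM IHn !padM -!ext_pad pad_act1 // !pad_act2 //.
by rewrite mulrA.
Qed.

(** Of R_1 ... R_{p+1} only the last generator touches the traced factor, and [rtrace_last_conj]
    removes it. *)
Lemma rtrace_last_shift p (Z : op A N p.+1) : rtrace_last C (shift Z) = shift (rtrace_last C Z).
Proof.
rewrite /shift passWS passVS !extM !ext_pad -!mulrA rtrace_last_mull.
by rewrite 2!mulrA rtrace_last_mulr rtrace_last_conj mulrA.
Qed.

(* Families indexed by the number of factors spare casts between
   operators on (m + j).+1 and on m.+1 + j factors. *)
Definition op_family := forall p, op A N p.

(** The value at [p = 0] is a default; the condition [j <= p] in [rtrace_last_iter_fshift] keeps it
    out of reach. *)
Definition fshift (Z : op_family) : op_family :=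
  fun p => if p is p'.+1 return op A N p then shift (Z p') else 0.

Lemma rtrace_last_iter_fshift j p (Z : op_family) : (j <= p)%N ->
  rtrace_last C (iter j fshift Z p.+1) = iter j fshift (fun p => rtrace_last C (Z p.+1)) p.
Proof.
elim: j p => // j IHj [|p] // jp.
by rewrite !iterS [LHS]rtrace_last_shift IHj.
Qed.

Lemma op0_scalar (X : op A N 0) : X = (rtrace_full C X)%:M.
Proof.
apply: entryP => f g; have T0 (h : {ffun 'I_0 -> 'I_N}) : h = f.
  by apply/ffunP; case.
rewrite (T0 g) {2}/entry mxE eqxx mulr1n /rtrace_full.
have sumT0 (F : _ -> A) : \sum_(h : {ffun 'I_0 -> 'I_N}) F h = F f.
  by rewrite (bigD1 f) //= big1 ?addr0 // => h; rewrite (T0 h) eqxx.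
by rewrite !sumT0 big_ord0 scale1r.
Qed.

(** Once all factors of [Z] are traced out a scalar is left, and shifting fixes scalars. *)
Lemma iter_fshift_diag j (Z : op_family) : iter j fshift Z j = (rtrace_full C (Z 0%N))%:M.
Proof.
elim: j => [|j IHj]; first exact: op0_scalar.
by rewrite iterS [LHS]/= IHj shift_scalar.
Qed.

(** The hypothesis says that [X] acts in the first [j] factors only. The trace over the last factor
    then skips [X] and, passing under the shifts, takes one factor off [Z], until [iter_fshift_diag]
    leaves Tr_R(Z) as a scalar. *)
Lemma rtrace_full_shift_mul j m (X Z : op_family) :
    (forall p, (j <= p)%N -> pad (X p) = X p.+1) ->
  rtrace_full C (X (m + j)%N * iter j fshift Z (m + j)%N) = rtrace_full C (X j) * rtrace_full C
    (Z m).
Proof.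
move=> Xst; elim: m Z => [|m IHm] Z; first by rewrite iter_fshift_diag rtrace_full_scalar.
rewrite addSn -rtrace_full_last -Xst ?leq_addl // rtrace_last_mull rtrace_last_iter_fshift
  ?leq_addl //.
by rewrite IHm rtrace_full_last.
Qed.

Lemma rtrace_full_braid_comm n i (X : op A N n.+1) : (0 < i <= n)%N ->
  rtrace_full C (ext A (braid R n i) * X) = rtrace_full C (X * ext A (braid R n i)).
Proof.
elim: n X => [|n IHn] X /andP[i0 i_n]; first by case: i i0 i_n.
have [le_in|lt_ni] := leqP i n.
  by rewrite -rtrace_full_last -pad_braid ?i0 // rtrace_last_mull IHn ?i0 // -rtrace_last_mulr
    rtrace_full_last.
have -> : i = n.+1 by apply/eqP; rewrite eqn_leq i_n.
by rewrite -rtrace_full_last -rtrace_full_last rtrace_last2_comm !rtrace_full_last.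
Qed.
End BraidTrace.

(** * Antisymmetrizers of the Hecke algebra *)

Section QNumbers.
Variables (K : fieldType) (q : K).
Hypothesis q_neq0 : q != 0.
Hypothesis q_generic : forall n : int, n != 0 -> q ^ n != 1.

Lemma expq_neq1 n : (0 < n)%N -> q ^+ n != 1.
Proof. by move=> n0; apply: (q_generic (n := n)); rewrite -lt0n. Qed.

Lemma expq_inj : injective (fun n => q ^+ n).
Proof.
move=> m n; wlog le_mn : m n / (m <= n)%N => [hw e|/eqP e].
  by have [/hw->//|/ltnW/hw h] := leqP m n; rewrite h.
apply/eqP; rewrite eqn_leq le_mn leqNgt -subn_gt0; apply/negP => /expq_neq1.
rewrite -[X in X == 1](mulKf (expf_neq0 m q_neq0)) -exprD subnKC //.
by rewrite -(eqP e) mulVf ?expf_neq0 // eqxx.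
Qed.

Lemma lam_neq0 : q - q^-1 != 0.
Proof.
rewrite subr_eq0; apply: contra (expq_neq1 (n := 2) isT) => /eqP e.
by rewrite expr2 {1}e mulVf.
Qed.

Lemma qnum_neq0 k : (0 < k)%N -> qnum q k != 0.
Proof.
move=> k0; rewrite mulf_neq0 ?invr_eq0 ?lam_neq0 // subr_eq0.
apply: contra (expq_neq1 (n := k + k) _) => [/eqP e|]; last by rewrite addn_gt0 k0.
by rewrite exprD {1}e mulVf ?expf_neq0.
Qed.

Lemma qnum1 : qnum q 1 = 1.
Proof. by rewrite /qnum expr1 divff ?lam_neq0. Qed.

Lemma qnumS k : qnum q k.+1 = q ^+ k + q^-1 * qnum q k.
Proof.
have xn0 : q ^+ k != 0 by rewrite expf_neq0.
have q2 : q * q - 1 != 0.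
  by rewrite subr_eq0 -expr2 expq_neq1.
rewrite /qnum exprS; move: (q ^+ k) xn0 => x xn0.
by field; rewrite q_neq0 q2 xn0.
Qed.
End QNumbers.

Section Antisymmetrizer.
Variables (K : fieldType) (q : K).
(* [qn] stands for [qnum q]; it is abstract so that rewriting does not see the fraction. *)
Variable qn : nat -> K.
Hypothesis qn_neq0 : forall k, (0 < k)%N -> qn k != 0.
Hypothesis qn1 : qn 1 = 1.
Hypothesis qnS : forall k, qn k.+1 = q ^+ k + q^-1 * qn k.
Variable d : nat.
Implicit Types (f : nat -> 'M[K]_d) (X Y : 'M[K]_d).

(** The recursion of [skew_symmetrizer] for an arbitrary sequence of generators, so that it applies
    to shifted, reversed and transposed ones. *)
Fixpoint asym f k : 'M[K]_d :=
  match k with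
  | 0 | 1 => 1
  | k'.+1 => (qn k' / qn k) *:
      (asym f k' * ((q ^+ k' / qn k')%:M - f k') * asym f k')
  end.

(* [f 1, ..., f k.-1] satisfy the relations of the Hecke algebra H_k. *)
Definition hecke_seq f k :=
  [/\ forall i, (0 < i < k)%N -> (q%:M - f i) * ((q^-1)%:M + f i) = 0,
      forall i, (0 < i)%N -> (i.+1 < k)%N ->
        f i * f i.+1 * f i = f i.+1 * f i * f i.+1
    & forall i j, (0 < i)%N -> (i.+1 < j)%N -> (j < k)%N -> f i * f j = f j * f i].

Lemma hecke_seqW f k m : (m <= k)%N -> hecke_seq f k -> hecke_seq f m.
Proof.
move=> mk [h b c]; split=> [i /andP[i0 im]|i i0 im|i j i0 ij jm].
- by apply: h; rewrite i0 (leq_trans im).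
- by apply: b => //; apply: leq_trans mk.
- by apply: c => //; apply: leq_trans mk.
Qed.

Lemma scaleAl (c : K) X Y : c *: (X * Y) = (c *: X) * Y.
Proof. exact: scalemxAl. Qed.

Lemma scaleAr (c : K) X Y : c *: (X * Y) = X * (c *: Y).
Proof. exact: scalemxAr. Qed.

Lemma scalar_mul (c : K) X : c%:M * X = c *: X.
Proof. exact: mul_scalar_mx. Qed.

Lemma mul_scalar (c : K) X : X * c%:M = c *: X.
Proof. exact: mul_mx_scalar. Qed.

Lemma hecke_relC (a b : K) X :
  (a%:M - X) * (b%:M + X) = 0 -> (b%:M + X) * (a%:M - X) = 0.
Proof.
move=> <-; rewrite [RHS]mulrBl [LHS]mulrBr !mulrDl !mulrDr !mul_scalar !scalar_mul.
by congr (_ + _ - _); rewrite -!scalar_mul -[LHS]scalar_mxM -[RHS]scalar_mxM mulrC.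
Qed.

Lemma asymS f k : (0 < k)%N ->
  asym f k.+1 = (qn k / qn k.+1) *:
    (asym f k * ((q ^+ k / qn k)%:M - f k) * asym f k).
Proof. by case: k. Qed.

Lemma eq_asym f g k : (forall i, (0 < i < k)%N -> f i = g i) -> asym f k = asym g k.
Proof.
elim: k => // -[|k] // IHk e; rewrite !(asymS _ (ltn0Sn k)) e ?leqnn // IHk // => i /andP[i0
  ik].
by rewrite e // i0 ltnW.
Qed.

Lemma asymE f k : (0 < k)%N ->
  asym f k.+1 = (qn k / qn k.+1)%:M * (asym f k * ((q ^+ k / qn k)%:M - f k) * asym f k).
Proof. by move=> k0; rewrite asymS // scalar_mul. Qed.

Section Absorb.
Variables (B : pzRingType) (phi : {rmorphism 'M[K]_d -> B}).

Let phiC (c : K) X : phi c%:M * phi X = phi X * phi c%:M.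
Proof. by rewrite -!rmorphM /= scalar_mul mul_scalar. Qed.

Let phi_sandwich (c : K) (P X : 'M[K]_d) :
  phi (c%:M * (P * X * P)) = phi c%:M * (phi P * phi X * phi P).
Proof. by rewrite (rmorphM _ c%:M) (rmorphM _ (P * X)) (rmorphM _ P). Qed.

Let phi_sandwichl (c : K) (P X : 'M[K]_d) (Z : B) :
  phi (c%:M * (P * X * P)) * Z = phi P * (phi c%:M * (phi X * (phi P * Z))).
Proof. by rewrite phi_sandwich !mulrA (phiC c P). Qed.

Let phi_sandwichr (c : K) (P X : 'M[K]_d) (Z : B) :
  Z * phi (c%:M * (P * X * P)) = Z * phi P * phi X * phi c%:M * phi P.
Proof.
rewrite phi_sandwich (mulrA (phi c%:M)) (mulrA (phi c%:M)) (phiC c P).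
by rewrite -(mulrA (phi P)) (phiC c X) !mulrA.
Qed.

(** Origin of the coefficients in [asym]: where f_k acts by -q^{-1}, the factor q^k/k_q - f_k acts
    by (k+1)_q/k_q, which the prefactor k_q/(k+1)_q cancels. *)
Let norm_asym k : (qn k.+1 / qn k.+2)%:M * ((q ^+ k.+1 / qn k.+1)%:M - (- q^-1)%:M) = 1
  :> 'M[K]_d.
Proof.
rewrite -raddfB scalar_mul scale_scalar_mx opprK.
have -> : q ^+ k.+1 / qn k.+1 + q^-1 = qn k.+2 / qn k.+1.
  by rewrite (qnS k.+1) mulrDl mulfK ?qn_neq0.
move: (@qn_neq0 k.+1 isT) (@qn_neq0 k.+2 isT); move: (qn k.+1) (qn k.+2) => a b a0 b0.
by congr (_%:M); field; rewrite a0 b0.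
Qed.

(** [phi] lets the scalar matrix [asym f k] act on a [Y] over a larger ring; it is taken to be the
    identity or [ext]. *)
Lemma asym_absorb_morph f k (Y : B) :
    (forall i, (0 < i < k)%N -> phi (f i) * Y = phi (- q^-1)%:M * Y) ->
  phi (asym f k) * Y = Y.
Proof.
elim: k => [|[|k] IHk] fY; rewrite ?rmorph1 ?mul1r // asymE //.
have IH : phi (asym f k.+1) * Y = Y.
  by apply: IHk => i /andP[i0 ik]; apply: fY; rewrite i0 ltnW.
have fk := fY k.+1 (ltnSn _).
rewrite phi_sandwichl IH.
rewrite rmorphB mulrBl fk -mulrBl -rmorphB (mulrA (phi _%:M)) -rmorphM norm_asym rmorph1 mul1r.
exact: IH.
Qed.

Lemma asym_absorb_morphr f k (Y : B) :
    (forall i, (0 < i < k)%N -> Y * phi (f i) = Y * phi (- q^-1)%:M) ->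
  Y * phi (asym f k) = Y.
Proof.
elim: k => [|[|k] IHk] fY; rewrite ?rmorph1 ?mulr1 // asymE //.
have IH : Y * phi (asym f k.+1) = Y.
  by apply: IHk => i /andP[i0 ik]; apply: fY; rewrite i0 ltnW.
have fk := fY k.+1 (ltnSn _).
rewrite phi_sandwichr IH.
rewrite rmorphB mulrBr fk -mulrBr -rmorphB -(mulrA Y) -rmorphM.
have -> : ((q ^+ k.+1 / qn k.+1)%:M - (- q^-1)%:M) * (qn k.+1 / qn k.+2)%:M = 1 :> 'M[K]_d.
  by rewrite mul_scalar -scalar_mul norm_asym.
by rewrite rmorph1 mulr1.
Qed.
End Absorb.

Lemma asym_absorb f k Y : (forall i, (0 < i < k)%N -> f i * Y = - q^-1 *: Y) ->
  asym f k * Y = Y.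
Proof.
move=> fY; apply: (asym_absorb_morph (phi := idfun)) => i ik /=.
by rewrite fY // scalar_mul.
Qed.

Lemma asym_absorbr f k Y : (forall i, (0 < i < k)%N -> Y * f i = - q^-1 *: Y) ->
  Y * asym f k = Y.
Proof.
move=> fY; apply: (asym_absorb_morphr (phi := idfun)) => i ik /=.
by rewrite fY // mul_scalar.
Qed.

(* The antisymmetrizer is divisible on the left by this sum over coset
   representatives of H_k / H_(k-1), see [asymP]. *)
Fixpoint asym_coset f k : 'M[K]_d :=
  if k is k'.+1 then (q ^+ k')%:M - asym_coset f k' * f k' else 0.

Lemma asym_comm f k X : (forall i, (0 < i < k)%N -> f i * X = X * f i) ->
  asym f k * X = X * asym f k.
Proof.
elim: k => [|[|k] IHk] fX; rewrite ?mul1r ?mulr1 // asymS // -scaleAl -scaleAr.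
have IH : asym f k.+1 * X = X * asym f k.+1.
  by apply: IHk => i /andP[i0 ik]; apply: fX; rewrite i0 ltnW.
congr (_ *: _); move: (asym f k.+1) IH => P IH.
have BX : ((q ^+ k.+1 / qn k.+1)%:M - f k.+1) * X = X * ((q ^+ k.+1 / qn k.+1)%:M - f k.+1).
  by rewrite mulrBl mulrBr scalar_mul mul_scalar fX ?leqnn.
by rewrite -mulrA IH mulrA -(mulrA P) BX !mulrA IH.
Qed.

Lemma asym_coset_comm f k X : (forall i, (0 < i < k)%N -> f i * X = X * f i) ->
  asym_coset f k * X = X * asym_coset f k.
Proof.
elim: k => [|k IHk] fX; rewrite ?mul0r ?mulr0 //= mulrBl mulrBr scalar_mul mul_scalar.
congr (_ - _); case: k IHk fX => [|k] IHk fX; first by rewrite !mul0r mulr0.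
rewrite -mulrA fX ?leqnn // !mulrA IHk //.
by move=> i /andP[i0 ik]; apply: fX; rewrite i0 ltnW.
Qed.

(** The two claims are proved together: the eigenvalue makes the antisymmetrizer idempotent, which
    yields the factorization one step higher, and the factorization yields the eigenvalue of the new
    generator. *)
Lemma asymP f k : (0 < k)%N -> hecke_seq f k ->
  (forall i, (0 < i < k)%N -> f i * asym f k = - q^-1 *: asym f k)
  /\ qn k *: asym f k = asym_coset f k * asym f k.-1.
Proof.
case: k => // k _; elim: k => [|k IHk] hk.
  split=> [i|]; first by case: i => // -[].
  by rewrite /= mul0r subr0 mulr1 qn1 scale1r expr0.
have {IHk} [IH1 IH2] := IHk (hecke_seqW (leqnSn _) hk).
have [hh hb hc] := hk.
have idem : asym f k.+1 * asym f k.+1 = asym f k.+1 by apply: asym_absorb.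
have coset : qn k.+2 *: asym f k.+2 = asym_coset f k.+2 * asym f k.+1.
  rewrite asymS // scalerA mulrCA divff ?qn_neq0 // mulr1 [_ * (_%:M - _)]mulrBr mulrBl
    mul_scalar.
  rewrite -scaleAl idem scalerBr scalerA mulrCA divff ?qn_neq0 // mulr1.
  rewrite [asym_coset f k.+2]/= -/(asym_coset f k.+1) mulrBl scalar_mul.
  (* By [IH2] the left copy of [asym f k.+1] becomes [asym_coset f k.+1] times [asym f k]; the
     latter commutes with [f k.+1] and is absorbed by the right copy. *)
  congr (_ - _); rewrite -mulrA scaleAl IH2 -!mulrA; congr (_ * _).
  rewrite [LHS]mulrA asym_comm => [|i /andP[i0 ik]]; last exact: hc.
  rewrite -mulrA; congr (_ * _); apply: asym_absorb => i /andP[i0 ik].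
  by apply: IH1; rewrite i0 ltnW.
split=> // i /andP[i0]; rewrite ltnS leq_eqVlt => /orP[/eqP->|ik]; last first.
  by rewrite asymS // -scaleAr -[_ * asym f k.+1]mulrA [f i * _]mulrA IH1 ?i0 // -!scaleAl
    !scalerA mulrC.
(* The coset sum splits as q^k (q - h) + [asym_coset f k * f k * h]. On the left, q^{-1} + h kills
   the first part by the Hecke relation. Moved through the second part by the braid relation it
   becomes q^{-1} + [f k], which kills P. *)
set h := f k.+1; set P := asym f k.+1 in idem coset IH1 *.
have hV : ((q^-1)%:M + h) * (q%:M - h) = 0.
  exact: hecke_relC (hh k.+1 (ltnSn _)).
have topV : ((q^-1)%:M + h) * ((q ^+ k.+1)%:M - (q ^+ k)%:M * h) = 0.
  have -> : (q ^+ k.+1)%:M - (q ^+ k)%:M * h = q ^+ k *: (q%:M - h).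
    by rewrite scalerBr scale_scalar_mx -exprSr scalar_mul.
  by rewrite -scaleAr hV scaler0.
have lowV : ((q^-1)%:M + h) * (asym_coset f k * f k * h * P) = 0.
  case: k @h @P {hk IH2 hh idem coset hV topV} IH1 hb hc => [|k] h P IH1 hb hc.
    by rewrite !mul0r mulr0.
  have -> : ((q^-1)%:M + h) * (asym_coset f k.+1 * f k.+1 * h * P) =
      asym_coset f k.+1 * (f k.+1 * h * (((q^-1)%:M + f k.+1) * P)).
    have cT : ((q^-1)%:M + h) * asym_coset f k.+1 = asym_coset f k.+1 * ((q^-1)%:M + h).
      rewrite [LHS]mulrDl [RHS]mulrDr scalar_mul mul_scalar asym_coset_comm // => j /andP[j0
        jk].
      exact: hc.
    have ch : ((q^-1)%:M + h) * (f k.+1 * h) = f k.+1 * h * ((q^-1)%:M + f k.+1).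
      by rewrite [LHS]mulrDl [RHS]mulrDr scalar_mul mul_scalar !mulrA /h hb.
    rewrite -[_ * f k.+1 * h]mulrA [LHS]mulrA [_ * (asym_coset _ _ * _)]mulrA cT.
    by rewrite -(mulrA (asym_coset f k.+1)) ch !mulrA.
  by rewrite [(_ + f k.+1) * P]mulrDl scalar_mul IH1 ?leqnn // scaleNr subrr !mulr0.
apply/eqP; rewrite -subr_eq0 -scaleNr opprK -scalar_mul -mulrDl; apply/eqP.
apply: (scalerI (@qn_neq0 k.+2 isT)); rewrite scaler0 scaleAr coset.
have -> : asym_coset f k.+2 =
    (q ^+ k.+1)%:M - (q ^+ k)%:M * h + asym_coset f k * f k * h.
  by rewrite [LHS]/= mulrBl opprB addrA addrAC.
by rewrite [h + _]addrC [(_ + _) * P]mulrDl mulrDr lowV addr0 mulrA topV mul0r.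
Qed.

Lemma asym_left f k i : hecke_seq f k -> (0 < i < k)%N ->
  f i * asym f k = - q^-1 *: asym f k.
Proof.
move=> hf ik; have k0 : (0 < k)%N by case: k ik {hf} => //; case: i.
exact: (proj1 (asymP k0 hf)).
Qed.

Lemma trM X Y : (X * Y)^T = Y^T * X^T.
Proof. exact: trmx_mul. Qed.

Lemma asym_tr f k : (asym f k)^T = asym (fun i => (f i)^T) k.
Proof.
elim: k => [|[|k] IHk]; rewrite ?trmx1 // !(asymS _ (ltn0Sn k)) linearZ /=.
by rewrite !trM IHk linearB /= tr_scalar_mx mulrA.
Qed.

Lemma hecke_seq_tr f k : hecke_seq f k -> hecke_seq (fun i => (f i)^T) k.
Proof.
move=> [h b c]; split=> [i ik|i i0 ik|i j i0 ij jk].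
- apply: (can_inj (@trmxK _ _ _)); rewrite trM linearD linearB /= !tr_scalar_mx trmxK.
  by rewrite trmx0; apply: hecke_relC; apply: h.
- by rewrite -!trM !mulrA b //.
- by rewrite -!trM (c i j).
Qed.

(** Both the recursion of [asym] and the Hecke relations are stable under transposition, so
    [asym_left] applies to the transposed generators. *)
Lemma asym_right f k i : hecke_seq f k -> (0 < i < k)%N ->
  asym f k * f i = - q^-1 *: asym f k.
Proof.
move=> hf ik; apply: (can_inj (@trmxK _ _ _)); rewrite trM linearZ /= asym_tr.
exact: asym_left (hecke_seq_tr hf) ik.
Qed.

Lemma asym_idem f k : hecke_seq f k -> asym f k * asym f k = asym f k.
Proof. by move=> hf; apply: asym_absorb => i; apply: asym_left. Qed.

(** All generators act by -q^{-1} on either side of both antisymmetrizers, so the product of the two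
    equals each of them. *)
Lemma asym_rev f k : hecke_seq f k -> asym (fun i => f (k - i)%N) k = asym f k.
Proof.
move=> hf; have hg : hecke_seq (fun i => f (k - i)%N) k.
  have [h b c] := hf; split=> [i /andP[i0 ik]|i i0 ik|i j i0 ij jk].
  - by apply: h; lia.
  - have -> : (k - i = (k - i.+1).+1)%N by lia.
    by rewrite b //; lia.
  - by rewrite (c (k - j)%N (k - i)%N) //; lia.
rewrite -[RHS](@asym_absorbr (fun i => f (k - i)%N) k) => [|i /andP[i0 ik]].
  apply/esym/asym_absorb => i /andP[i0 ik].
  rewrite -{1}(subKn (ltnW ik)); apply: (asym_left (i := (k - i)%N) hg); lia.
by apply: asym_right => //; lia.
Qed.

(** The defining recursion adds a generator at the end; for the reversed sequence this end is [f 1].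
    The Newton step needs this form because it is the low end that extends the word R_{j-1} ... R_1
    by R_j. *)
Lemma asym_recl f k : (0 < k)%N -> hecke_seq f k.+1 ->
  let Q := asym (fun i => f i.+1) k in
  qn k.+1 *: asym f k.+1 = q ^+ k *: Q - qn k *: (Q * f 1%N * Q).
Proof.
move=> k0 hf Q; have hS : hecke_seq (fun i => f i.+1) k.
  have [h b c] := hf; split=> [i ik|i i0 ik|i j i0 ij jk].
  - by apply: h; lia.
  - exact: b.
  - exact: c.
have eQ : asym (fun i => f (k.+1 - i)%N) k = Q.
  rewrite /Q -(asym_rev hS); apply: eq_asym => i /andP[i0 ik].
  by rewrite subSn // ltnW.
rewrite -(asym_rev hf) asymS // eQ subSnn scalerA mulrCA divff ?qn_neq0 // mulr1.
rewrite mulrBr mulrBl mul_scalar -scaleAl asym_idem // scalerBr scalerA mulrCA.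
by rewrite divff ?qn_neq0 // mulr1.
Qed.
End Antisymmetrizer.

(** * The two-site relation *)

Section Dilation.
Variables (K : fieldType) (A : algType K).
Implicit Types s t : series A.

Lemma dilate_zmod_morphism c : zmod_morphism (@dilate K A c).
Proof. by move=> s t; apply: seriesP => n /=; rewrite scalerBr. Qed.

Lemma dilate_monoid_morphism c : monoid_morphism (@dilate K A c).
Proof.
split=> [|s t]; apply: seriesP => n /=.
  by case: n => [|n]; rewrite ?scaler0 // expr0 invr1 scale1r.
rewrite scaler_sumr; apply: eq_bigr => i _.
rewrite -scalerAr -scalerAl scalerA -invfM -exprD subnK //; exact: leq_ord.
Qed.

HB.instance Definition _ c := GRing.isZmodMorphism.Build (series A) (series A)
  (@dilate K A c) (dilate_zmod_morphism c).
HB.instance Definition _ c := GRing.isMonoidMorphism.Build (series A) (series A)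
  (@dilate K A c) (dilate_monoid_morphism c).

Lemma dilateZ c a s : dilate c (a *: s) = a *: dilate c s.
Proof. by apply: seriesP => n /=; rewrite !scalerA mulrC. Qed.

Lemma dilate_dilate c d s : dilate c (dilate d s) = dilate (c * d) s.
Proof. by apply: seriesP => n /=; rewrite scalerA -invfM -exprMn. Qed.

Lemma map_dilate_ext c m (X : 'M[K]_m) :
  map_mx (dilate c) (ext (series A) X) = ext (series A) X.
Proof. by apply/matrixP => i j; rewrite !mxE dilateZ rmorph1. Qed.

Lemma map_dilate_act1 c N n k (X : 'M[series A]_N) :
  map_mx (dilate c) (act1 n k X) = act1 n k (map_mx (dilate c) X).
Proof. by apply/matrixP => i j; rewrite !mxE rmorphMn. Qed.

Lemma overlineSS N (R : 'M[K]_(N * N)) n k (X : 'M[series A]_N) :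
  overline R n k.+2 X =
  ext (series A) (braid R n k.+1) * overline R n k.+1 X
    * ext (series A) (invmx (braid R n k.+1)).
Proof. by []. Qed.

Lemma map_dilate_overline c N (R : 'M[K]_(N * N)) n k (X : 'M[series A]_N) :
  map_mx (dilate c) (overline R n k X) = overline R n k (map_mx (dilate c) X).
Proof.
elim: k => [|[|k] IHk]; [exact: map_dilate_act1|exact: map_dilate_act1|].
by rewrite !overlineSS !map_mxM IHk !map_dilate_ext.
Qed.

Lemma rtrace_full_dilate N (C : 'M[K]_N) c p (X : op (series A) N p) :
  rtrace_full C (map_mx (dilate c) X) = dilate c (rtrace_full C X).
Proof.
rewrite /rtrace_full rmorph_sum /=; apply: eq_bigr => f _; rewrite rmorph_sum /=.
by apply: eq_bigr => g _; rewrite dilateZ /entry mxE.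
Qed.
End Dilation.

Section TwoSite.
Variables (K : fieldType) (N : nat) (q : K) (R : 'M[K]_(N * N)).
Variables (A : algType K) (L : 'M[series A]_N).

Let Lc n := map_mx (fun s => scoef s n) L.
Hypothesis rel : forall a b, yangian_lhs q R Lc a b = yangian_rhs q R Lc a b.

Let cf p n (X : op (series A) N p) : op A N p := map_mx (fun s => scoef s n) X.

Let cfE p n (X : op (series A) N p) a b : cf n X a b = scoef (X a b) n.
Proof. by rewrite mxE. Qed.

Let cfM p n (X Y : op (series A) N p) :
  cf n (X * Y) = \sum_(i < n.+1) cf i X * cf (n - i) Y.
Proof.
have scoef_sum I (r : seq I) (F : I -> series A) m :
    scoef (\sum_(i <- r) F i) m = \sum_(i <- r) scoef (F i) m.
  by elim: r => [|i r IHr]; rewrite ?big_nil // !big_cons /= IHr.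
apply/matrixP => a b; rewrite summxE !mxE scoef_sum /= exchange_big.
by apply: eq_bigr => i _; rewrite mxE; apply: eq_bigr => j _; rewrite !mxE.
Qed.

Let cf_ext p n (X : op K N p) : cf n (ext (series A) X) = if n is 0 then ext A X else 0.
Proof. by case: n => [|n]; apply/matrixP => a b; rewrite !mxE //= scaler0. Qed.

Let cf_extl p n (X : op K N p) Y : cf n (ext (series A) X * Y) = ext A X * cf n Y.
Proof.
rewrite cfM big_ord_recl cf_ext subn0 big1 ?addr0 // => i _.
by rewrite cf_ext mul0r.
Qed.

Let cf_extr p n (X : op K N p) Y : cf n (Y * ext (series A) X) = cf n Y * ext A X.
Proof.
rewrite cfM big_ord_recr /= cf_ext subnn big1 ?add0r // => i _.
rewrite cf_ext; case: (n - i)%N (subn_gt0 i n) => [|m _]; rewrite ?mulr0 //.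
by rewrite ltn_ord.
Qed.

Let cf_dilate c n : cf n (act1 1 1 (map_mx (dilate c) L)) = (c ^- n)%:A *: act1 1 1 (Lc n).
Proof.
apply/matrixP => a b; rewrite !mxE mulr_algl -scalerMnr.
by case: [forall _, _]; rewrite ?mulr1n // !mulr0n /= scaler0.
Qed.

Let scalC p (c : K) (X Y : op A N p) : X * (c%:A *: Y) = c%:A *: (X * Y).
Proof.
apply/matrixP => a b; rewrite !mxE big_distrr /=; apply: eq_bigr => i _.
by rewrite mxE !mulr_algl scalerAr.
Qed.

Let scalA p (c : A) (X Y : op A N p) : (c *: X) * Y = c *: (X * Y).
Proof. by rewrite -[LHS]/(_ *m _) -scalemxAl. Qed.

Let X1 a b := act1 1 1 (Lc a) * ext A (braid R 1 1) * act1 1 1 (Lc b).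

Let cf_two c d n :
  cf n (act1 1 1 (map_mx (dilate c) L) * ext (series A) (braid R 1 1)
        * act1 1 1 (map_mx (dilate d) L)) =
  \sum_(i < n.+1) (c ^- i * d ^- (n - i))%:A *: X1 i (n - i).
Proof.
rewrite cfM; apply: eq_bigr => i _; rewrite cf_extr !cf_dilate !scalA scalC.
by rewrite scalerA -in_algE -rmorphM.
Qed.

(** The substitution u -> c u, v -> d u makes a double series a single one, with weight c^{-a}
    d^{-b} on the coefficient of u^{-a} v^{-b}. Multiplication by v^{-1} then raises the degree by
    one and contributes d^{-1}; in [sum_uinv], u^{-1} contributes c^{-1}. *)
Let sum_vinv (X : nat -> nat -> op A N 2) c d n :
  \sum_(i < n.+2) (c ^- i * d ^- (n.+1 - i))%:A *: mul_vinv X i (n.+1 - i) =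
  (d^-1)%:A *: \sum_(i < n.+1) (c ^- i * d ^- (n - i))%:A *: X i (n - i)%N.
Proof.
rewrite big_ord_recr /= subnn scaler0 addr0 scaler_sumr; apply: eq_bigr => i _.
rewrite subSn ?leq_ord //= scalerA; congr (_ *: _).
by rewrite -!in_algE -rmorphM exprS invfM mulrCA.
Qed.

Let sum_uinv (X : nat -> nat -> op A N 2) c d n :
  \sum_(i < n.+2) (c ^- i * d ^- (n.+1 - i))%:A *: mul_uinv X i (n.+1 - i) =
  (c^-1)%:A *: \sum_(i < n.+1) (c ^- i * d ^- (n - i))%:A *: X i (n - i)%N.
Proof.
rewrite big_ord_recl /= scaler0 add0r scaler_sumr; apply: eq_bigr => i _.
rewrite /bump /= add1n subSS scalerA; congr (_ *: _).
by rewrite -!in_algE -rmorphM exprS invfM mulrA.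
Qed.

(* (v^{-1} - u^{-1}) R(u, v) at (u, v) := (c u, d u), divided by u^{-1} *)
Definition twist c d : 'M[K]_(N * N) := d^-1 *: (R - (q - q^-1)%:M) - c^-1 *: R.

Let ext_twist c d : ext A (act2 1 1 (twist c d)) =
  (d^-1)%:A *: (ext A (braid R 1 1) - ext A (q - q^-1)%:M)
  - (c^-1)%:A *: ext A (braid R 1 1).
Proof.
have act2Z a (Y : 'M[K]_(N * N)) : act2 1 1 (a *: Y) = a *: act2 1 1 Y.
  by apply/matrixP => i j; rewrite !mxE mulrnAr.
have extZ a (Y : op K N 2) : ext A (a *: Y) = a%:A *: ext A Y.
  by apply/matrixP => i j; rewrite !mxE mulr_algl scalerA.
by rewrite /twist act2B extB !act2Z !extZ act2B act2_scalar // extB.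
Qed.

Lemma two_site c d :
  ext (series A) (act2 1 1 (twist c d)) *
    (act1 1 1 (map_mx (dilate c) L) * ext (series A) (braid R 1 1)
      * act1 1 1 (map_mx (dilate d) L)) =
  act1 1 1 (map_mx (dilate d) L) * ext (series A) (braid R 1 1)
    * act1 1 1 (map_mx (dilate c) L) * ext (series A) (act2 1 1 (twist c d)).
Proof.
suff e n : cf n (ext (series A) (act2 1 1 (twist c d)) *
    (act1 1 1 (map_mx (dilate c) L) * ext (series A) (braid R 1 1)
      * act1 1 1 (map_mx (dilate d) L))) =
  cf n (act1 1 1 (map_mx (dilate d) L) * ext (series A) (braid R 1 1)
    * act1 1 1 (map_mx (dilate c) L) * ext (series A) (act2 1 1 (twist c d))).
  apply/matrixP => a b; apply: seriesP => n.
  exact: etrans (esym (cfE _ _ _ _)) (etrans (congr1 (fun X => fun_of_matrix X a b) (e n)) (cfE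
    _ _ _ _)).
(* The coefficient of degree [n] is governed by the relations with a + b = n + 1, since these carry
   the extra factor v^{-1} - u^{-1}. The sum is finite, so the specialization is legitimate. *)
pose w i := (c ^- i * d ^- (n.+1 - i))%:A : A.
have el : \sum_(i < n.+2) w i *: yangian_lhs q R Lc i (n.+1 - i) =
    ext A (act2 1 1 (twist c d)) * \sum_(i < n.+1) (c ^- i * d ^- (n - i))%:A *: X1 i (n - i).
  rewrite ext_twist mulrBl !scalA -!scalC -sum_vinv -sum_uinv !mulr_sumr -sumrB.
  by apply: eq_bigr => i _; rewrite !scalC -scalerBr.
have er : \sum_(i < n.+2) w i *: yangian_rhs q R Lc i (n.+1 - i) =
    (\sum_(i < n.+1) (c ^- i * d ^- (n - i))%:A *: X1 (n - i) i)
      * ext A (act2 1 1 (twist c d)).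
  rewrite ext_twist mulrBr !scalC -!scalA.
  rewrite -(sum_vinv (fun a b => X1 b a)) -(sum_uinv (fun a b => X1 b a)) !mulr_suml -sumrB.
  by apply: eq_bigr => i _; rewrite !scalA -scalerBr.
rewrite cf_extl cf_extr !cf_two -el.
rewrite [in RHS](reindex_inj rev_ord_inj) /=.
transitivity (\sum_(i < n.+2) w i *: yangian_rhs q R Lc i (n.+1 - i)).
  by apply: eq_bigr => i _; rewrite rel.
rewrite er; congr (_ * _); apply: eq_bigr => i _.
by rewrite subSS subKn ?leq_ord // mulrC.
Qed.
End TwoSite.

(** * The defining relations for the generating matrix *)

Section Generating.
Variables (K : fieldType) (N : nat) (q : K) (R : 'M[K]_(N * N)).

(** The relators vanish in the quotient, and the quotient map, applied entrywise, preserves the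
    expressions on both sides. *)
Lemma generating_relation a b :
  let Lc n := map_mx (fun s => scoef s n) (generating_matrix q R) in
  yangian_lhs q R Lc a b = yangian_rhs q R Lc a b.
Proof.
move=> Lc; have LcE n : Lc n = yangian_coef q R n.
  by apply/matrixP => i j; rewrite !mxE /= !mxE.
pose m (X : op (yangian_free K N) N 2) : op (braided_yangian q R) N 2 :=
  map_mx (quot_pi (@yangian_proper K N q R)) X.
have mB X Y : m (X - Y) = m X - m Y by exact: map_mxB.
have mM X Y : m (X * Y) = m X * m Y by exact: map_mxM.
have m0 : m 0 = 0 by exact: map_mx0.
have mE (X : op K N 2) : m (extend _ X) = extend _ X.
  by apply/matrixP => i j; rewrite !mxE linearZ rmorph1.
have mL n : m (act1 1 1 (yangian_free_coef K N n)) = act1 1 1 (Lc n).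
  by rewrite LcE; apply/matrixP => i j; rewrite !mxE rmorphMn.
have mu (X : nat -> nat -> _) Y i j : (forall i j, m (X i j) = Y i j) ->
    m (mul_uinv X i j) = mul_uinv Y i j by case: i => [|i] h; rewrite /= ?m0 ?h.
have mv (X : nat -> nat -> _) Y i j : (forall i j, m (X i j) = Y i j) ->
    m (mul_vinv X i j) = mul_vinv Y i j by case: j => [|j] h; rewrite /= ?m0 ?h.
have mrel : m (yangian_lhs q R (yangian_free_coef K N) a b)
    = m (yangian_rhs q R (yangian_free_coef K N) a b).
  apply/matrixP => i j; rewrite [LHS]mxE [RHS]mxE; apply/quot_piP; apply: ideal_gen.
  by exists a, b, i, j.
clearbody m.
have two c d : m (act1 1 1 (yangian_free_coef K N c) * extend _ (braid R 1 1)
      * act1 1 1 (yangian_free_coef K N d)) =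
    act1 1 1 (Lc c) * extend _ (braid R 1 1) * act1 1 1 (Lc d).
  by rewrite mM mM mE !mL.
have sub : m (ext (yangian_free K N) (braid R 1 1)
              - ext (yangian_free K N) (q - q^-1)%:M) =
    ext (braided_yangian q R) (braid R 1 1) - ext (braided_yangian q R) (q - q^-1)%:M.
  by apply: (etrans (mB _ _)); apply: (congr2 (fun x y => x - y)); apply: mE.
have el : m (yangian_lhs q R (yangian_free_coef K N) a b) = yangian_lhs q R Lc a b.
  rewrite [LHS]mB; apply: (congr2 (fun x y => x - y)).
    by rewrite mM sub; congr (_ * _); apply: mv => i j; apply: two.
  by rewrite mM mE; congr (_ * _); apply: mu => i j; apply: two.
have er : m (yangian_rhs q R (yangian_free_coef K N) a b) = yangian_rhs q R Lc a b.
  rewrite [LHS]mB; apply: (congr2 (fun x y => x - y)).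
    by rewrite mM sub; congr (_ * _); apply: mv => i j; apply: two.
  by rewrite mM mE; congr (_ * _); apply: mu => i j; apply: two.
exact: etrans (esym el) (etrans mrel er).
Qed.
End Generating.

(** * Commutation of R_i with the copies L_{\overline k} *)

Lemma braid_conj_comm (B : pzRingType) (u v U V O : B) :
    u * v * u = v * u * v -> u * U = 1 -> U * u = 1 -> v * V = 1 -> V * v = 1 ->
    v * O = O * v ->
  u * (v * (u * O * U) * V) = v * (u * O * U) * V * u.
Proof.
move=> uvu uU Uu vV Vv vO.
have vUV : v * (U * V) = U * V * u.
  have ZW : U * V * (v * u) = 1 by rewrite mulrA -(mulrA U) Vv mulr1.
  have WZ : v * u * (U * V) = 1 by rewrite mulrA -(mulrA v) uU mulr1.
  rewrite -[LHS]mul1r -ZW mulrA -(mulrA (U * V)) -uvu -(mulrA u v u).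
  by rewrite [U * V * _]mulrA -[_ * _ * (U * V)]mulrA WZ mulr1.
rewrite !mulrA uvu -(mulrA (v * u)) vO -!mulrA; congr (_ * (_ * (_ * _))).
by rewrite vUV mulrA.
Qed.

Lemma comm_inverse (B : pzRingType) (u U Y : B) :
  u * U = 1 -> U * u = 1 -> u * Y = Y * u -> U * Y = Y * U.
Proof.
by move=> uU Uu uY; rewrite -[LHS]mulr1 -uU mulrA -(mulrA U) -uY mulrA Uu mul1r.
Qed.

Lemma comm_conj (B : pzRingType) (u v V O : B) :
    v * u = u * v -> V * u = u * V -> u * O = O * u ->
  u * (v * O * V) = v * O * V * u.
Proof. by move=> vu Vu uO; rewrite -[RHS]mulrA Vu !mulrA -(mulrA v) -uO mulrA vu. Qed.

Section Overline.
Variables (K : fieldType) (N : nat) (q : K) (R Psi : 'M[K]_(N * N)).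
Hypothesis q_neq0 : q != 0.
Hypothesis hecke : hecke_symmetry q R.
Hypothesis skew : skew_inverse R Psi.
Variables (A : algType K).
Implicit Type X : 'M[series A]_N.

Local Notation lam := (q - q^-1).
Local Notation b n i := (ext (series A) (braid R n i)).
Local Notation bV n i := (ext (series A) (invmx (braid R n i))).
Local Notation shft := (shift q R (A := series A)).

Lemma mulbV n i : (0 < i <= n)%N -> b n i * bV n i = 1.
Proof. by move=> i_n; rewrite -extM (invmx_braid q_neq0 hecke) // mulbraidV // ext1. Qed.

Lemma mulVb n i : (0 < i <= n)%N -> bV n i * b n i = 1.
Proof. by move=> i_n; rewrite -extM (invmx_braid q_neq0 hecke) // mulVbraid // ext1. Qed.

Lemma bV_comm n i (Y : op (series A) N n.+1) : (0 < i <= n)%N ->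
  b n i * Y = Y * b n i -> bV n i * Y = Y * bV n i.
Proof.
by move=> i_n; apply: comm_inverse; [exact: mulbV|exact: mulVb].
Qed.

Lemma pad_overline n k X : (0 < k <= n.+1)%N ->
  pad (overline R n k X) = overline R n.+1 k X.
Proof.
elim: k => [|[|k] IHk] kn; [by case: (notF kn)|exact: pad_act1|].
rewrite !overlineSS 2!padM pad_braid ?(pad_braidV q_neq0 hecke) ?IHk //.
by rewrite (ltnW kn).
Qed.

Lemma shift_overline n k X : (0 < k <= n.+1)%N ->
  shft (overline R n k X) = overline R n.+1 k.+1 X.
Proof.
elim: k => [|[|k] IHk] kn; [by case: (notF kn)|exact: (shift_act1 q_neq0 hecke)|].
have e1 := shift_braid q_neq0 hecke (series A) (kn : (0 < k.+1 <= n)%N).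
have e2 := shift_braidV q_neq0 hecke (series A) (kn : (0 < k.+1 <= n)%N).
have e3 := IHk (ltnW kn).
rewrite (overlineSS _ n); apply: etrans (shiftM q_neq0 hecke _ _) _.
apply: (congr2 *%R _ e2); apply: etrans (shiftM q_neq0 hecke _ _) _.
exact: (congr2 *%R e1 e3).
Qed.

Lemma b_braid n i : (0 < i < n)%N -> b n i * b n i.+1 * b n i = b n i.+1 * b n i * b n i.+1.
Proof. by move=> i_n; rewrite -!extM braid_rel // (proj1 hecke). Qed.

Lemma b_comm n i j : (0 < i)%N -> (i.+1 < j <= n)%N -> b n i * b n j = b n j * b n i.
Proof. by move=> i0 ij; rewrite -!extM braid_comm. Qed.

Lemma overline_comm_gt n i k X : (0 < k)%N -> (k < i <= n)%N ->
  b n i * overline R n k X = overline R n k X * b n i.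
Proof.
elim: k => [|[|k] IHk] k0 /andP[ki i_n]; [by case: (notF k0)| |].
  by apply: act1_braid_comm; rewrite ki.
have k_n : (k.+1 <= n)%N by lia.
rewrite overlineSS.
have c1 : b n k.+1 * b n i = b n i * b n k.+1 by apply: b_comm => //; rewrite ki.
have c2 : bV n k.+1 * b n i = b n i * bV n k.+1 by apply: bV_comm.
have IH : b n i * overline R n k.+1 X = overline R n k.+1 X * b n i.
  by apply: IHk => //; lia.
exact: (comm_conj c1 c2 IH).
Qed.

(** The essential case is k = i + 2, where L_{\overline k} = R_{i+1} R_i L_{\bar i} R_i^{-1}
    R_{i+1}^{-1}: the braid relation turns R_i on the left into R_{i+1} next to L_{\bar i}, with
    which it commutes, and back into R_i on the right. Larger k only add conjugations by generators
    that commute with R_i. *)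
Lemma overline_comm_lt n i k X : (0 < i)%N -> (i.+1 < k <= n.+1)%N ->
  b n i * overline R n k X = overline R n k X * b n i.
Proof.
move=> i0; elim: k => [|[|k] IHk] /andP[ik k_n]; [by case: (notF ik)|by case: (notF ik)|].
rewrite overlineSS.
have [lt_ik|] := ltnP i k.
  have c1 : b n k.+1 * b n i = b n i * b n k.+1.
    by apply/esym/b_comm => //; rewrite ltnS lt_ik.
  have c2 : bV n k.+1 * b n i = b n i * bV n k.+1 by apply: bV_comm.
  have IH : b n i * overline R n k.+1 X = overline R n k.+1 X * b n i.
    by apply: IHk; lia.
  exact: (comm_conj c1 c2 IH).
move=> le_ki; have ek : k = i by lia.
subst k; clear IHk ik le_ki; case: i i0 k_n => [i0|i _] k_n; first by case: (notF i0).
rewrite overlineSS; set u := b n i.+1; set v := b n i.+2.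
have uvu : u * v * u = v * u * v by apply: b_braid; lia.
have uO : v * overline R n i.+1 X = overline R n i.+1 X * v.
  by apply: overline_comm_gt => //; lia.
have uV : u * bV n i.+1 = 1 by apply: mulbV; lia.
have Vu : bV n i.+1 * u = 1 by apply: mulVb; lia.
have vV : v * bV n i.+2 = 1 by apply: mulbV; lia.
have Vv : bV n i.+2 * v = 1 by apply: mulVb; lia.
exact: (braid_conj_comm uvu uV Vu vV Vv uO).
Qed.
End Overline.

(** * The two-site relation in any pair of adjacent factors *)

Lemma intertwine_conj (B : pzRingType) (G X Y b V : B) :
  G * (X * b * Y) = Y * b * X * G -> V * G = G * V ->
  G * (X * (b * Y * V)) = Y * (b * X * V) * G.
Proof. by move=> h cV; rewrite !mulrA in h *; rewrite h -!mulrA cV. Qed.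

Section Swap.
Variables (K : fieldType) (N : nat) (q : K) (R : 'M[K]_(N * N)).
Hypothesis q_neq0 : q != 0.
Hypothesis q_generic : forall n : int, n != 0 -> q ^ n != 1.
Hypothesis hecke : hecke_symmetry q R.
Variables (A : algType K) (L : 'M[series A]_N).
Hypothesis rel : forall a b, let Lc n := map_mx (fun s => scoef s n) L in
  yangian_lhs q R Lc a b = yangian_rhs q R Lc a b.

Local Notation lam := (q - q^-1).
Local Notation S := (series A).
Local Notation b n i := (ext S (braid R n i)).
Local Notation bV n i := (ext S (invmx (braid R n i))).
Local Notation shft := (shift q R (A := S)).
Local Notation sc c := (ext S c%:M).

Lemma sc_comm m (c : K) (Y : 'M[S]_m) : sc c * Y = Y * sc c.
Proof.
rewrite ext_scalar; apply/matrixP => i j; rewrite -[LHS]/((_ *m _) _ _) mul_scalar_mx.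
rewrite !mxE mulr_algl (bigD1 j) //= big1 ?addr0 => [|k kj]; last first.
  by rewrite mxE (negPf kj) mulr0.
by rewrite mxE eqxx mulr_algr.
Qed.

Lemma act2_twist n i c d : (0 < i <= n)%N ->
  act2 n i (twist q R c d) =
  (d^-1 - c^-1)%:M * braid R n i - (d^-1 * lam)%:M.
Proof.
move=> i_n; rewrite (_ : twist q R c d = (d^-1 - c^-1)%:M * R - (d^-1 * lam)%:M).
  by rewrite act2B act2M // !act2_scalar.
rewrite /twist scalar_mul scalerBr scale_scalar_mx scalerBl addrAC.
by [].
Qed.

Definition twist_op n i c d := ext S (act2 n i (twist q R c d)).

Lemma twist_opE n i c d : (0 < i <= n)%N ->
  twist_op n i c d = sc (d^-1 - c^-1) * b n i - sc (d^-1 * lam).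
Proof. by move=> i_n; rewrite /twist_op act2_twist // extB extM. Qed.

Lemma twist_op_comm n i c d (Y : op S N n.+1) : (0 < i <= n)%N ->
  b n i * Y = Y * b n i -> twist_op n i c d * Y = Y * twist_op n i c d.
Proof.
move=> i_n bY; rewrite twist_opE // [LHS]mulrBl [RHS]mulrBr.
apply: (congr2 (fun x y => x - y)); last exact: sc_comm.
by rewrite -mulrA bY !mulrA (sc_comm _ Y).
Qed.

Lemma pad_twist_op n i c d : (0 < i <= n)%N -> pad (twist_op n i c d) = twist_op n.+1 i c d.
Proof. by move=> i_n; rewrite /twist_op -ext_pad pad_act2. Qed.

Lemma shift_twist_op n i c d : (0 < i <= n)%N -> shft (twist_op n i c d) = twist_op n.+1 i.+1 c
  d.
Proof.
move=> i_n; have i_n' : (0 < i.+1 <= n.+1)%N by case/andP: i_n.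
have sS p x : shft (sc x : op S N p) = sc x.
  by rewrite !ext_scalar; apply: (shift_scalar q_neq0 hecke).
rewrite !twist_opE //; apply: etrans (shiftB q R _ _) _.
apply: (congr2 (fun x y => x - y)); last exact: sS.
apply: etrans (shiftM q_neq0 hecke _ _) _; apply: (congr2 *%R); first exact: sS.
exact: (shift_braid q_neq0 hecke).
Qed.

Local Notation O n i c := (overline R n i (map_mx (dilate c) L)).

(** [shift] moves the relation one position to the right and [pad] adds a factor at the end; both
    are multiplicative, so only the case of two factors uses [two_site]. *)
Lemma two_site_at n i c d : (0 < i <= n)%N ->
  twist_op n i c d * (O n i c * O n i.+1 d) = O n i d * O n i.+1 c * twist_op n i c d.
Proof.
elim: n i => [|n IHn] [|[|i]] i_n; [by case: (notF i_n)|by case: (notF i_n)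
  |by case: (notF i_n)|by case: (notF i_n)| |]; last first.
  have i_n' : (0 < i.+1 <= n)%N by [].
  have [k1 k2] : (0 < i.+1 <= n.+1)%N /\ (0 < i.+2 <= n.+1)%N.
    by split; lia.
  have eG := shift_twist_op c d i_n'.
  have s2 a a' : shft (O n i.+1 a * O n i.+2 a') = O n.+1 i.+2 a * O n.+1 i.+3 a'.
    by apply: etrans (shiftM q_neq0 hecke _ _) _; apply: (congr2 *%R); apply: (shift_overline
      q_neq0 hecke).
  have el : shft (twist_op n i.+1 c d * (O n i.+1 c * O n i.+2 d)) =
      twist_op n.+1 i.+2 c d * (O n.+1 i.+2 c * O n.+1 i.+3 d).
    exact: (etrans (shiftM q_neq0 hecke _ _) (congr2 *%R eG (s2 c d))).
  have er : shft (O n i.+1 d * O n i.+2 c * twist_op n i.+1 c d) =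
      O n.+1 i.+2 d * O n.+1 i.+3 c * twist_op n.+1 i.+2 c d.
    exact: (etrans (shiftM q_neq0 hecke _ _) (congr2 *%R (s2 d c) eG)).
  apply: etrans (esym el) _; apply: etrans _ er.
  exact: (congr1 (@shift K N q R S n.+1) (IHn i.+1 i_n')).
case: n IHn i_n => [|n] IHn i_n.
  have h := two_site rel c d.
  (* R_1^{-1} commutes with the twist, a polynomial in R_1; multiplying by it on the right turns L_1
     R_1 L_1 into L_{\bar 1} L_{\bar 2}. *)
  have cV : bV 1 1 * twist_op 1 1 c d = twist_op 1 1 c d * bV 1 1.
    by apply: (bV_comm q_neq0 hecke); [by []|apply: esym; apply: twist_op_comm].
  rewrite !overlineSS -!/(twist_op 1 1 c d) in h *.
  rewrite -[overline _ _ _ (map_mx (dilate c) L)]/(act1 1 1 (map_mx (dilate c) L)).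
  rewrite -[overline _ _ _ (map_mx (dilate d) L)]/(act1 1 1 (map_mx (dilate d) L)).
  exact: (intertwine_conj h cV).
have i_n' : (0 < 1 <= n.+1)%N by [].
have e := congr1 (@pad S N n.+2) (IHn _ i_n').
have pO := fun k c => @pad_overline K N q R q_neq0 hecke A n.+1 k (map_mx (dilate c) L).
have eG := pad_twist_op c d i_n'.
have s2 a a' : pad (O n.+1 1 a * O n.+1 2 a') = O n.+2 1 a * O n.+2 2 a'.
  by apply: etrans (padM _ _) _; apply: (congr2 *%R); apply: pO.
have el : pad (twist_op n.+1 1 c d * (O n.+1 1 c * O n.+1 2 d)) =
    twist_op n.+2 1 c d * (O n.+2 1 c * O n.+2 2 d).
  exact: (etrans (padM _ _) (congr2 *%R eG (s2 c d))).
have er : pad (O n.+1 1 d * O n.+1 2 c * twist_op n.+1 1 c d) =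
    O n.+2 1 d * O n.+2 2 c * twist_op n.+2 1 c d.
  exact: (etrans (padM _ _) (congr2 *%R (s2 d c) eG)).
exact: etrans (esym el) (etrans e er).
Qed.
End Swap.

(** * Products of shifted generating matrices *)

(** A reversal is a composition of adjacent swaps. The bound in the hypothesis restricts it to lists
    of at most n + 1 entries, one per tensor factor. *)
Lemma rev_by_swaps (V T : Type) (F : seq T -> V) n (s : seq T) :
    (forall p a a' t, (size p + size t < n)%N ->
      F (p ++ a :: a' :: t) = F (p ++ a' :: a :: t)) ->
  (size s <= n.+1)%N -> F s = F (rev s).
Proof.
move=> swap; have move1 a p s' t : (size p + size s' + size t <= n)%N ->
    F (p ++ a :: s' ++ t) = F (p ++ s' ++ a :: t).
  elim: s' p => [|c s' IHs] p //= h; rewrite swap ?size_cat; last by lia.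
  by rewrite -!(cat_rcons c) IHs // size_rcons; lia.
suff gen t : (size s + size t <= n.+1)%N -> F (s ++ t) = F (rev s ++ t).
  by move=> sn; have := gen [::]; rewrite !cats0; apply; rewrite addn0.
elim: s t => [|a s IHs] t //= st.
rewrite -[LHS]/(F ([::] ++ a :: s ++ t)) move1 /=; last by lia.
by rewrite IHs ?rev_cons ?cat_rcons //=; lia.
Qed.

Section Intertwining.
Variable B : pzRingType.
Implicit Types c m s G X Y P b : B.

Lemma intertwine_product G X Y u v u' v' :
    G * X = X * G -> G * Y = Y * G -> G * (u * v) = u' * v' * G ->
  G * (X * (u * (v * Y))) = X * (u' * (v' * Y)) * G.
Proof.
move=> GX GY Guv; rewrite mulrA GX -!mulrA; congr (_ * _).
by rewrite (mulrA u) mulrA Guv -!mulrA GY.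
Qed.

Lemma eig_shiftl s s' b m Y : b * Y = m * Y -> (s * b - s') * Y = (s * m - s') * Y.
Proof. by move=> e; rewrite !mulrBl -!mulrA e. Qed.

Lemma eig_shiftr s s' b m Y : (forall Z, s * Z = Z * s) ->
  Y * b = Y * m -> Y * (s * b - s') = Y * (s * m - s').
Proof. by move=> sC e; rewrite !sC !mulrBr !mulrA e. Qed.

(** c X' Y = X' G Y = G X Y lies in the image of G, where b acts as m. The factor c, the eigenvalue
    of G on Y, is divided out later by [scI]. *)
Lemma intertwine_left c m G b X X' Y : (forall Z, c * Z = Z * c) ->
    b * G = m * G -> G * X = X' * G -> G * Y = c * Y ->
  c * (b * (X' * Y)) = c * (m * (X' * Y)).
Proof.
move=> cC bG GX GY; have e : X' * Y * c = G * (X * Y).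
  by rewrite -mulrA -cC -GY !mulrA GX.
by rewrite !cC -!mulrA !(mulrA X') e !mulrA bG.
Qed.

Lemma intertwine_right c m G b X X' Y : (forall Z, c * Z = Z * c) ->
    G * b = G * m -> G * X = X' * G -> Y * G = c * Y ->
  c * (Y * X * b) = c * (Y * X * m).
Proof. by move=> cC Gb GX YG; rewrite !mulrA -YG -(mulrA Y) GX -!mulrA Gb. Qed.

(** c P X P = P G X P = P X' G P = c P X' P. *)
Lemma intertwine_both c G X X' P : (forall Z, c * Z = Z * c) ->
    G * X = X' * G -> G * P = c * P -> P * G = c * P ->
  c * (P * X * P) = c * (P * X' * P).
Proof.
move=> cC GX GP PG; rewrite !mulrA -PG -(mulrA P) GX [in RHS]PG.
by rewrite mulrA -[LHS]mulrA GP mulrA -cC !mulrA.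
Qed.
End Intertwining.

Section Chains.
Variables (K : fieldType) (N : nat) (q : K) (R : 'M[K]_(N * N)).
Hypothesis q_neq0 : q != 0.
Hypothesis q_generic : forall n : int, n != 0 -> q ^ n != 1.
Hypothesis hecke : hecke_symmetry q R.
Variables (A : algType K) (L : 'M[series A]_N).
Hypothesis rel : forall a b, let Lc n := map_mx (fun s => scoef s n) L in
  yangian_lhs q R Lc a b = yangian_rhs q R Lc a b.

Local Notation lam := (q - q^-1).
Local Notation S := (series A).
Local Notation b n i := (ext S (braid R n i)).
Local Notation sc c := (ext S c%:M).

Lemma scM m x y : sc x * sc y = sc (x * y) :> 'M[S]_m.
Proof. by rewrite -extM scalar_mul scale_scalar_mx. Qed.

Lemma sc1 m : sc 1 = 1 :> 'M[S]_m.
Proof. exact: ext1. Qed.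

Lemma scI m x (Y Z : 'M[S]_m) : x != 0 -> sc x * Y = sc x * Z -> Y = Z.
Proof.
move=> x0 e; rewrite -[Y]mul1r -[Z]mul1r -sc1 -(mulVf x0) -scM -!mulrA.
by apply: (congr1 (fun Y => _ * Y)).
Qed.

Definition overlineL n i a := overline R n i (map_mx (dilate (q ^- (2 * a))) L).

(* L_{m+1}(q^{-2 s_0} u) L_{m+2}(q^{-2 s_1} u) ..., all indices being overlined *)
Fixpoint chain n m s : op S N n.+1 :=
  if s is a :: s' then overlineL n m.+1 a * chain n m.+1 s' else 1.

Lemma chain_cat n m s t : chain n m (s ++ t) = chain n m s * chain n (m + size s) t.
Proof.
elim: s m => [|a s IHs] m /=; first by rewrite addn0 mul1r.
by rewrite IHs -mulrA addSnnS.
Qed.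

Lemma chain_comm n i m s : (0 < i <= n)%N -> (m + size s <= n.+1)%N ->
  (i < m)%N \/ (m + size s < i)%N -> b n i * chain n m s = chain n m s * b n i.
Proof.
move=> /andP[i0 i_n]; elim: s m => [|a s IHs] m /= ms im; first by rewrite mulr1 mul1r.
have e1 : b n i * overlineL n m.+1 a = overlineL n m.+1 a * b n i.
  case: im => im; first by apply: (overline_comm_lt q_neq0 hecke) => //; lia.
  by apply: (overline_comm_gt q_neq0 hecke) => //; lia.
have e2 : b n i * chain n m.+1 s = chain n m.+1 s * b n i by apply: IHs; lia.
move: (overlineL n m.+1 a) (chain n m.+1 s) e1 e2 => X Y e1 e2.
by rewrite mulrA e1 -!mulrA e2.
Qed.

Local Notation T n i a a' := (twist_op q R A n i (q ^- (2 * a)) (q ^- (2 * a'))).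

Lemma chain_swap n p a a' t : (size p + size t < n)%N ->
  let i := (size p).+1 in
  T n i a a' * chain n 0 (p ++ a :: a' :: t) = chain n 0 (p ++ a' :: a :: t) * T n i a a'.
Proof.
move=> pt i; have i_n : (0 < i <= n)%N by rewrite /i; lia.
rewrite !chain_cat !add0n.
have e1 : T n i a a' * chain n 0 p = chain n 0 p * T n i a a'.
  apply: twist_op_comm => //; apply: chain_comm => //; first by lia.
  by right; rewrite /i; lia.
have e2 : T n i a a' * chain n i.+1 t = chain n i.+1 t * T n i a a'.
  apply: twist_op_comm => //; apply: chain_comm => //.
  by rewrite /i; lia.
have e3 : T n i a a' * (overlineL n i a * overlineL n i.+1 a') = overlineL n i a' * overlineL n
  i.+1 a * T n i a a'.
  exact: (two_site_at q_neq0 hecke rel).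
exact: intertwine_product e1 e2 e3.
Qed.

(* The scalar by which the twist acts where R_i acts by - q^{-1}. *)
Definition twist_eig a a' : K := q^-1 * (q ^+ (2 * a) - q ^+ (2 * a'.+1)).

Lemma twist_eig_neq0 a a' : a != a'.+1 -> twist_eig a a' != 0.
Proof.
move=> aa'; rewrite mulf_neq0 ?invr_eq0 // subr_eq0; apply: contra aa' => /eqP e.
have := expq_inj q_neq0 q_generic e; lia.
Qed.

Lemma twist_eigE a a' : (q ^+ (2 * a') - q ^+ (2 * a)) * - q^-1 - q ^+ (2 * a') * lam =
  twist_eig a a'.
Proof.
rewrite /twist_eig mulnS exprD; move: (q ^+ (2 * a)) (q ^+ (2 * a')) => x y.
by field.
Qed.

Lemma sc_twist_eig m a a' :
  sc ((q ^- (2 * a'))^-1 - (q ^- (2 * a))^-1) * sc (- q^-1)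
    - sc ((q ^- (2 * a'))^-1 * lam) = sc (twist_eig a a') :> 'M[S]_m.
Proof. by rewrite scM -extB -raddfB !invrK twist_eigE. Qed.

Lemma twist_op_eigl n i a a' Y : (0 < i <= n)%N -> b n i * Y = sc (- q^-1) * Y ->
  T n i a a' * Y = sc (twist_eig a a') * Y.
Proof.
move=> i_n e; rewrite (twist_opE _ _ _ _ _ i_n); apply: etrans (eig_shiftl _ _ e) _.
exact: (congr1 (fun Z => Z * Y) (sc_twist_eig _ _ _)).
Qed.

Lemma twist_op_eigr n i a a' Y : (0 < i <= n)%N -> Y * b n i = Y * sc (- q^-1) ->
  Y * T n i a a' = sc (twist_eig a a') * Y.
Proof.
move=> i_n e; rewrite (twist_opE _ _ _ _ _ i_n); apply: etrans (eig_shiftr _ (sc_comm _) e) _.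
by apply: etrans (congr1 (fun Z => Y * Z) (sc_twist_eig _ _ _)) _; rewrite sc_comm.
Qed.

Lemma braid_hecke n i : (0 < i <= n)%N ->
  (q%:M - braid R n i) * ((q^-1)%:M + braid R n i) = 0.
Proof.
move=> i_n; have := congr1 (act2 n i) (proj2 hecke).
rewrite act2M // act2B act2D !act2_scalar // => e; apply: etrans e _.
by apply/matrixP => x y; rewrite !mxE mul0rn.
Qed.

(** At the parameters q^{-2a} and q^{-2(a+1)} the twist is q^{2a}(1 - q^2)(q - R_i), which the Hecke
    relation makes an eigenvector of R_i on both sides. This is the reason for the spacing by
    q^{-2}. *)
Lemma twist_op_hecke n i a : (0 < i <= n)%N ->
  b n i * T n i a a.+1 = sc (- q^-1) * T n i a a.+1 /\
  T n i a a.+1 * b n i = T n i a a.+1 * sc (- q^-1).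
Proof.
move=> i_n; have h := braid_hecke i_n; have h' := hecke_relC h.
have qV : braid R n i - (- q^-1)%:M = (q^-1)%:M + braid R n i.
  by rewrite raddfN opprK addrC.
have hl : braid R n i * (q%:M - braid R n i) = (- q^-1)%:M * (q%:M - braid R n i).
  by apply/eqP; rewrite -subr_eq0 -mulrBl qV h'.
have hr : (q%:M - braid R n i) * braid R n i = (q%:M - braid R n i) * (- q^-1)%:M.
  by apply/eqP; rewrite -subr_eq0 -mulrBr qV h.
have -> : T n i a a.+1 = sc (q ^+ (2 * a) * (1 - q ^+ 2)) * ext S (q%:M - braid R n i).
  rewrite /twist_op act2_twist // !invrK -extM; congr (ext _ _).
  have -> : q ^+ (2 * a.+1) - q ^+ (2 * a) = - (q ^+ (2 * a) * (1 - q ^+ 2)).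
    by rewrite mulnS exprD; ring.
  have -> : q ^+ (2 * a.+1) * lam = - (q ^+ (2 * a) * (1 - q ^+ 2)) * q.
    by rewrite mulnS exprD; field.
  move: (q ^+ (2 * a) * _) (braid R n i) => x B.
  by rewrite raddfN mulNr mulNr raddfN opprK addrC mulrBr !scalar_mul scale_scalar_mx.
split; first by rewrite mulrA -sc_comm -mulrA -extM hl extM !mulrA sc_comm.
by rewrite -mulrA -extM hr extM !mulrA.
Qed.

(** In [chain_swap] the product with the descending pair stands to the left of the twist, so it
    preserves eigenvectors lying on its right; the ascending pair stands to the right of the twist
    and in [chain_asc] preserves those on its left. *)
Lemma chain_desc n i p a t Y : i = (size p).+1 -> (size p + size t < n)%N ->
    b n i * Y = sc (- q^-1) * Y ->
  b n i * (chain n 0 (p ++ a.+1 :: a :: t) * Y) =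
  sc (- q^-1) * (chain n 0 (p ++ a.+1 :: a :: t) * Y).
Proof.
move=> -> pt e; have i_n : (0 < (size p).+1 <= n)%N by lia.
have g0 : twist_eig a a.+1 != 0 by apply: twist_eig_neq0; lia.
have [h _] := twist_op_hecke a i_n.
have e1 := chain_swap a a.+1 pt; have e2 := twist_op_eigl a a.+1 i_n e.
exact: (scI g0 (intertwine_left (sc_comm _) h e1 e2)).
Qed.

Lemma chain_asc n i p a t Y : i = (size p).+1 -> (size p + size t < n)%N ->
    Y * b n i = Y * sc (- q^-1) ->
  Y * chain n 0 (p ++ a :: a.+1 :: t) * b n i =
  Y * chain n 0 (p ++ a :: a.+1 :: t) * sc (- q^-1).
Proof.
move=> -> pt e; have i_n : (0 < (size p).+1 <= n)%N by lia.
have g0 : twist_eig a a.+1 != 0 by apply: twist_eig_neq0; lia.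
have [_ h] := twist_op_hecke a i_n.
have e1 := chain_swap a a.+1 pt; have e2 := twist_op_eigr a a.+1 i_n e.
exact: (scI g0 (intertwine_right (sc_comm _) h e1 e2)).
Qed.

(* At least one of [twist_eig a a'] and [twist_eig a' a] is nonzero. *)
Lemma chain_sandwich n p a a' t P : (size p + size t < n)%N ->
    (forall i, (0 < i <= n)%N -> b n i * P = sc (- q^-1) * P) ->
    (forall i, (0 < i <= n)%N -> P * b n i = P * sc (- q^-1)) ->
  P * chain n 0 (p ++ a :: a' :: t) * P = P * chain n 0 (p ++ a' :: a :: t) * P.
Proof.
move=> pt Pl Pr; have i_n : (0 < (size p).+1 <= n)%N by lia.
have swap c c' : c != c'.+1 ->
    P * chain n 0 (p ++ c :: c' :: t) * P = P * chain n 0 (p ++ c' :: c :: t) * P.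
  move=> cc; have e1 := chain_swap c c' pt; have e2 := twist_op_eigl c c' i_n (Pl _ i_n).
  have e3 := twist_op_eigr c c' i_n (Pr _ i_n).
  exact: (scI (twist_eig_neq0 cc) (intertwine_both (sc_comm _) e1 e2 e3)).
have [/eqP e|ne] := eqVneq a a'.+1; last exact: swap.
by apply/esym/swap; lia.
Qed.

Lemma chain_rev n s P : (size s <= n.+1)%N ->
    (forall i, (0 < i <= n)%N -> b n i * P = sc (- q^-1) * P) ->
    (forall i, (0 < i <= n)%N -> P * b n i = P * sc (- q^-1)) ->
  P * chain n 0 s * P = P * chain n 0 (rev s) * P.
Proof.
move=> sn Pl Pr; apply: (rev_by_swaps (F := fun s => P * chain n 0 s * P) _ sn).
by move=> p a a' t pt; apply: chain_sandwich.
Qed.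
End Chains.

(** * Newton identities *)

Section ExtMorphism.
Variables (K : fieldType) (A : algType K) (m : nat).

Fact ext_zmod_morphism : zmod_morphism (@ext K A m).
Proof. exact: extB. Qed.

Fact ext_monoid_morphism : monoid_morphism (@ext K A m).
Proof. by split; [exact: ext1|exact: extM]. Qed.

HB.instance Definition _ := GRing.isZmodMorphism.Build 'M[K]_m 'M[A]_m
  (@ext K A m) ext_zmod_morphism.
HB.instance Definition _ := GRing.isMonoidMorphism.Build 'M[K]_m 'M[A]_m
  (@ext K A m) ext_monoid_morphism.
End ExtMorphism.

Definition descending k l : seq nat := [seq (k - a)%N | a <- index_iota 1 l.+1].

Lemma size_descending k l : size (descending k l) = l.
Proof. by rewrite size_map size_iota subSS subn0. Qed.

Lemma descending_cat m j : descending (m + j) (m + j) = descending (m + j) j ++ descending m m.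
Proof.
rewrite /descending /index_iota !subSS !subn0 addnC iotaD map_cat; congr (_ ++ _).
rewrite add1n -[j.+1]addn1 iotaDl -map_comp; apply: eq_map => a /=.
by rewrite subnDl.
Qed.

Lemma descending_add m j : map (addn m) (descending j j) = descending (m + j) j.
Proof.
rewrite /descending -map_comp; apply/eq_in_map => a; rewrite mem_index_iota => /andP[_ aj] /=.
by rewrite addnBA.
Qed.

Lemma descending_rev k : descending k k = rev (iota 0 k).
Proof.
apply: (eq_from_nth (x0 := 0%N)) => [|i]; rewrite size_descending ?size_rev ?size_iota // => ik.
rewrite nth_rev size_iota // nth_iota ?(nth_map 0%N) ?size_iota ?subSS ?subn0 //.
  by rewrite nth_iota; lia.
lia.
Qed.

Lemma rev_iota_split n i : (0 < i <= n)%N ->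
  rev (iota 0 n.+1) =
  rev (iota (n - i).+2 i.-1) ++ (n - i).+1 :: (n - i)%N :: rev (iota 0 (n - i)).
Proof.
move=> i_n; have -> : n.+1 = ((n - i) + (2 + i.-1))%N by lia.
by rewrite iotaD add0n rev_cat !rev_cons !cat_rcons.
Qed.

Lemma iota_split n i : (0 < i <= n)%N ->
  iota 0 n.+1 = iota 0 i.-1 ++ i.-1 :: i.-1.+1 :: iota i.-1.+2 (n - i).
Proof.
move=> i_n; have -> : n.+1 = (i.-1 + (2 + (n - i)))%N by lia.
by rewrite iotaD add0n.
Qed.

Lemma mul_comm_middle (B : pzRingType) (X Y D E : B) :
  D * Y = Y * D -> X * D * (Y * E) = X * Y * (D * E).
Proof. by move=> DY; rewrite !mulrA -(mulrA X D) DY !mulrA. Qed.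

Lemma sum_alternating (K : pzRingType) (V : lmodType K) (a : nat -> V) l :
  \sum_(1 <= j < l.+1) (-1) ^+ j *: (a j + a j.+1) = (-1) ^+ l *: a l.+1 - a 1%N.
Proof.
elim: l => [|l IHl]; first by rewrite big_geq // expr0 scale1r subrr.
rewrite big_nat_recr //= IHl scalerDr exprS mulN1r !scaleNr.
by rewrite addrACA subrr add0r addrC.
Qed.

Section Newton.
Variables (K : fieldType) (N : nat) (q : K) (R Psi : 'M[K]_(N * N)).
Hypothesis q_neq0 : q != 0.
Hypothesis q_generic : forall n : int, n != 0 -> q ^ n != 1.
Hypothesis hecke : hecke_symmetry q R.
Hypothesis skew : skew_inverse R Psi.
Variables (A : algType K) (L : 'M[series A]_N).
Hypothesis rel : forall a b, let Lc n := map_mx (fun s => scoef s n) L in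
  yangian_lhs q R Lc a b = yangian_rhs q R Lc a b.

Local Notation C := (skew_trace_mx Psi).
Local Notation S := (series A).
Local Notation b n i := (ext S (braid R n i)).
Local Notation sc c := (ext S c%:M).
Local Notation chn := (chain q R L).
Local Notation shft := (shift q R (A := S)).
Local Notation tr := (rtrace_full C).
Local Notation qn := (qnum q).

Let qn0 := qnum_neq0 q_neq0 q_generic.
Let qn1 := qnum1 q_neq0 q_generic.
Let qnS := qnumS q_neq0 q_generic.

(* P^{(m)} in the factors j+1, ..., j+m *)
Definition anti n j m := asym q qn (fun i => braid R n (i + j)) m.

Lemma skew_symmetrizerE n k : skew_symmetrizer q R n k = anti n 0 k.
Proof.
have -> : anti n 0 k = asym q qn (braid R n) k.
  by apply: eq_asym => i _; rewrite addn0.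
elim: k => [|[|k] IHk]; [by []|by []|].
by rewrite (asymS _ _ _ (ltn0Sn k)) -IHk.
Qed.

Lemma braid_hecke_seq n j m : (m + j <= n.+1)%N ->
  hecke_seq q (fun i => braid R n (i + j)) m.
Proof.
move=> mj; split=> [i i_m|i i0 i_m|i i' i0 ii' i_m].
- by apply: braid_hecke => //; lia.
- by rewrite addSn; apply: braid_rel; [exact: (proj1 hecke)|lia].
- by apply: braid_comm; lia.
Qed.

Lemma anti_left n j m i : (m + j <= n.+1)%N -> (0 < i < m)%N ->
  b n (i + j) * ext S (anti n j m) = sc (- q^-1) * ext S (anti n j m).
Proof.
move=> mj i_m; have e := asym_left qn0 qn1 qnS (braid_hecke_seq mj) i_m.
by rewrite -!extM [X in ext S X]e scalar_mul.
Qed.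

Lemma anti_right n j m i : (m + j <= n.+1)%N -> (0 < i < m)%N ->
  ext S (anti n j m) * b n (i + j) = ext S (anti n j m) * sc (- q^-1).
Proof.
move=> mj i_m; have e := asym_right qn0 qn1 qnS (braid_hecke_seq mj) i_m.
by rewrite -!extM [X in ext S X]e mul_scalar.
Qed.

Lemma anti_absorbl n j m (Y : op S N n.+1) :
    (forall i, (0 < i < m)%N -> b n (i + j) * Y = sc (- q^-1) * Y) ->
  ext S (anti n j m) * Y = Y.
Proof.
pose phi : {rmorphism op K N n.+1 -> op S N n.+1} := @ext K S _.
exact: (asym_absorb_morph qn0 qnS (phi := phi)).
Qed.

Lemma anti_absorbr n j m (Y : op S N n.+1) :
    (forall i, (0 < i < m)%N -> Y * b n (i + j) = Y * sc (- q^-1)) ->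
  Y * ext S (anti n j m) = Y.
Proof.
pose phi : {rmorphism op K N n.+1 -> op S N n.+1} := @ext K S _.
exact: (asym_absorb_morphr qn0 qnS (phi := phi)).
Qed.

Lemma full_desc n i (Y : op S N n.+1) : (0 < i <= n)%N ->
    b n i * Y = sc (- q^-1) * Y ->
  b n i * (chn n 0 (descending n.+1 n.+1) * Y) = sc (- q^-1) * (chn n 0 (descending n.+1 n.+1)
    * Y).
Proof.
move=> i_n e; rewrite descending_rev (rev_iota_split i_n).
by apply: chain_desc => //; rewrite !size_rev !size_iota; lia.
Qed.

Lemma full_asc n i (Y : op S N n.+1) : (0 < i <= n)%N ->
    Y * b n i = Y * sc (- q^-1) ->
  Y * chn n 0 (iota 0 n.+1) * b n i = Y * chn n 0 (iota 0 n.+1) * sc (- q^-1).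
Proof.
move=> i_n e; rewrite (iota_split i_n).
by apply: chain_asc => //; rewrite !size_iota; lia.
Qed.

Lemma anti_full_desc n j m : (m + j <= n.+1)%N ->
  ext S (anti n j m) * (chn n 0 (descending n.+1 n.+1) * ext S (anti n j m)) =
  chn n 0 (descending n.+1 n.+1) * ext S (anti n j m).
Proof.
move=> mj; apply: anti_absorbl => i i_m; apply: full_desc; first by lia.
exact: anti_left.
Qed.

(** The definition of e_k has increasing exponents and P on the left; M has decreasing ones and P on
    the right. The former product absorbs a second P on the right, the latter on the left, and
    between two copies of P the order is immaterial. *)
Lemma anti_chain n :
  ext S (anti n 0 n.+1) * chn n 0 (iota 0 n.+1) =
  chn n 0 (descending n.+1 n.+1) * ext S (anti n 0 n.+1).
Proof.
have nn : (n.+1 + 0 <= n.+1)%N by rewrite addn0.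
have al i : (0 < i <= n)%N ->
    b n i * ext S (anti n 0 n.+1) = sc (- q^-1) * ext S (anti n 0 n.+1).
  by move=> i_n; have := @anti_left n 0 n.+1 i nn i_n; rewrite addn0.
have ar i : (0 < i <= n)%N ->
    ext S (anti n 0 n.+1) * b n i = ext S (anti n 0 n.+1) * sc (- q^-1).
  by move=> i_n; have := @anti_right n 0 n.+1 i nn i_n; rewrite addn0.
have e1 := anti_full_desc nn.
have e2 : ext S (anti n 0 n.+1) * chn n 0 (iota 0 n.+1) * ext S (anti n 0 n.+1) =
    ext S (anti n 0 n.+1) * chn n 0 (iota 0 n.+1).
  by apply: anti_absorbr => i i_n; rewrite addn0; apply: full_asc => //; apply: ar.
have e3 : ext S (anti n 0 n.+1) * chn n 0 (iota 0 n.+1) * ext S (anti n 0 n.+1) =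
    ext S (anti n 0 n.+1) * chn n 0 (descending n.+1 n.+1) * ext S (anti n 0 n.+1).
  rewrite descending_rev; apply: chain_rev => //; last by rewrite size_iota.
exact: etrans (esym e2) (etrans e3 (etrans (esym (mulrA _ _ _)) e1)).
Qed.
Lemma prod_chain n m l (g : nat -> nat) :
  \prod_(m.+1 <= a < m.+1 + l) overlineL q R L n a (g a) = chn n m [seq g a | a <- iota m.+1 l].
Proof.
elim: l m => [|l IHl] m; first by rewrite addn0 big_geq.
rewrite big_ltn; last by lia.
rewrite addnS -addSn IHl; reflexivity.
Qed.

(* R_{j-1} ... R_1 *)
Definition braid_word n j : op K N n.+1 := \prod_(1 <= a < j) braid R n (j - a).

Lemma braid_wordS n j : (0 < j)%N -> braid_word n j.+1 = braid R n j * braid_word n j.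
Proof.
move=> j0; rewrite /braid_word big_ltn ?ltnS // subSS subn0 big_add1 /=.
by congr (_ * _); apply: eq_bigr => a _; rewrite subSS.
Qed.

Lemma braid_word_comm n l (X : op K N n.+1) :
    (forall i, (0 < i < l)%N -> braid R n i * X = X * braid R n i) ->
  braid_word n l * X = X * braid_word n l.
Proof.
elim: l => [|[|l] IHl] h.
- by rewrite /braid_word big_geq // mul1r mulr1.
- by rewrite /braid_word big_geq // mul1r mulr1.
have IH : braid_word n l.+1 * X = X * braid_word n l.+1 by apply: IHl => i i_l; apply: h; lia.
by rewrite (braid_wordS _ (ltn0Sn l)) -mulrA IH !mulrA h // ltnSn.
Qed.

Lemma ext_braid_word_comm n l (Y : op S N n.+1) :
    (forall i, (0 < i < l)%N -> b n i * Y = Y * b n i) ->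
  ext S (braid_word n l) * Y = Y * ext S (braid_word n l).
Proof.
elim: l => [|[|l] IHl] h.
- by rewrite /braid_word big_geq // ext1 mul1r mulr1.
- by rewrite /braid_word big_geq // ext1 mul1r mulr1.
have IH : ext S (braid_word n l.+1) * Y = Y * ext S (braid_word n l.+1).
  by apply: IHl => i i_l; apply: h; lia.
have hl : b n l.+1 * Y = Y * b n l.+1 by apply: h; rewrite ltnSn.
rewrite (braid_wordS _ (ltn0Sn l)) extM; apply: etrans (esym (mulrA _ _ _)) _.
apply: etrans (congr1 (fun Z => _ * Z) IH) _; apply: etrans (mulrA _ _ _) _.
by apply: etrans (congr1 (fun Z => Z * _) hl) _; apply: esym (mulrA _ _ _).
Qed.

Lemma anti_braid_word_comm n j m l : (m + j <= n.+1)%N -> (l <= j)%N ->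
  anti n j m * braid_word n l = braid_word n l * anti n j m.
Proof.
move=> mj lj; apply: esym; apply: braid_word_comm => i i_l; apply: esym.
apply: asym_comm => i' i'_m; apply: esym.
by apply: braid_comm; lia.
Qed.

Lemma pad_braid_word n j : (j <= n.+1)%N -> pad (ext S (braid_word n j)) = ext S (braid_word
  n.+1 j).
Proof.
elim: j => [|[|j] IHj] jn.
- by rewrite /braid_word !big_geq // !ext1 pad1.
- by rewrite /braid_word !big_geq // !ext1 pad1.
rewrite !(braid_wordS _ (ltn0Sn j)) 2!extM; apply: etrans (padM _ _) _.
by apply: (congr2 *%R); [exact: pad_braid|apply: IHj; apply: ltnW].
Qed.

Lemma pad_chain n m s : (m + size s <= n.+1)%N -> pad (chn n m s) = chn n.+1 m s.
Proof.
elim: s m => [|a s IHs] m ms; first exact: pad1.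
apply: etrans (padM _ _) _; apply: (congr2 *%R).
  by apply: (pad_overline q_neq0 hecke); move: ms => /=; lia.
by apply: IHs; move: ms => /=; lia.
Qed.

Lemma shift_chain n m s : (m + size s <= n.+1)%N -> shft (chn n m s) = chn n.+1 m.+1 s.
Proof.
elim: s m => [|a s IHs] m ms; first exact: (shift1 q_neq0 hecke).
apply: etrans (shiftM q_neq0 hecke _ _) _; apply: (congr2 *%R).
  by apply: (shift_overline q_neq0 hecke); move: ms => /=; lia.
by apply: IHs; move: ms => /=; lia.
Qed.

Lemma shift_asym n (f f' : nat -> 'M[K]_ _) m :
    (forall i, (0 < i < m)%N -> shft (ext S (f i) : op S N n.+1) = ext S (f' i)) ->
  shft (ext S (asym q qn f m)) = ext S (asym q qn f' m).
Proof.
have sS x : shft (sc x : op S N n.+1) = sc x.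
  by rewrite !ext_scalar; apply: (shift_scalar q_neq0 hecke).
elim: m => [|[|m] IHm] ff.
- by rewrite !ext1; apply: (shift1 q_neq0 hecke).
- by rewrite !ext1; apply: (shift1 q_neq0 hecke).
rewrite !(asymE _ _ _ (ltn0Sn m)) !extM.
have IH : shft (ext S (asym q qn f m.+1)) = ext S (asym q qn f' m.+1).
  by apply: IHm => i i_m; apply: ff; lia.
apply: etrans (shiftM q_neq0 hecke _ _) _; apply: (congr2 *%R); first exact: sS.
apply: etrans (shiftM q_neq0 hecke _ _) _; apply: (congr2 *%R); last exact: IH.
apply: etrans (shiftM q_neq0 hecke _ _) _; apply: (congr2 *%R); first exact: IH.
rewrite !extB; apply: etrans (shiftB q R _ _) _.
apply: (congr2 (fun x y => x - y)); first exact: sS.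
by apply: ff; rewrite ltnSn.
Qed.

Lemma shift_anti n j m : (m + j <= n.+1)%N ->
  shft (ext S (anti n j m)) = ext S (anti n.+1 j.+1 m).
Proof.
move=> mj; apply: shift_asym => i i_m; rewrite addnS.
by apply: (shift_braid q_neq0 hecke); lia.
Qed.

Lemma map_dilate_chain c n m s :
  map_mx (dilate (q ^- (2 * c))) (chn n m s) = chn n m (map (addn c) s).
Proof.
elim: s m => [|a s IHs] m; first exact: map_mx1.
apply: etrans (map_mxM _ _ _) _; apply: (congr2 *%R); last exact: IHs.
apply: etrans (map_dilate_overline _ _ _ _ _) _; rewrite -map_mx_comp /overlineL.
congr (overline _ _ _ _); apply: eq_map_mx => s' /=.
by rewrite dilate_dilate mulnDr exprD invfM.
Qed.

Lemma rtrace_full_sc p c (Y : op S N p) : tr (sc c * Y) = c *: tr Y.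
Proof. by rewrite ext_scalar -rtrace_fullZ -[_ * Y]/(_ *m _) mul_scalar_mx. Qed.

Let trA p (X Y Z : op S N p) : tr (X * (Y * Z)) = tr (X * Y * Z).
Proof. by rewrite mulrA. Qed.

Let trAA p (X Y Z W : op S N p) : tr (X * (Y * (Z * W))) = tr (X * (Y * Z) * W).
Proof. by rewrite !mulrA. Qed.

Let trBl p (X Y Z : op S N p) : tr ((X - Y) * Z) = tr (X * Z) - tr (Y * Z).
Proof. by rewrite mulrBl rtrace_fullB. Qed.

Let trBr p (X Y Z : op S N p) : tr (Z * (X - Y)) = tr (Z * X) - tr (Z * Y).
Proof. by rewrite mulrBr rtrace_fullB. Qed.

Let trextZ n c (M : op S N n.+1) X : tr (M * ext S (c *: X)) = c *: tr (M * ext S X).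
Proof. by rewrite -scalar_mul extM mulrA -sc_comm -mulrA rtrace_full_sc. Qed.

Let trextB n (M : op S N n.+1) X Y :
  tr (M * ext S (X - Y)) = tr (M * ext S X) - tr (M * ext S Y).
Proof. by rewrite extB trBr. Qed.

(** Cyclicity of the R-trace in [X]. It passes to products and differences, hence from the R_i to
    the antisymmetrizers. *)
Definition central n (X : op K N n.+1) :=
  forall Y : op S N n.+1, tr (ext S X * Y) = tr (Y * ext S X).

Lemma central_braid n i : (0 < i <= n)%N -> central (braid R n i).
Proof. by move=> i_n Y; apply: (rtrace_full_braid_comm hecke skew). Qed.

Lemma centralM n (X X' : op K N n.+1) : central X -> central X' -> central (X * X').
Proof.
move=> hX hX' Y; rewrite extM.
apply: etrans (esym (trA _ _ _)) _; apply: etrans (hX _) _.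
apply: etrans (esym (trA _ _ _)) _; apply: etrans (hX' _) _.
exact: esym (trA _ _ _).
Qed.

Lemma centralB n (X X' : op K N n.+1) : central X -> central X' -> central (X - X').
Proof.
move=> hX hX' Y; rewrite extB.
apply: etrans (trBl _ _ _) _.
apply: esym; apply: etrans (trBr _ _ _) _.
exact: esym (congr2 (fun x y => x - y) (hX Y) (hX' Y)).
Qed.

Lemma central_scalar n c : @central n c%:M.
Proof. by move=> Y; rewrite sc_comm. Qed.

Lemma central_anti n j m : (m + j <= n.+1)%N -> central (anti n j m).
Proof.
elim: m => [|[|m] IHm] mj; [exact: central_scalar|exact: central_scalar|].
have IH : central (anti n j m.+1) by apply: IHm; apply: leq_trans mj; lia.
rewrite /anti (asymE _ _ _ (ltn0Sn m)); apply: centralM; first exact: central_scalar.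
apply: centralM; last exact: IH.
apply: centralM; first exact: IH.
apply: centralB; first exact: central_scalar.
by apply: central_braid; lia.
Qed.

Local Notation mono n := (chn n 0 (descending n.+1 n.+1)).

(** The three traces are V_{j+1}, T_{j+1} and V_{j+2}. The recursion produces Q R_{j+1} Q; the
    second Q commutes with R_j ... R_1, moves to the far right and by cyclicity to the front of M,
    where Q M Q = M Q absorbs it. *)
Lemma newton_step n j m : (0 < m)%N -> (m + j.+1 = n.+1)%N ->
  qn m.+1 *: tr (mono n * ext S (anti n j m.+1 * braid_word n j.+1)) =
  q ^+ m *: tr (mono n * ext S (anti n j.+1 m * braid_word n j.+1))
  - qn m *: tr (mono n * ext S (anti n j.+1 m * braid_word n j.+2)).
Proof.
move=> m0 mj; set Q := anti n j.+1 m; set D := braid_word n j.+1.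
have eQ : asym q qn (fun i => braid R n (i.+1 + j)) m = Q.
  by apply: eq_asym => i _; rewrite addnS addSn.
have hs : hecke_seq q (fun i => braid R n (i + j)) m.+1.
  by apply: braid_hecke_seq; lia.
have QD : Q * D = D * Q.
  by apply: anti_braid_word_comm; lia.
have rec : qn m.+1 *: (anti n j m.+1 * D) = q ^+ m *: (Q * D) - qn m *: (Q * braid_word n j.+2
  * Q).
  have e := asym_recl qn0 qn1 qnS m0 hs; rewrite eQ /= in e.
  rewrite scaleAl e mulrBl -!scaleAl; congr (_ - _ *: _).
  by rewrite -mulrA QD braid_wordS // !mulrA add1n.
have cQ : central Q by apply: central_anti; lia.
have absorb : tr (mono n * ext S (Q * braid_word n j.+2 * Q)) = tr (mono n * ext S (Q *
  braid_word n j.+2)).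
  have e := @anti_full_desc n j.+1 m.
  rewrite [in LHS]extM; apply: etrans (trA _ _ _) _.
  apply: etrans (esym (cQ _)) _; rewrite extM.
  apply: etrans (trAA _ _ _ _) _; apply: esym.
  apply: etrans (trA _ _ _) _; apply: esym.
  apply: (congr1 (fun Z => tr (Z * _))); apply: e; lia.
apply: etrans (esym (trextZ _ _ _)) _; rewrite rec.
apply: etrans (trextB _ _ _) _; apply: (congr2 (fun x y => x - y)); first exact: trextZ.
by apply: etrans (trextZ _ _ _) _; rewrite absorb.
Qed.

Lemma tr1 : tr (1 : op S N 0) = 1.
Proof.
pose f : {ffun 'I_0 -> 'I_N} := ffun0 (card_ord 0).
have := congr1 (fun X => entry X f f) (op0_scalar Psi (1 : op S N 0)).
by rewrite entry1 /entry mxE !eqxx => e; apply: esym.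
Qed.

(** The case of zero factors is included because e_0 occurs in the last term of the identity. *)
Lemma elem_symE m : elem_sym q R C L m =
  tr (if m is n.+1 return op S N m
      then chn n 0 (descending n.+1 n.+1) * ext S (anti n 0 n.+1) else 1).
Proof.
case: m => [|n]; first by rewrite tr1.
apply: etrans (rtrace_allE _ _) _; congr (rtrace_full _ _).
apply: etrans (anti_chain n).
apply: (congr2 *%R); first by rewrite -skew_symmetrizerE.
have -> : iota 0 n.+1 = [seq a.-1 | a <- iota 1 n.+1].
  by rewrite (iotaDl 1 0) -map_comp -[LHS]map_id; apply: eq_map.
exact: (prod_chain n 0 n.+1 predn).
Qed.

Lemma power_sumE j : power_sum q R C L j.+1 =
  tr (chn j 0 (descending j.+1 j.+1) * ext S (braid_word j j.+1)).
Proof.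
apply: etrans (rtrace_tailE _ _) _; congr (rtrace_full _ _); apply: (congr2 *%R).
  rewrite /descending /index_iota subSS subn0.
  exact: (prod_chain j 0 j.+1 (fun a => (j.+1 - a)%N)).
by rewrite /braid_word (rmorph_prod (@ext K S _)).
Qed.

Lemma dilate_power_sum m j : dilate (q ^- (2 * m)) (power_sum q R C L j.+1) =
  tr (chn j 0 (descending (m + j.+1) j.+1) * ext S (braid_word j j.+1)).
Proof.
rewrite power_sumE -rtrace_full_dilate; congr (rtrace_full _ _).
apply: etrans (map_mxM _ _ _) _; apply: (congr2 *%R); last exact: map_dilate_ext.
by rewrite map_dilate_chain descending_add.
Qed.

Lemma iter_fshift_anti m j n : n.+1 = (m + j)%N ->
  iter j (fshift q R (A := S)) (fun p => if p is n'.+1 return op S N p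
      then chn n' 0 (descending m m) * ext S (anti n' 0 m) else 1) n.+1 =
  chn n j (descending m m) * ext S (anti n j m).
Proof.
elim: j n => [|j IHj] n nmj; first by [].
rewrite iterS; set F := iter j _ _ in IHj *.
rewrite -[LHS]/(shft (F n)).
case: n nmj => [|n] nmj.
  (* A shift out of zero factors: both sides are 1. *)
  have [m0 j0] : m = 0%N /\ j = 0%N by lia.
  rewrite /F m0 j0 /= /anti /= mul1r ext1; exact: (shift1 q_neq0 hecke).
rewrite IHj; last by lia.
apply: etrans (shiftM q_neq0 hecke _ _) _; apply: (congr2 *%R).
  by apply: shift_chain; rewrite size_descending; lia.
by apply: shift_anti; lia.
Qed.

(** The word R_j ... R_1 of the power sum commutes with the L's in the factors from j + 2 on and
    with the antisymmetrizer there, so the two blocks of L's join to M. *)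
Lemma power_sum_mul_elem_sym n m j : n.+1 = (m + j.+1)%N ->
  dilate (q ^- (2 * m)) (power_sum q R C L j.+1) * elem_sym q R C L m =
  tr (mono n * ext S (anti n j.+1 m * braid_word n j.+1)).
Proof.
move=> nmj.
(* The value of [X] at [p = 0] is a default, as only p >= j + 1 occurs; [Z 0 = 1] accounts for
   e_0. *)
pose X : op_family N S := fun p => if p is n'.+1 return op S N p
  then chn n' 0 (descending (m + j.+1) j.+1) * ext S (braid_word n' j.+1) else 0.
pose Z : op_family N S := fun p => if p is n'.+1 return op S N p
  then chn n' 0 (descending m m) * ext S (anti n' 0 m) else 1.
have Xst p : (j.+1 <= p)%N -> pad (X p) = X p.+1.
  case: p => // p jp; apply: etrans (padM _ _) _; apply: (congr2 *%R).
    by apply: pad_chain; rewrite size_descending.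
  exact: pad_braid_word.
have eX : tr (X j.+1) = dilate (q ^- (2 * m)) (power_sum q R C L j.+1).
  by rewrite dilate_power_sum.
have eZ : tr (Z m) = elem_sym q R C L m.
  by rewrite elem_symE /Z; case: (m).
rewrite -eX -eZ; apply: etrans (esym (rtrace_full_shift_mul q_neq0 hecke skew m Z Xst)) _.
rewrite -nmj; apply: etrans (congr1 (fun W => tr (X n.+1 * W)) (iter_fshift_anti nmj)) _.
have cD : ext S (braid_word n j.+1) * chn n j.+1 (descending m m) = chn n j.+1 (descending m m)
  * ext S (braid_word n j.+1).
  apply: ext_braid_word_comm => i i_j; apply: (chain_comm q_neq0 hecke L).
  - by lia.
  - by rewrite size_descending; lia.
  - by left; lia.
have cA : ext S (anti n j.+1 m * braid_word n j.+1) = ext S (braid_word n j.+1) * ext S (anti n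
  j.+1 m).
  by rewrite anti_braid_word_comm ?extM //; lia.
have eM : mono n = chn n 0 (descending (m + j.+1) j.+1) * chn n j.+1 (descending m m).
  have -> : descending n.+1 n.+1 = descending (m + j.+1) j.+1 ++ descending m m by rewrite nmj
    descending_cat.
  by rewrite chain_cat size_descending.
rewrite cA eM /X; congr (rtrace_full _ _).
exact: mul_comm_middle cD.
Qed.

Theorem newton_identity k : (0 < k)%N ->
  qn k *: elem_sym q R C L k
    + \sum_(1 <= j < k.+1) ((-1) ^+ j * q ^+ (k - j))
        *: (dilate (q ^- (2 * (k - j))) (power_sum q R C L j) * elem_sym q R C L (k - j)%N)
  = 0.
Proof.
case: k => // n _.
(* With k = n + 1, [a j] is (k - j + 1)_q V_j; the end term [a k.+1] vanishes because 0_q = 0. *)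
pose a j : S := qn (n.+2 - j) *: tr (mono n * ext S (anti n j.-1 (n.+2 - j) * braid_word n j)).
have qn_0 : qn 0 = 0 by rewrite /qnum expr0 invr1 subrr mul0r.
have step j : (0 < j <= n.+1)%N -> q ^+ (n.+1 - j) *:
    (dilate (q ^- (2 * (n.+1 - j))) (power_sum q R C L j) * elem_sym q R C L (n.+1 - j)%N)
    = a j + a j.+1.
  case: j => // j /= jn.
  rewrite (@power_sum_mul_elem_sym n); last by lia.
  rewrite /a /= !subSS.
  have [j_n|n_j] := ltnP j n.
    have -> : (n.+1 - j = (n - j).+1)%N by lia.
    by rewrite (@newton_step n j (n - j)%N) ?subn_gt0 ?subrK //; lia.
  (* The last term has m = 0, outside the range of [newton_step]; the antisymmetrizers of lengths 0
     and 1 are both 1, so T_k = V_k. *)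
  have -> : j = n by lia.
  by rewrite subnn subSnn expr0 scale1r qn_0 scale0r addr0 qn1 scale1r.
rewrite (eq_big_nat _ _ (F2 := fun j => (-1) ^+ j *: (a j + a j.+1))); last first.
  by move=> j jn; rewrite -scalerA step.
rewrite sum_alternating {1}/a subnn qn_0 scale0r scaler0 add0r /a subSS subn0 elem_symE.
by rewrite /= /braid_word big_geq // mulr1 subrr.
Qed.
End Newton.

Theorem corollary25 (Rr : realType) (K : fieldType)
    (hK : K = (Rr : fieldType) \/ K = (Rr[i] : fieldType))
    (N : nat) (q : K) (q_neq0 : q != 0)
    (q_generic : forall n : int, n != 0 -> q ^ n != 1)
    (R : 'M[K]_(N * N)) (R_hecke : hecke_symmetry q R)
    (Psi : 'M[K]_(N * N)) (R_skew_inv : skew_inverse R Psi)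
    (k : nat) (k_ge1 : (1 <= k)%N) :
  let C := skew_trace_mx Psi in
  let L := generating_matrix q R in
  let e := elem_sym q R C L in
  let p := power_sum q R C L in
  qnum q k *: e k
    + \sum_(1 <= j < k.+1)
        ((-1) ^+ j * q ^+ (k - j))
          *: (dilate (q ^- (2 * (k - j))) (p j) * e (k - j)%N)
  = 0.
Proof.
exact: (newton_identity q_neq0 q_generic R_hecke R_skew_inv (generating_relation q R)).
Qed.
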